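(* Let $k\ge 3$ be an integer and let $0<\alpha<1/4$. There exists $n_0$ (depending on $k$ and $\alpha$) such that for every $n\ge n_0$ the following holds. Let $G$ be a $k$-graph on the vertex set $[n]=\{1,\dots,n\}$. Suppose that, for every $S\in\binom{[n]}{k-1}$, $$d(S)\ge \min\{\min S,(n-k+2)/2\}+\alpha n.$$ Then $G$ contains a tight Hamiltonian cycle.
   Context: A $k$-graph is a $k$-uniform hypergraph. For a $k$-graph $G$ and $S\subseteq V(G)$, the degree of $S$ is $d(S)=d_G(S)=|\{e\in E(G): S\subseteq e\}|$. Here $\min S$ is the smallest element of $S\subseteq[n]$. A tight Hamiltonian cycle in a $k$-graph is a cyclic ordering of all its vertices such that every $k$ cyclically consecutive vertices form an edge. *)

(* Defs.v *)
From HB Require Import structures.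
From mathcomp Require Import all_boot all_order all_algebra.
From mathcomp Require Import reals.
Set Implicit Arguments.
Unset Strict Implicit.
Unset Printing Implicit Defensive.

Record kgraph (k : nat) (V : finType) := KGraph {
  edges : {set {set V}};
  edges_uniform : forall e, e \in edges -> #|e| = k
}.

Definition degree k (V : finType) (G : kgraph k V) (S : {set V}) : nat :=
  #|[set e in edges G | S \subset e]|.

(* The element [i] of ['I_n] stands for the vertex [i.+1] of {1, ..., n}. All
   labels are at most [n], so the default [n] only matters for [S = set0]. *)
Definition min_label n (S : {set 'I_n}) : nat := \big[minn/n]_(i in S) i.+1.

(* The list [c] is read cyclically: [take k (rot i c)] is the block of [k]
   consecutive vertices starting at position [i]. If [k > size c > 0], the block
   has fewer than [k] vertices and so is never an edge. *)
Definition tight_hamiltonian_cycle k (V : finType) (G : kgraph k V)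
    (c : seq V) : Prop :=
  [/\ uniq c,
      forall v : V, v \in c
    & forall i : nat, i < size c -> [set v in take k (rot i c)] \in edges G].

(* Main.v *)
(* Absorption, with probabilities replaced by averages over tuples of vertices.
   A configuration of positive density has blow-ups of positive density, by
   convexity; and if every request of a polynomial number of kinds is met by a
   positive proportion of all tuples, then a greedy choice, with a potential that
   halves the weight of a request each time it is met, yields disjoint tuples that
   meet each request linearly often.

   Call a vertex top if its label is at least (n-k+2)/2. The degree condition lets
   a tight path climb: its labels rise by a fixed fraction of alpha n every k-1 steps until they
   are top. Any two (k-1)-sets of top vertices have linearly many common
   neighbours, and blowing up two climbing paths with common neighbours of their
   top ends gives a connecting path between any two ends. In the same way, a vertex
   u can be exchanged for some w of larger label, where A u B and A w B are both
   tight, and k top vertices can be exchanged for the vertices of an edge block Z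
   for which X Y and X Z Y are both tight. A path made of such swappers and
   absorbers absorbs any small set of k j vertices, after it has been turned into a
   set of top vertices by repeated swaps.

   The rest is tiled greedily with blow-ups of edges. The tiles are chosen so that
   the 2k-th moment of the deviation of the degrees into the uncovered set U stays
   small; the gradient of this moment is a weight on the vertices, and the degree
   condition inside U provides many edges whose weight is hardly above average.
   Short connectors taken from a reserved bank join the tiles to a cycle; as their
   length is fixed, trimming one tile makes the number of uncovered vertices
   divisible by k. *)

Require Import Defs.
From mathcomp Require Import all_boot all_order all_algebra.
From mathcomp Require Import reals.
From mathcomp Require Import ring lra zify.
Set Implicit Arguments.
Unset Strict Implicit.
Unset Printing Implicit Defensive.
Import Order.TTheory GRing.Theory Num.Theory.

(** * Averages over tuples *)

Local Open Scope ring_scope.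

(** The degree condition yields no common neighbours for two sets with small labels, so connecting
    and absorbing cannot be done there directly; this is why every gadget first moves to top
    vertices. The moment that guides the tiling has exponent [2 k] because the exponent must be even
    and exceed [k - 1]. Weights are rounded to precision [1 / Q], and the moment is kept below
    [rho ^ 2k] with [rho] of order [1 / Q]. By Markov's inequality, the tuples with too small a
    degree into the uncovered set then have density [O(Q ^ - 2k)], whereas the [k - 1]-tuples inside
    a set of about [n / Q] vertices have density of order [Q ^ - (k - 1)]. A large constant [Q]
    makes the exceptions negligible among them. *)

Section Mean.
Variables (R : realType) (V : finType).

Fixpoint mean r (f : seq V -> R) : R :=
  if r is r'.+1 then (\sum_v mean r' (fun p => f (v :: p))) / #|V|%:R
  else f [::].

Lemma eq_mean r f g :
  (forall p, size p = r -> f p = g p) -> mean r f = mean r g.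
Proof.
elim: r f g => [|r IH] f g fg /=; first exact: fg.
by congr (_ / _); apply: eq_bigr => v _; apply: IH => p sp; apply: fg; rewrite /= sp.
Qed.

Lemma ler_mean r f g :
  (forall p, size p = r -> f p <= g p) -> mean r f <= mean r g.
Proof.
elim: r f g => [|r IH] f g fg /=; first exact: fg.
apply: ler_wpM2r; first by rewrite invr_ge0.
by apply: ler_sum => v _; apply: IH => p sp; apply: fg; rewrite /= sp.
Qed.

Lemma meanZ r c f : mean r (fun p => c * f p) = c * mean r f.
Proof.
elim: r f => [|r IH] f //=.
by rewrite mulrA; congr (_ / _); rewrite mulr_sumr; apply: eq_bigr => v _; rewrite IH.
Qed.

Lemma meanD r f g : mean r (fun p => f p + g p) = mean r f + mean r g.
Proof.
elim: r f g => [|r IH] f g //=.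
by rewrite -mulrDl -big_split /=; congr (_ / _); apply: eq_bigr => v _; rewrite IH.
Qed.

Lemma meanN r f : mean r (fun p => - f p) = - mean r f.
Proof.
by rewrite -mulN1r -meanZ; apply: eq_mean => p _; rewrite mulN1r.
Qed.

Lemma meanB r f g : mean r (fun p => f p - g p) = mean r f - mean r g.
Proof. by rewrite meanD meanN. Qed.

Lemma mean0 r : mean r (fun=> 0) = 0.
Proof.
by elim: r => //= r IH; rewrite big1 ?mul0r.
Qed.

Lemma mean_sum (I : Type) (s : seq I) (P : pred I) r (F : I -> seq V -> R) :
  mean r (fun p => \sum_(i <- s | P i) F i p) = \sum_(i <- s | P i) mean r (F i).
Proof.
elim: s => [|i s IH].
  by rewrite big_nil -[RHS](mean0 r); apply: eq_mean => p _; rewrite big_nil.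
rewrite big_cons -IH.
case: ifP => Pi.
  by rewrite -meanD; apply: eq_mean => p _; rewrite big_cons Pi.
by apply: eq_mean => p _; rewrite big_cons Pi.
Qed.

Lemma mean_ge0 r f : (forall p, size p = r -> 0 <= f p) -> 0 <= mean r f.
Proof. by move=> f0; rewrite -(mean0 r); apply: ler_mean. Qed.

Lemma mean_cat a b f :
  mean (a + b) f = mean a (fun p => mean b (fun q => f (p ++ q))).
Proof.
elim: a f => [|a IH] f //=.
by congr (_ / _); apply: eq_bigr => v _; rewrite IH.
Qed.

Lemma mean1E f : mean 1 f = (\sum_v f [:: v]) / #|V|%:R.
Proof. by []. Qed.

Section Nonempty.
Hypothesis V0 : (0 < #|V|)%N.

Lemma card_gt0R : 0 < #|V|%:R :> R. Proof. by rewrite ltr0n. Qed.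
Let n0 := card_gt0R.
Let n1 : #|V|%:R != 0 :> R. Proof. by rewrite gt_eqF. Qed.

Lemma mean_const r c : mean r (fun=> c) = c.
Proof.
elim: r => [|r IH] //=.
rewrite (eq_bigr (fun=> c)) // sumr_const -[c *+ _]mulr_natr cardT -cardE.
by rewrite mulfK.
Qed.

Lemma mean_ex r f c : c <= mean r f -> exists2 p, size p = r & c <= f p.
Proof.
elim: r f => [|r IH] f /=; first by exists [::].
move=> cf; have [v cv] : exists v, c <= mean r (fun p => f (v :: p)).
  apply/existsP; apply: contraLR cf; rewrite negb_exists => /forallP H.
  rewrite -ltNge ltr_pdivrMr //.
  have -> : c * #|V|%:R = \sum_(v : V) c by rewrite sumr_const mulr_natr cardT -cardE.
  have [v0 _] : exists v, v \in V by apply/card_gt0P.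
  rewrite (bigD1 v0) //= [X in _ < X](bigD1 v0) //=.
  apply: ltr_leD; first by rewrite ltNge H.
  by apply: ler_sum => v _; rewrite leNgt; apply/negP => /ltW; apply/negP.
by have [p sp fp] := IH _ cv; exists (v :: p) => //=; rewrite sp.
Qed.

Lemma mean_ind_gt0 r (P : pred (seq V)) :
  0 < mean r (fun p => (P p)%:R) -> exists2 p, size p = r & P p.
Proof.
move=> P0; have [p sp Pp] := mean_ex (lexx (mean r (fun p => (P p)%:R))).
by exists p => //; move: (lt_le_trans P0 Pp); case: (P p) => //; rewrite ltxx.
Qed.

Lemma sum_indE (P : pred V) : \sum_v (P v)%:R = #|[pred v | P v]|%:R :> R.
Proof.
rewrite -sum1_card natr_sum [RHS]big_mkcond /=; apply: eq_bigr => v _.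
by rewrite inE; case: (P v).
Qed.

(** Counting form of a greedy embedding: each new vertex keeps a fraction [c] of the choices. As [Q]
    has to make sense for every prefix, its instances below carry guards on [size p]. *)
Lemma mean_tree r c (Q : pred (seq V)) : 0 <= c -> Q [::] ->
  (forall p, (size p < r)%N -> Q p ->
     c * #|V|%:R <= #|[pred v | Q (rcons p v)]|%:R) ->
  c ^+ r <= mean r (fun p => (Q p)%:R).
Proof.
move=> c0; elim: r Q => [|r IH] Q Q0 HQ /=; first by rewrite Q0.
rewrite ler_pdivlMr // exprSr -mulrA.
have /ler_wpM2l := HQ [::] isT Q0 => /(_ (c ^+ r)) H.
apply: le_trans (H _) _; first exact: exprn_ge0.
rewrite -sum_indE mulr_sumr; apply: ler_sum => v _.
have [Qv|_] := boolP (Q (rcons [::] v)); last first.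
  by rewrite mulr0; apply: mean_ge0.
rewrite mulr1; apply: (IH (fun p => Q (v :: p))) => // p sp Qp.
exact: (HQ (v :: p)).
Qed.

Lemma mean_stage a b c1 c2 (A : pred (seq V)) (B : seq V -> pred (seq V)) :
  0 <= c2 ->
  c1 <= mean a (fun p => (A p)%:R) ->
  (forall p, size p = a -> A p -> c2 <= mean b (fun q => (B p q)%:R)) ->
  c1 * c2 <= mean (a + b) (fun s => (A (take a s) && B (take a s) (drop a s))%:R).
Proof.
move=> c20 HA HB; rewrite mean_cat.
apply: le_trans (_ : mean a (fun p => c2 * (A p)%:R) <= _).
  by rewrite meanZ mulrC; apply: ler_wpM2l.
apply: ler_mean => p sp.
rewrite (@eq_mean b _ (fun q => (A p && B p q)%:R)); last first.
  by move=> q _; rewrite take_size_cat // drop_size_cat.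
have [Ap|_] := boolP (A p) => /=; last by rewrite mulr0; apply: mean_ge0.
by rewrite mulr1; apply: HB.
Qed.

(** Convexity: the power lies above its tangent at [a]. Multiplied by [x], the inductive bound
    exceeds the next tangent by exactly [m.+1 * a ^ m * (x - a) ^ 2]. *)
Lemma tangent m (x a : R) : 0 <= x -> 0 <= a ->
  a ^+ m.+1 + m.+1%:R * a ^+ m * (x - a) <= x ^+ m.+1.
Proof.
move=> x0 a0; elim: m => [|m IH]; first by rewrite !expr1 expr0 mulr1 mul1r; lra.
have /(ler_wpM2l x0) := IH; rewrite -exprS => /(le_trans _); apply.
have am : 0 <= a ^+ m by apply: exprn_ge0.
rewrite -subr_ge0.
have -> : x * (a ^+ m.+1 + m.+1%:R * a ^+ m * (x - a)) -
  (a ^+ m.+2 + m.+2%:R * a ^+ m.+1 * (x - a)) = m.+1%:R * a ^+ m * (x - a) ^+ 2.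
  by rewrite !exprS -(natr1 m.+1); ring.
by rewrite mulr_ge0 ?sqr_ge0 // mulr_ge0.
Qed.

(** Jensen's inequality, by averaging the tangent at the mean of [f]. *)
Lemma power_mean r m f : (forall p, size p = r -> 0 <= f p) ->
  (mean r f) ^+ m <= mean r (fun p => f p ^+ m).
Proof.
move=> f0; case: m => [|m].
  by rewrite expr0 (@eq_mean r _ (fun=> 1)) ?mean_const // => p; rewrite expr0.
set a := mean r f; have a0 : 0 <= a by apply: mean_ge0.
apply: le_trans (ler_mean (f := fun p => a ^+ m.+1 + m.+1%:R * a ^+ m * (f p - a)) _).
  by rewrite meanD mean_const meanZ meanB mean_const -/a subrr mulr0 addr0.
by move=> p sp; apply: tangent => //; apply: f0.
Qed.

Lemma mean_has r (F : {pred V}) :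
  mean r (fun p => (has (mem F) p)%:R) <= r%:R * #|F|%:R / #|V|%:R.
Proof.
elim: r => [|r IH] /=; first by rewrite !mul0r.
apply: le_trans (_ : (\sum_v (mean r (fun p => (v \in F)%:R + (has (mem F) p)%:R))) / #|V|%:R <= _).
  apply: ler_wpM2r; first by rewrite invr_ge0 ltW.
  apply: ler_sum => v _; apply: ler_mean => p _ /=.
  by rewrite -natrD ler_nat; case: (v \in F); case: has.
under eq_bigr do rewrite meanD mean_const.
rewrite big_split /= sum_indE sumr_const cardT -cardE.
rewrite -[mean _ _ *+ _]mulr_natr mulrDl mulfK // -natr1 mulrDl mul1r mulrDl.
rewrite [leRHS]addrC; apply: lerD => //.
Qed.

Lemma sum_mem (p : seq V) : \sum_v (v \in p)%:R <= (size p)%:R :> R.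
Proof. by rewrite sum_indE ler_nat -[leqLHS]/(#|p|) card_size. Qed.

Lemma mean_nuniq r :
  mean r (fun p => (~~ uniq p)%:R) <= (r * r)%:R / #|V|%:R.
Proof.
elim: r => [|r IH] /=; first by rewrite mul0r.
apply: le_trans (_ : (\sum_v (mean r (fun p => (v \in p)%:R + (~~ uniq p)%:R))) / #|V|%:R <= _).
  apply: ler_wpM2r; first by rewrite invr_ge0 ltW.
  apply: ler_sum => v _; apply: ler_mean => p _ /=.
  by rewrite -natrD ler_nat; case: (v \in p); case: uniq.
under eq_bigr do rewrite meanD.
rewrite big_split /= -mean_sum sumr_const cardT -cardE -[mean _ _ *+ _]mulr_natr mulrDl mulfK //.
have H : mean r (fun p => \sum_v (v \in p)%:R) <= r%:R.
  rewrite -[leRHS](mean_const r); apply: ler_mean => p <-; exact: sum_mem.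
apply: le_trans (lerD (ler_wpM2r _ H) IH) _; first by rewrite invr_ge0 ltW.
rewrite -mulrDl; apply: ler_wpM2r; first by rewrite invr_ge0 ltW.
by rewrite -natrD ler_nat; lia.
Qed.

(** Union bound: a repeated vertex costs density [O(1 / n)], and a vertex in [F] costs [r] times the
    density of [F]. *)
Lemma mean_good c r (P : pred (seq V)) (F : {pred V}) :
  c <= mean r (fun p => (P p)%:R) ->
  c - r%:R * #|F|%:R / #|V|%:R - (r * r)%:R / #|V|%:R <=
  mean r (fun p => [&& P p, uniq p & ~~ has (mem F) p]%:R).
Proof.
move=> HP; have := mean_has r F; have := mean_nuniq r => H1 H2.
have : c <= mean r (fun p => [&& P p, uniq p & ~~ has (mem F) p]%:R) +
    (mean r (fun p => (~~ uniq p)%:R) + mean r (fun p => (has (mem F) p)%:R)).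
  rewrite -!meanD; apply: le_trans HP _; apply: ler_mean => p _.
  by rewrite -!natrD ler_nat; case: (P p); case: uniq; case: has.
by move: H1 H2; lra.
Qed.

Lemma mean_all t (a : pred V) :
  mean t (fun p => (all a p)%:R) = (mean 1 (fun p => (all a p)%:R)) ^+ t.
Proof.
elim: t => [|t IH] //=.
rewrite exprSr -IH /= mulrA mulr_sumr; congr (_ / _); apply: eq_bigr => v _.
by case: (a v) => /=; rewrite ?mulr1 ?mulr0 ?mean0.
Qed.

(* [q] lists [r] blocks of [t] vertices; [P] has to hold for each of the [t ^ r]
   ways of choosing one vertex per block. *)
Fixpoint blow t r (P : pred (seq V)) (q : seq V) : bool :=
  if r is r'.+1 then blow t r' (fun p => all (fun v => P (v :: p)) (take t q)) (drop t q)
  else P [::].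

(* Convexity: blowing up one coordinate replaces a density by at least its
   [t]-th power. *)
Lemma mean_blow t r (P : pred (seq V)) :
  (mean r (fun p => (P p)%:R)) ^+ (t ^ r) <= mean (r * t) (fun q => (blow t r P q)%:R).
Proof.
elim: r P => [|r IH] P; first by rewrite expr1.
rewrite mulSn mean_cat.
rewrite (@eq_mean t _ (fun p => mean (r * t) (fun q =>
  (blow t r (fun p' => all (fun v => P (v :: p')) p) q)%:R))); last first.
  by move=> p sp; apply: eq_mean => q _ /=; rewrite take_size_cat // drop_size_cat.
apply: le_trans (ler_mean (fun p _ => IH _)).
(* Jensen is used twice: here with exponent [t ^ r] for the mean over the first block, and below,
   after exchanging the two means, with exponent [t] for the mean over the other coordinates. *)
apply: le_trans (power_mean (t ^ r) _); last by move=> p _; apply: mean_ge0.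
rewrite expnS exprM; apply: lerXn2r; rewrite ?nnegrE ?exprn_ge0 ?mean_ge0 //.
  by move=> p sp; apply: mean_ge0.
have exch (s r' : nat) (F : seq V -> seq V -> R) :
    mean s (fun p => mean r' (F p)) = mean r' (fun p' => mean s (F^~ p')).
  elim: s F => [|s IHs] F //=.
  rewrite (eq_bigr _ (fun v _ => IHs _)) -mean_sum mulrC -meanZ.
  by apply: eq_mean => p _ /=; rewrite mulrC.
rewrite exch.
rewrite [X in X ^+ _](_ : _ = mean r (fun p' => mean 1 (fun v => (all (fun v => P (v :: p')) v)%:R))).
  apply: le_trans (power_mean t _) _; first by move=> p _; apply: mean_ge0.
  by apply: ler_mean => p' _; rewrite (mean_all t).
rewrite -(exch 1%N) /=; congr (_ / _); apply: eq_bigr => v _; apply: eq_mean => p _.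
by rewrite andbT.
Qed.

End Nonempty.

Lemma blowP t r P q x0 (sig : nat -> nat) : size q = (r * t)%N -> blow t r P q ->
  (forall i, (i < r)%N -> (sig i < t)%N) ->
  P (mkseq (fun i => nth x0 q (i * t + sig i)) r).
Proof.
elim: r P q sig => [|r IH] P q sig //= sq.
have st : size (take t q) = t by rewrite size_takel // sq mulSn leq_addr.
move=> HB Hs; have sd : size (drop t q) = (r * t)%N by rewrite size_drop sq mulSn addKn.
have H := IH _ _ (fun i => sig i.+1) sd HB.
have /allP /(_ (nth x0 q (sig 0%N))) := H (fun i => Hs i.+1).
rewrite /mkseq /= mul0n add0n => /(_ _).
have -> : [seq nth x0 q (i * t + sig i)%N | i <- iota 1 r]
   = [seq nth x0 (drop t q) (i * t + sig i.+1)%N | i <- iota 0 r].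
  rewrite (iotaDl 1 0) -map_comp; apply: eq_map => i /=.
  by rewrite nth_drop mulSn addnA.
apply; rewrite -(nth_take x0 (n0 := t)) ?Hs //; apply: mem_nth.
by rewrite st Hs.
Qed.

End Mean.

(** * Greedy selection of disjoint tuples *)

Lemma size_flatten_const (T : Type) (s : seq (seq T)) C :
  all (fun q => size q == C) s -> size (flatten s) = (C * size s)%N.
Proof.
elim: s => [|q s IH] /=; first by rewrite muln0.
by case/andP => /eqP sq /IH; rewrite size_cat sq => ->; rewrite mulnS.
Qed.

Section Greedy.
Variables (R : realType) (V D : finType) (hit : D -> pred (seq V)).
Variables (C : nat) (c : R) (F : {pred V}).
Hypotheses (V0 : (0 < #|V|)%N) (D0 : (0 < #|D|)%N) (c0 : 0 < c).
Hypothesis Hhit : forall d, c <= mean C (fun q => (hit d q)%:R).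

(** Averaged over all tuples, the requests met carry a fraction [c] of the total weight, and still
    [c / 2] if only repetition-free tuples avoiding [F] and the earlier choices count. Some tuple
    attains this average, and halving the weights of the requests it meets removes a fraction
    [c / 4] of the total. *)
Lemma greedy_potential m :
  C%:R * (#|F| + C * m)%:R / #|V|%:R + (C * C)%:R / #|V|%:R <= c / 2 ->
  exists fam : seq (seq V), [/\ size fam = m, all (fun q => size q == C) fam,
    uniq (flatten fam), ~~ has (mem F) (flatten fam) &
    \sum_d (2^-1) ^+ count (hit d) fam <= #|D|%:R * (1 - c / 4) ^+ m].
Proof.
elim: m => [|m IH] Hm.
  exists [::]; split=> //=.
  by rewrite (eq_bigr (fun=> 1)) ?sumr_const // mulr1 cardT -cardE.
have nV : 0 < #|V|%:R :> R by rewrite ltr0n.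
have [|fam [sf sC uf dF Hp]] := IH.
  apply: le_trans Hm; rewrite lerD2r; apply: ler_wpM2r; first by rewrite invr_ge0 ltW.
  by apply: ler_wpM2l => //; rewrite ler_nat; lia.
pose F' := [predU F & mem (flatten fam)].
have cF' : (#|F'| <= #|F| + C * m)%N.
  apply: leq_trans (_ : #|F| + #|mem (flatten fam)| <= _)%N.
    by rewrite -cardUI leq_addr.
  by rewrite leq_add2l -sf -(size_flatten_const sC) card_size.
pose w d : R := (2^-1) ^+ count (hit d) fam.
have w0 d : 0 < w d by rewrite exprn_gt0 // invr_gt0.
pose good d q := [&& hit d q, uniq q & ~~ has (mem F') q].
have Hg d : c / 2 <= mean C (fun q => (good d q)%:R).
  apply: le_trans (mean_good V0 F' (Hhit d)).
  have : C%:R * #|F'|%:R / #|V|%:R + (C * C)%:R / #|V|%:R <= c / 2.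
    apply: le_trans Hm; rewrite lerD2r; apply: ler_wpM2r; first by rewrite invr_ge0 ltW.
    by apply: ler_wpM2l => //; rewrite ler_nat; apply: leq_trans cF' _; lia.
  by lra.
have : c / 2 * \sum_d w d <= mean C (fun q => \sum_d w d * (good d q)%:R).
  rewrite mean_sum mulr_sumr; apply: ler_sum => d _.
  by rewrite meanZ mulrC; apply: ler_wpM2l (Hg d); rewrite ltW.
case/(mean_ex V0) => q sq Hq.
have [d0 _] : exists d, d \in D by apply/card_gt0P.
have S0 : 0 < \sum_d w d.
  by rewrite (bigD1 d0) //= ltr_pwDl // sumr_ge0 // => i _; rewrite ltW.
(* The weighted sum at [q] is positive, so [q] is good for some [d]; in particular it is
   repetition-free and avoids [F']. *)
have [d gd] : exists d, good d q.
  apply/existsP; apply: contraLR Hq; rewrite negb_exists => /forallP Hn.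
  rewrite [X in _ <= X]big1 => [|d _]; last first.
    by have := Hn d; case: (good d q) => // _; rewrite mulr0.
  by rewrite -ltNge mulr_gt0 // divr_gt0.
have /and3P[_ uq dq] := gd.
exists (q :: fam); split => //=.
- by rewrite sf.
- by rewrite sq eqxx.
- rewrite cat_uniq uq uf andbT /=; apply: contra dq => /hasP[v v1 v2].
  by apply/hasP; exists v => //=; rewrite !inE v1 orbT.
- rewrite has_cat negb_or dF andbT; apply: contra dq; apply: sub_has => v /= vF.
  by rewrite !inE; apply/orP; left.
have c4 : c / 4 <= 1.
  have : c <= mean C (fun _ : seq V => 1).
    by apply: le_trans (Hhit d) _; apply: ler_mean => p _; case: hit.
  by rewrite mean_const //; lra.
apply: le_trans (_ : (1 - c / 4) * \sum_d w d <= _); last first.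
  by rewrite exprS mulrCA; apply: ler_wpM2l Hp; lra.
apply: le_trans (_ : \sum_d (w d - 2^-1 * (w d * (good d q)%:R)) <= _).
  apply: ler_sum => d' _; rewrite exprD -/(w d') /good.
  have := w0 d'; case: (hit d' q) => /=; last by rewrite expr0; lra.
  by rewrite uq dq expr1 /=; lra.
by rewrite big_split /= sumrN -mulr_sumr; move: Hq; lra.
Qed.

(** A request met fewer than [h] times alone contributes at least [2 ^ - h] to the potential, but
    [kap * h] steps bring the potential down to [#|D| * 4 ^ - h], which is less. *)
Lemma greedy_family kap h :
  (1 - c / 4) ^+ kap <= 4^-1 -> (#|D| < 2 ^ h)%N ->
  C%:R * (#|F| + C * (kap * h))%:R / #|V|%:R + (C * C)%:R / #|V|%:R <= c / 2 ->
  exists fam : seq (seq V), [/\ size fam = (kap * h)%N, all (fun q => size q == C) fam,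
    uniq (flatten fam), ~~ has (mem F) (flatten fam) &
    forall d, (h <= count (hit d) fam)%N].
Proof.
move=> Hk HD /greedy_potential[fam [? ? ? ? Hp]]; exists fam; split=> // d.
rewrite leqNgt; apply/negP => Hlt.
have c4 : c / 4 <= 1.
  have : c <= mean C (fun _ : seq V => 1).
    by apply: le_trans (Hhit d) _; apply: ler_mean => p _; case: hit.
  by rewrite mean_const //; lra.
have H1 : (2^-1) ^+ h <= \sum_d (2^-1) ^+ count (hit d) fam :> R.
  rewrite (bigD1 d) //= -[leLHS]addr0; apply: lerD.
    by apply: ler_wiXn2l; rewrite ?invr_ge0 ?invf_le1 ?ler1n // ltnW.
  by apply: sumr_ge0 => i _; rewrite exprn_ge0 // invr_ge0.
have H2 : #|D|%:R * (1 - c / 4) ^+ (kap * h) < (2 ^ h)%:R * (4^-1) ^+ h :> R.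
  apply: le_lt_trans (_ : #|D|%:R * 4^-1 ^+ h < _).
    apply: ler_wpM2l => //; rewrite exprM; apply: lerXn2r => //; rewrite nnegrE.
      by apply: exprn_ge0; lra.
    by rewrite invr_ge0.
  by rewrite ltr_pM2r ?ltr_nat // exprn_gt0 // invr_gt0.
have := le_lt_trans (le_trans H1 Hp) H2.
rewrite natrX -exprMn (_ : 2 * 4^-1 = 2^-1) ?ltxx //.
by field.
Qed.

End Greedy.

Local Close Scope ring_scope.

(** * Tight paths and cycles *)

Section Tight.
Variables (V : finType) (k : nat) (E : {set {set V}}).
Hypothesis E_unif : forall e, e \in E -> #|e| = k.

Definition edge (s : seq V) : bool := [set v in s] \in E.

(** A list shorter than [k] has no window and is therefore tight. *)
Definition tight (s : seq V) : bool :=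
  all (fun i => edge (take k (drop i s))) (iota 0 ((size s).+1 - k)).

Lemma tightP s :
  reflect (forall i, i + k <= size s -> edge (take k (drop i s))) (tight s).
Proof.
apply: (iffP allP) => H i Hi; first by apply: (H i); rewrite mem_iota; lia.
by move: Hi; rewrite mem_iota => Hi; apply: (H i); lia.
Qed.

Lemma eq_edge s s' : s =i s' -> edge s = edge s'.
Proof.
move=> ss'; rewrite /edge (_ : [set v in s] = [set v in s']) //.
by apply/setP => v; rewrite !inE ss'.
Qed.

Lemma edge_uniq s : size s = k -> edge s -> uniq s.
Proof.
by move=> sk /E_unif; rewrite cardsE => H; apply/card_uniqP; rewrite H.
Qed.

Hypothesis k_gt0 : 0 < k.

(** A window that leaves [p ++ a] on the right cannot start before [a], because [a] has at least
    [k.-1] entries. *)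
Lemma tight_cat p a q : k.-1 <= size a ->
  tight (p ++ a) -> tight (a ++ q) -> tight (p ++ a ++ q).
Proof.
move=> ka /tightP H1 /tightP H2; apply/tightP => i; rewrite !size_cat => Hi.
have [le|lt] := leqP (i + k) (size p + size a).
  have -> : take k (drop i (p ++ a ++ q)) = take k (drop i (p ++ a)).
    rewrite catA drop_cat size_cat; case: ltnP => H; last by lia.
    by rewrite takel_cat // size_drop size_cat; lia.
  by apply: H1; rewrite size_cat.
have := H2 (i - size p); rewrite size_cat => H.
by rewrite drop_cat ltnNge (_ : size p <= i) /=; [apply: H|]; lia.
Qed.

Lemma tight_prefix p q : tight (p ++ q) -> tight p.
Proof.
move=> /tightP H; apply/tightP => i Hi; have := H i; rewrite size_cat.
move=> /(_ (leq_trans Hi (leq_addr _ _))).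
rewrite drop_cat; case: ltnP => ip; last by lia.
by rewrite takel_cat // size_drop; lia.
Qed.

Lemma tight_suffix p q : tight (p ++ q) -> tight q.
Proof.
move=> /tightP H; apply/tightP => i Hi; have := H (size p + i); rewrite size_cat.
rewrite -addnA leq_add2l => /(_ Hi).
by rewrite drop_cat ltnNge leq_addr /= addKn.
Qed.

Lemma tight_rev s : tight s -> tight (rev s).
Proof.
move=> /tightP H; apply/tightP => i; rewrite size_rev => Hi.
have := H (size s - i - k); rewrite (_ : size s - i - k + k <= _); last by lia.
move=> /(_ isT); rewrite (@eq_edge _ (take k (drop i (rev s)))) // => v.
rewrite drop_rev take_rev size_takel ?leq_subr // mem_rev.
by congr (v \in _); rewrite take_drop; congr drop; congr take; lia.
Qed.

(** Neither list has more than [k] entries, so every window is a final part of [A] followed by an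
    initial part of [A'], and [j] determines it. *)
Lemma tight_pair A A' : size A <= k -> size A' <= k ->
  (forall j, j <= size A -> k <= size A - j + size A' ->
     edge (drop j A ++ take (k - (size A - j)) A')) -> tight (A ++ A').
Proof.
move=> Ak A'k H; apply/tightP => i; rewrite size_cat => Hi.
rewrite drop_cat; case: ltnP => iA.
  have := H i (ltnW iA); rewrite take_cat size_drop ltnNge leq_subLR.
  by rewrite (leq_trans Ak (leq_addl _ _)) /=; apply; lia.
have -> : i - size A = 0 by lia.
have := H (size A) (leqnn _); rewrite drop_size subnn subn0 drop0 /=; apply; lia.
Qed.

Definition cyc_tight c := tight (c ++ take k.-1 c).

(** The buffers [a] and [b] isolate the change: no window meets both [m] and a vertex beyond them,
    and the repeated segment of [k.-1] entries already lies in [f1 ++ a]. *)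
Lemma cyc_tight_replace a b m m' f1 f2 :
  k.-1 <= size a -> k.-1 <= size b -> tight (a ++ m' ++ b) ->
  cyc_tight (f1 ++ (a ++ m ++ b) ++ f2) -> cyc_tight (f1 ++ (a ++ m' ++ b) ++ f2).
Proof.
move=> sa sb Hm; rewrite /cyc_tight.
have T x : take k.-1 (f1 ++ (a ++ x ++ b) ++ f2) = take k.-1 (f1 ++ a).
  by rewrite -!catA catA takel_cat // size_cat; lia.
rewrite !T; set t := take _ _ => Hc.
have H1 : tight (f1 ++ a) by move: Hc; rewrite -!catA catA => /tight_prefix.
have H2 : tight (b ++ f2 ++ t).
  by move: Hc; rewrite -!catA => /tight_suffix/tight_suffix/tight_suffix.
rewrite -!catA; apply: tight_cat => //.
rewrite (catA a m'); apply: (@tight_cat (a ++ m') b) => //.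
by rewrite -catA.
Qed.

Lemma cyc_tight_window c i : k <= size c -> i < size c ->
  cyc_tight c -> edge (take k (rot i c)).
Proof.
move=> kc ic /tightP /(_ i); rewrite size_cat size_takel; last by lia.
move=> /(_ ltac:(lia)); rewrite drop_cat ic /rot !take_cat size_drop.
case: ltnP => // Hk; congr (edge (_ ++ _)).
have [->|Hl] := eqVneq (k - (size c - i)) 0; first by rewrite !take0.
by rewrite !take_takel //; lia.
Qed.

End Tight.

Lemma cyc_tight_hamiltonian k n (G : kgraph k 'I_n) c : 0 < k -> k <= size c ->
  uniq c -> (forall v, v \in c) -> cyc_tight k (edges G) c ->
  tight_hamiltonian_cycle G c.
Proof. by move=> k0 kc uc ac H; split => // i ic; apply: cyc_tight_window. Qed.

(** * The degree condition *)

(* [lia] is slow when the context holds boolean facts that are not arithmetic. *)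
Ltac slia :=
  repeat match goal with h := _ |- _ => clearbody h end;
  repeat match goal with
  | h : ?T |- _ =>
    lazymatch T with
    | is_true (leq _ _) => fail
    | is_true (andb (leq _ _) _) => fail
    | is_true (negb (@eq_op _ _ _)) => fail
    | leq _ _ = false => fail
    | @eq nat _ _ => fail
    | _ => clear h
    end
  end; lia.

Lemma card_ord_lt n m : #|[set v : 'I_n | v < m]| <= m.
Proof.
rewrite cardE -(size_map val) -[X in _ <= X](size_iota 0 m).
apply: uniq_leq_size; first by rewrite map_inj_uniq ?enum_uniq //; apply: val_inj.
by move=> i /mapP[v]; rewrite mem_enum inE mem_iota => vm ->.
Qed.

Lemma min_label_le n (S : {set 'I_n}) v : v \in S -> min_label S <= v.+1.
Proof.
move=> vS; rewrite /min_label; have := mem_index_enum v.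
elim: (index_enum _) => // w r IH; rewrite inE big_cons => /predU1P[<-|vr].
  by rewrite vS geq_minl.
by case: ifP => _; rewrite ?geq_min IH ?orbT.
Qed.

Lemma min_label_leP n (S : {set 'I_n}) x :
  x <= n -> (forall v, v \in S -> x <= v.+1) -> x <= min_label S.
Proof.
move=> xn H; rewrite /min_label; elim/big_rec: _ => // v y vS xy.
by rewrite leq_min H.
Qed.

Lemma min_labelP n (S : {set 'I_n}) u : u \in S ->
  exists2 v, v \in S & min_label S = v.+1.
Proof.
move=> uS; have [v vS Hv] := @arg_minnP _ u (mem S) (@nat_of_ord n) uS.
exists v => //; apply/eqP; rewrite eqn_leq min_label_le //=.
by apply: min_label_leP => // w /Hv.
Qed.

Definition is_top (V : finType) (lab : V -> nat) k (v : V) : bool :=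
  #|V| + 2 <= 2 * (lab v).+1 + k.

Definition nbr (V : finType) (E : {set {set V}}) (s : seq V) : {set V} :=
  [set v | edge E (v :: s)].

(* Labels start at 0, so the paper's label of [v] is [(lab v).+1]; [8 * b] is
   at most [alpha * n], and [is_top] stands for a label of at least
   [(n - k + 2) / 2]. *)
Record dirac (V : finType) (lab : V -> nat) (k b : nat) (E : {set {set V}}) : Prop :=
  Dirac {
  dirac_k : 2 < k;
  dirac_unif : forall e, e \in E -> #|e| = k;
  dirac_lab : forall x, #|[set v | lab v < x]| <= x;
  dirac_deg : forall s : seq V, size s = k.-1 -> uniq s ->
    exists v0, [/\ v0 \in s, forall v, v \in s -> lab v0 <= lab v &
      if is_top lab k v0 then #|V| + 2 + 16 * b <= 2 * #|nbr E s| + k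
      else (lab v0).+1 + 8 * b <= #|nbr E s|];
  dirac_kb : k <= b;
  dirac_bn : 4 * b <= #|V| }.

Section Degree.
Variables (V : finType) (lab : V -> nat) (k b : nat) (E : {set {set V}}).
Hypothesis H : dirac lab k b E.
Let k2 : 2 < k. Proof. exact: dirac_k H. Qed.
Let card_lab := dirac_lab H.
Let HE := dirac_deg H.
Let kb : k <= b. Proof. exact: dirac_kb H. Qed.
Let bn : 4 * b <= #|V|. Proof. exact: dirac_bn H. Qed.
Local Notation n := #|V|.
Local Notation top := (is_top lab k).
Local Notation nbr := (nbr E).

Lemma card_nontop : 2 * #|[set v | ~~ top v]| + k <= n + 2.
Proof.
have kn : k <= n by lia.
suff : #|[set v | ~~ top v]| <= (n + 2 - k)./2 by lia.
apply: leq_trans (card_lab _); apply: subset_leq_card.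
by apply/subsetP => v; rewrite !inE /is_top; lia.
Qed.

Lemma leq_card_cover (A B C D : {set V}) :
  A \subset B :|: (C :|: D) -> #|A| <= #|B| + (#|C| + #|D|).
Proof.
move=> /subset_leq_card /leq_trans; apply.
apply: leq_trans (leq_card_setU _ _) _; rewrite leq_add2l; exact: leq_card_setU.
Qed.

Lemma card_set_seq (s : seq V) : #|[set v in s]| <= size s.
Proof. by rewrite cardsE card_size. Qed.

Lemma many_top (Av : seq V) : size Av <= b ->
  b <= #|[set v | top v && (v \notin Av)]|.
Proof.
move=> sA; have := card_nontop; have := card_set_seq Av.
have : #|[set: V]| <= #|[set v | top v && (v \notin Av)]| +
   (#|[set v | ~~ top v]| + #|[set v in Av]|).
  apply: leq_card_cover; apply/subsetP => v _; rewrite !inE.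
  by case: top; case: (v \in Av).
by rewrite cardsT; lia.
Qed.

(** The climbing step. If the smallest vertex of [s] is top, the degree exceeds the number of
    non-top vertices by [8 * b]; otherwise it is more than [x + 8 * b], while at most [x + b]
    vertices have a label below [x + b]. Either way at least [b] suitable neighbours lie outside
    [Av]. *)
Lemma many_nbr (s Av : seq V) x : size s = k.-1 -> uniq s -> size Av <= b ->
  (forall v, v \in s -> top v || (x <= lab v)) ->
  b <= #|[set v | [&& edge E (v :: s), v \notin Av & top v || (x + b <= lab v)]]|.
Proof.
move=> ss us sA Hx; have := HE ss us; have sAv := card_set_seq Av.
set N := [set v | [&& _, _ & _]]; set B := [set v | ~~ (top v || (x + b <= lab v))].
have Hcov : #|nbr s| <= #|N| + (#|B| + #|[set v in Av]|).
  apply: leq_card_cover; apply/subsetP => v; rewrite /N /B !inE.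
  by case: edge; case: (v \in Av); case: (top v); case: (_ <= _).
case=> v0 [vs0 v0s]; case: ifP => Hm Hd.
  have : #|B| <= #|[set v | ~~ top v]|.
    by apply: subset_leq_card; apply/subsetP => v; rewrite /B !inE negb_or => /andP[].
  by have := card_nontop; lia.
have := Hx _ vs0; rewrite Hm /= => xv.
have : #|B| <= #|[set v | lab v < x + b]|.
  by apply: subset_leq_card; apply/subsetP => w; rewrite /B !inE negb_or => /andP[_]; lia.
by have := card_lab (x + b); lia.
Qed.

Lemma deg_top (s : seq V) : size s = k.-1 -> uniq s -> all top s ->
  n + 2 + 16 * b <= 2 * #|nbr s| + k.
Proof. by move=> ss us /allP ts; have [v0 [/ts ->]] := HE ss us. Qed.

(** Inclusion-exclusion: the two degrees add up to at least [n + 2 + 16 * b - k], and [k <= b]. *)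
Lemma many_common (s s' Av : seq V) : size s = k.-1 -> uniq s -> all top s ->
  size s' = k.-1 -> uniq s' -> all top s' -> size Av <= b ->
  b <= #|[set v | [&& edge E (v :: s), edge E (v :: s') & v \notin Av]]|.
Proof.
move=> ss us ts ss' us' ts' sA.
have := deg_top ss us ts; have := deg_top ss' us' ts'; have sAv := card_set_seq Av.
have := cardsUI (nbr s) (nbr s'); have := max_card (nbr s :|: nbr s').
set N := [set v | [&& _, _ & _]].
have : #|nbr s :&: nbr s'| <= #|N| + (#|[set v in Av]| + #|set0 : {set V}|).
  apply: leq_card_cover; apply/subsetP => v; rewrite /N !inE.
  by do 2!case: edge; case: (v \in Av).
by rewrite cards0; lia.
Qed.

End Degree.

(** * Connectors *)

Lemma leq_bool (a b : bool) : (a -> b) -> a <= b.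
Proof. by case: a => // ->. Qed.

Section Gadgets.
Variables (R : realType) (V : finType) (lab : V -> nat) (k b : nat) (E : {set {set V}}).
Hypothesis H : dirac lab k b E.
Let k2 : 2 < k. Proof. exact: dirac_k H. Qed.
Let E_unif : forall e, e \in E -> #|e| = k. Proof. exact: dirac_unif H. Qed.
Let kb : k <= b. Proof. exact: dirac_kb H. Qed.
Let bn : 4 * b <= #|V|. Proof. exact: dirac_bn H. Qed.
Local Notation n := #|V|.
Local Notation top := (is_top lab k).
Local Notation edge := (edge E).
Local Notation tight := (tight k E).

Lemma dirac_card_gt0 : 0 < n. Proof. by move: k2 kb bn; slia. Qed.
Let n0 : 0 < #|V|. Proof. exact: dirac_card_gt0. Qed.
Let k0 : 0 < k. Proof. by move: k2; slia. Qed.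

Variable beta : R.
Hypothesis beta0 : (0 <= beta)%R.
Hypothesis beta_b : (beta * n%:R <= b%:R)%R.

Lemma tree_step (P : pred V) (A : {set V}) :
  b <= #|A| -> (forall v, v \in A -> P v) -> (beta * n%:R <= #|[pred v | P v]|%:R)%R.
Proof.
move=> bA AP; apply: le_trans beta_b _; rewrite ler_nat; apply: leq_trans bA _.
by apply: subset_leq_card; apply/subsetP.
Qed.

Lemma tight_rcons (s : seq V) v : k.-1 <= size s ->
  tight s -> edge (v :: drop (size s - k.-1) s) -> tight (rcons s v).
Proof.
move=> ks ts ev; rewrite -cats1 -{1}(cat_take_drop (size s - k.-1) s) -catA.
have sd : size (drop (size s - k.-1) s) = k.-1 by rewrite size_drop; slia.
apply: (tight_cat k0); rewrite ?cat_take_drop ?sd //.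
apply/tightP => i; rewrite size_cat sd /= => Hi.
have -> : i = 0 by slia.
rewrite drop0 take_oversize; last by rewrite size_cat sd /=; slia.
by rewrite (@eq_edge _ _ _ (v :: drop (size s - k.-1) s)) // => w; rewrite cats1 mem_rcons.
Qed.

(** The last window is an edge and so has [k] distinct vertices. Thus a growing tight path provides
    the distinctness that the degree condition asks for. *)
Lemma tight_last_uniq (s : seq V) : k <= size s -> tight s -> uniq (drop (size s - k.-1) s).
Proof.
move=> ks /tightP /(_ (size s - k)) /=; rewrite subnK // => /(_ (leqnn _)).
rewrite take_oversize; last by rewrite size_drop; slia.
move=> /(edge_uniq E_unif); rewrite size_drop => /(_ ltac:(slia)).
rewrite (_ : size s - k.-1 = 1 + (size s - k)); last by slia.
by rewrite -drop_drop; case: (drop _ s) => //= a l /andP[_]; rewrite drop0.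
Qed.

(* Each new vertex is top or has a label [b] above those of the [k.-1] vertices
   before it, so after [ell] rounds all labels are top. *)
Lemma climb (X Av : seq V) ell : 0 < ell -> n <= ell * b ->
  size X = k.-1 -> uniq X -> size Av <= b ->
  (beta ^+ (k.-1 * ell) <= mean (k.-1 * ell) (fun p : seq V =>
     [&& tight (X ++ p), ~~ has (mem Av) p, uniq (drop (k.-1 * ell - k.-1) p) &
         all top (drop (k.-1 * ell - k.-1) p)]%:R))%R.
Proof.
move=> ell0 nell sX uX sA; set L := k.-1 * ell.
have [x0 _] : exists x0, x0 \in V by apply/card_gt0P.
pose lev i v := top v || ((i %/ k.-1).+1 * b <= lab v).
pose Q p := [&& tight (X ++ p), ~~ has (mem Av) p &
  [forall i : 'I_L, (i < size p) ==> lev i (nth x0 p i)]].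
have kL : k.-1 <= L by rewrite leq_pmulr.
apply: (@le_trans _ _ (mean L (fun p => (Q p)%:R)%R)); last first.
  apply: ler_mean => p sp; rewrite ler_nat.
  have [/and3P[tp -> /forallP lp]|//] := boolP (Q p); rewrite tp /=.
  have -> : uniq (drop (L - k.-1) p).
    have := @tight_last_uniq (X ++ p); rewrite size_cat sX sp => /(_ ltac:(slia) tp).
    by rewrite drop_cat sX ltnNge (_ : k.-1 <= _) /=; [congr (uniq (drop _ _))|]; slia.
  rewrite lt0b; apply/(all_nthP x0) => i; rewrite size_drop sp => Hi.
  rewrite nth_drop; have iL : L - k.-1 + i < L by slia.
  have := lp (Ordinal iL); rewrite /= sp iL /= /lev => /orP[//|].
  (* The last [k.-1] positions belong to round [ell.-1], whose level [ell * b] is at least [n]; a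
     label that large is top. *)
  have -> : (L - k.-1 + i) %/ k.-1 = ell.-1.
    rewrite /L; apply/eqP; rewrite eqn_leq; apply/andP; split.
      by rewrite -ltnS prednK // ltn_divLR; [rewrite mulnC|]; move: iL; rewrite /L; slia.
    rewrite leq_divRL; last by slia.
    by rewrite mulnC -[X in _ * ell - X]muln1 -mulnBr subn1 leq_addr.
  by rewrite prednK // /is_top; slia.
apply: mean_tree => //.
  rewrite /Q cats0; apply/and3P; split=> //.
    by apply/tightP => i; slia.
  by apply/forallP.
move=> p sp /and3P[tp dp /forallP lp].
set s := drop (size p) (X ++ p).
have ss : size s = k.-1 by rewrite size_drop size_cat sX; slia.
have us : uniq s.
  case: (posnP (size p)) => [p0|p0].
    by rewrite /s (size0nil p0) cats0 drop0.
  have := @tight_last_uniq (X ++ p); rewrite size_cat sX => /(_ ltac:(slia) tp).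
  by rewrite (_ : _ - _ = size p) //; slia.
have [A bA HA] : exists2 A : {set V}, b <= #|A| &
    {subset A <= [pred v | [&& edge (v :: s), v \notin Av & lev (size p) v]]}.
  (* The vertices of [s] inside [p] were chosen at most one round ago. Vertices of [X] occur in [s]
     only during round 0, when level 0 suffices. *)
  have Hs v : v \in s -> top v || ((size p %/ k.-1) * b <= lab v).
    move=> /(nthP x0)[j]; rewrite ss => jk <-; rewrite /s nth_drop nth_cat sX.
    case: ltnP => jX.
      by rewrite divn_small ?mul0n ?orbT //; slia.
    have iL : size p + j - k.-1 < L by slia.
    have := lp (Ordinal iL); rewrite /= (_ : _ < size p); last by slia.
    rewrite /lev => /orP[->//|h]; apply/orP; right; apply: leq_trans h.
    rewrite leq_mul2r; apply/orP; right.
    apply: leq_trans (_ : (size p + j - k.-1 + k.-1) %/ k.-1 <= _).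
      by apply: leq_div2r; slia.
    by rewrite divnDr // divnn (_ : 0 < k.-1) ?addn1 //; slia.
  eexists; first exact: (many_nbr H ss us sA Hs).
  by move=> v; rewrite !inE /lev => /and3P[-> ->]; rewrite mulSn addnC.
apply: (tree_step bA) => v /HA; rewrite !inE => /and3P[ev vA lv].
rewrite /Q; apply/and3P; split.
- rewrite -rcons_cat; apply: tight_rcons => //; first by rewrite size_cat sX; slia.
  by rewrite size_cat sX (_ : _ - _ = size p) //; slia.
- by rewrite has_rcons negb_or dp andbT.
- apply/forallP => i; apply/implyP; rewrite size_rcons nth_rcons => Hi.
  have := lp i; case: ltnP => // Hi2 _; have -> : i = size p :> nat by slia.
  by rewrite eqxx.
Qed.

Section Connector.
Variables (x0 : V) (ell : nat).
Hypotheses (ell0 : 0 < ell) (nell : n <= ell * b).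
Let L := k.-1 * ell.
Hypothesis Lb : L <= b.
Let kL : k.-1 <= L. Proof. by rewrite leq_pmulr. Qed.

(** Interpolates, entry by entry, between the last [k.-1] vertices of [ups] and those of [downs]
    read backwards. Both ends are top, so consecutive hybrids, which differ in one entry, have
    common neighbours. *)
Definition hybrid i (ups downs : seq V) : seq V :=
  mkseq (fun j => if j < i then nth x0 downs (L - j.+1)
                  else nth x0 ups (L - k.-1 + j)) k.-1.

Definition link_ok (X Y ups downs ws : seq V) : bool :=
  [forall i : 'I_k.-1, (i < size ws) ==>
    edge (nth x0 ws i :: hybrid i ups downs) &&
    edge (nth x0 ws i :: hybrid i.+1 ups downs)].

(** The second climb starts from [rev Y] because the finished path runs through it backwards, down
    into [Y]. *)
Definition frame (X Y p : seq V) : bool :=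
  [&& tight (X ++ take L p), tight (rev Y ++ take L (drop L p)) &
      link_ok X Y (take L p) (take L (drop L p)) (drop L (drop L p))].

Lemma mean_frame X Y : size X = k.-1 -> uniq X -> size Y = k.-1 -> uniq Y ->
  (beta ^+ (L + (L + k.-1)) <= mean (L + (L + k.-1)) (fun p => (frame X Y p)%:R))%R.
Proof.
move=> sX uX sY uY; rewrite !exprD.
pose good (W Av p : seq V) := [&& tight (W ++ p), ~~ has (mem Av) p,
  uniq (drop (L - k.-1) p) & all top (drop (L - k.-1) p)].
pose B (u s : seq V) := good (rev Y) u (take L s) &&
  link_ok X Y u (take L s) (drop L s).
apply: le_trans (_ : _ <= mean (L + (L + k.-1))
   (fun s => (good X [::] (take L s) && B (take L s) (drop L s))%:R))%R _; last first.
  apply: ler_mean => p _; rewrite ler_nat /frame /B /good.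
  by apply: leq_bool => /andP[/and4P[-> _ _ _] /andP[/and4P[-> _ _ _] ->]].
apply: mean_stage => //.
- by rewrite mulr_ge0 // exprn_ge0.
- exact: (@climb X [::] ell).
move=> u su /and4P[tu _ uu au].
apply: mean_stage => //; first by rewrite exprn_ge0.
  by apply: (@climb (rev Y) u ell); rewrite ?size_rev ?rev_uniq ?su.
move=> d sd /and4P[td du ud ad].
have size_h i : size (hybrid i u d) = k.-1 by rewrite size_mkseq.
(* The second climb was chosen to avoid [u], so the two parts of a hybrid are disjoint. *)
have uniq_h i : uniq (hybrid i u d).
  apply/(uniqP x0) => j1 j2; rewrite !inE !size_h => h1 h2.
  rewrite !nth_mkseq //.
  have inu j : j < k.-1 -> nth x0 u (L - k.-1 + j) \in u.
    by move=> jk; apply: mem_nth; rewrite su; slia.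
  have ind j : j < k.-1 -> nth x0 d (L - j.+1) \in d.
    by move=> jk; apply: mem_nth; rewrite sd; slia.
  have dis x : x \in d -> x \in u -> False.
    by move=> xd xu; move/hasPn: du => /(_ x xd); rewrite /= xu.
  case: ifP => c1; case: ifP => c2 e.
  - have : L - j1.+1 - (L - k.-1) = L - j2.+1 - (L - k.-1).
      apply: (uniqP x0 ud); rewrite ?inE ?size_drop ?sd; try slia.
      by rewrite !nth_drop !subnKC //; slia.
    by slia.
  - by case: (dis _ (ind _ h1)); rewrite e; apply: inu.
  - by case: (dis _ (ind _ h2)); rewrite -e; apply: inu.
  - by apply: (uniqP x0 uu); rewrite ?inE ?size_drop ?su ?nth_drop //; slia.
have top_h i : all top (hybrid i u d).
  apply/(all_nthP x0) => j; rewrite size_h => jk; rewrite nth_mkseq //.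
  case: ifP => _.
    have /(all_nthP x0)/(_ (L - j.+1 - (L - k.-1))) := ad.
    by rewrite size_drop sd nth_drop subnKC; [apply|]; slia.
  have /(all_nthP x0)/(_ j) := au.
  by rewrite size_drop su nth_drop; apply; slia.
apply: mean_tree => //.
  by apply/forallP.
move=> p sp /forallP Hp.
have bA := @many_common _ _ _ _ _ H (hybrid (size p) u d) (hybrid (size p).+1 u d) [::]
  (size_h _) (uniq_h _) (top_h _) (size_h _) (uniq_h _) (top_h _) (leq0n _).
apply: (tree_step bA) => v; rewrite !inE => /and3P[e1 e2 _].
apply/forallP => i; apply/implyP; rewrite size_rcons nth_rcons => Hi.
have := Hp i; case: ltnP => // Hi2 _; have -> : i = size p :> nat by slia.
by rewrite eqxx e1 e2.
Qed.

Local Notation r := (L + (L + k.-1)).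

Definition hidx i j := if j < i then L + (L - j.+1) else L - k.-1 + j.

(* The path through a [k]-fold blow-up of a frame: the i-th hybrid tuple is
   taken from the i-th copy, so no vertex is used twice. *)
Definition connector_pos : seq (nat * nat) :=
  [seq (i, 0) | i <- iota 0 L] ++
  flatten [seq (L + L + i, 0) :: [seq (hidx i.+1 m, i.+1) | m <- iota 0 k.-1]
          | i <- iota 0 k.-1] ++
  [seq (i, k.-1) | i <- rev (iota L (L - k.-1))].

Definition connector_path (q : seq V) : seq V :=
  [seq nth x0 q (ic.1 * k + ic.2) | ic <- connector_pos].

Lemma take_mkseq (T : Type) (f : nat -> T) a c : take a (mkseq f (a + c)) = mkseq f a.
Proof. by rewrite /mkseq -map_take take_iota (minn_idPl _) // leq_addr. Qed.

Lemma drop_mkseq (T : Type) (f : nat -> T) a c :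
  drop a (mkseq f (a + c)) = mkseq (fun i => f (a + i)) c.
Proof.
rewrite /mkseq -map_drop drop_iota add0n addKn -[in LHS](addn0 a) iotaDl -map_comp.
by [].
Qed.

(** A window uses each coordinate of the frame at most once. Selecting in every coordinate the copy
    that the window uses ([sig]) turns it into a window or a link edge of an ordinary frame, and the
    blow-up supplies a frame for each selection. *)
Lemma connector_tight X Y q : size X = k.-1 -> size q = r * k ->
  blow k r (frame X Y) q -> tight (X ++ connector_path q ++ Y).
Proof.
move=> sX sq bq; pose el i c := nth x0 q (i * k + c).
have Fr sig : (forall i, i < r -> sig i < k) ->
    frame X Y (mkseq (fun i => el i (sig i)) r) by exact: blowP.
pose U := [seq el i 0 | i <- iota 0 L].
pose h i := [seq el (hidx i m) i | m <- iota 0 k.-1].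
have sh i : size (h i) = k.-1 by rewrite size_map size_iota.
have tU : tight (X ++ U).
  by have /and3P[] := Fr (fun=> 0) (fun _ _ => k0); rewrite take_mkseq.
have step i : i < k.-1 -> tight (h i ++ el (L + L + i) 0 :: h i.+1).
  move=> ik; apply: (tight_pair k0); rewrite /= ?sh; [slia | slia |] => j jk _.
  have -> : k - (k.-1 - j) = j.+1 by slia.
  rewrite /=.
  (* Link vertices are read from copy 0, hybrid entries before [j] from copy [i.+1] and the others
     from copy [i]. The two inner tests recover the entry number from the coordinate [x]. *)
  pose sig x := if L + L <= x then 0
    else if (if L <= x then L + L - x.+1 < j else x < L - k.-1 + j) then i.+1 else i.
  have sigk x : x < r -> sig x < k by move=> _; rewrite /sig; do !case: ifP; slia.
  have /and3P[_ _ /forallP/(_ (Ordinal ik))] := Fr _ sigk.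
  rewrite /= drop_mkseq take_mkseq drop_mkseq take_mkseq size_mkseq ik /=.
  rewrite !nth_mkseq //.
  rewrite (_ : sig (L + (L + i)) = 0); last by rewrite /sig addnA leq_addr.
  (* The coordinates of [hybrid i] and [hybrid i.+1] differ only in entry [i], which the window
     takes from the new block exactly if [i < j]. *)
  pose i' := if j <= i then i else i.+1.
  move=> /andP[e1 e2].
  have : edge (el (L + (L + i)) 0 :: hybrid i'
      (mkseq (fun x => el x (sig x)) L) (mkseq (fun x => el (L + x) (sig (L + x))) L)).
    by rewrite /i'; case: ifP => _; [exact: e1|exact: e2].
  rewrite (_ : hybrid _ _ _ = take j (h i.+1) ++ drop j (h i)).
    rewrite -addnA; set w := el _ _; rewrite (@eq_edge _ _ _
      (drop j (h i) ++ w :: take j (h i.+1))) // => v.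
    by rewrite !(inE, mem_cat); case: (v == w); case: (v \in take _ _); case: (v \in drop _ _).
  apply: (@eq_from_nth _ x0).
    by rewrite size_mkseq size_cat size_take size_drop !sh; case: ltnP; slia.
  move=> m; rewrite size_mkseq => mk; rewrite nth_mkseq // nth_cat.
  have -> : size (take j (h i.+1)) = j by rewrite size_takel ?sh.
  case: (ltnP m j) => mj.
    rewrite nth_take // [RHS](nth_map 0) ?size_iota // [in RHS]nth_iota // add0n.
    have -> : hidx i.+1 m = hidx i' m.
      by rewrite /hidx /i'; case: ifP; case: ifP; case: ifP; slia.
    rewrite /hidx; case: ifP => mi; rewrite nth_mkseq; [|slia| |slia]; congr (el _ _).
      rewrite /sig leq_add2l; case: ifP => c1; first by slia.
      by rewrite leq_addr; case: ifP => //; slia.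
    rewrite /sig; case: ifP => c1; first by slia.
    by rewrite (_ : (L <= _) = false); [case: ifP => //; slia| slia].
  rewrite nth_drop subnKC // [RHS](nth_map 0) ?size_iota // [in RHS]nth_iota // add0n.
  have -> : hidx i m = hidx i' m.
    by rewrite /hidx /i'; case: ifP; case: ifP; case: ifP; slia.
  rewrite /hidx; case: ifP => mi; rewrite nth_mkseq; [|slia| |slia]; congr (el _ _).
    rewrite /sig leq_add2l; case: ifP => c1; first by slia.
    by rewrite leq_addr; case: ifP => //; slia.
  rewrite /sig; case: ifP => c1; first by slia.
  by rewrite (_ : (L <= _) = false); [case: ifP => //; slia| slia].
pose mid i := flatten [seq el (L + L + i) 0 :: h i.+1 | i <- iota 0 i].
have stage i : i <= k.-1 ->
    exists2 pre, X ++ U ++ mid i = pre ++ h i & tight (pre ++ h i).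
  elim: i => [|i IH] ik.
    exists (X ++ [seq el i 0 | i <- iota 0 (L - k.-1)]).
      rewrite cats0 -catA; congr (X ++ _); rewrite /U -{1}(subnK kL) iotaD map_cat.
      congr (_ ++ _); rewrite add0n -[in LHS](addn0 (L - k.-1)) iotaDl -map_comp.
      by apply: eq_map => m.
    rewrite -catA (_ : _ ++ h 0 = U) //.
    rewrite /U -{2}(subnK kL) iotaD map_cat.
    congr (_ ++ _); rewrite add0n -[in RHS](addn0 (L - k.-1)) iotaDl -map_comp.
    by apply: eq_map => m.
  have [pre e t] := IH (ltnW ik).
  exists (pre ++ h i ++ [:: el (L + L + i) 0]).
    rewrite /mid -addn1 iotaD map_cat flatten_cat /= cats0 add0n.
    by rewrite !catA -(catA X U) -/(mid i) e addn1 -!catA.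
  rewrite -!catA /=; apply: (tight_cat k0) => //; first by rewrite sh.
  exact: step.
have [pre e t] := stage _ (leqnn _).
pose tail := [seq el i k.-1 | i <- rev (iota L (L - k.-1))].
have -> : X ++ connector_path q ++ Y = pre ++ h k.-1 ++ tail ++ Y.
  rewrite /connector_path /connector_pos !map_cat -map_comp -/U.
  rewrite (_ : map _ (flatten _) = mid k.-1).
    by rewrite -map_comp -/tail !catA -(catA X) e -!catA.
  rewrite /mid map_flatten -map_comp; congr flatten; apply: eq_map => i /=.
  by rewrite -map_comp.
apply: (tight_cat k0); rewrite ?sh //.
(* The last hybrid and the tail together are the second climb, reversed, in copy [k.-1]. *)
have /and3P[_ td _] := Fr (fun=> k.-1) (fun _ _ => ltac:(slia)).
have := tight_rev k0 td; rewrite rev_cat revK drop_mkseq take_mkseq catA.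
rewrite (_ : rev (mkseq _ _) = h k.-1 ++ tail) //.
apply: (@eq_from_nth _ x0).
  by rewrite size_rev size_mkseq size_cat sh size_map size_rev size_iota subnKC.
move=> m; rewrite size_rev size_mkseq => mL; rewrite nth_rev size_mkseq //.
rewrite nth_mkseq; last by slia.
rewrite nth_cat sh; case: ltnP => mk.
  rewrite (nth_map 0) ?size_iota // nth_iota // add0n /hidx.
  by case: ifP => //; slia.
rewrite (nth_map 0) ?size_rev ?size_iota; last by slia.
rewrite nth_rev ?size_iota; last by slia.
by rewrite nth_iota; [congr (el _ _)|]; slia.
Qed.

Lemma connector_pos_bound ic : ic \in connector_pos -> ic.1 * k + ic.2 < r * k.
Proof.
suff Hs : ic \in connector_pos -> ic.1 < r /\ ic.2 < k.
  by move=> /Hs[h1 h2]; apply: leq_trans (_ : ic.1.+1 * k <= _); [rewrite mulSn; slia|rewrite leq_mul2r h1 orbT].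
rewrite /connector_pos !mem_cat => /or3P[].
- by case/mapP => i; rewrite mem_iota => Hi -> /=; slia.
- case/flattenP => s /mapP[i]; rewrite mem_iota => Hi ->; rewrite inE => /predU1P[->|/mapP[m]] /=.
    by slia.
  by rewrite mem_iota => Hm -> /=; rewrite /hidx; case: ifP; slia.
- by case/mapP => i; rewrite mem_rev mem_iota => Hi -> /=; slia.
Qed.

(** Copy numbers and coordinates separate the segments. The tail shares copy [k.-1] with the last
    hybrid, but it stops short of the final [k.-1] coordinates of the second climb, which that
    hybrid uses. *)
Lemma connector_pos_uniq : uniq connector_pos.
Proof.
rewrite /connector_pos !cat_uniq; apply/and3P; split.
- by rewrite map_inj_uniq ?iota_uniq // => i j [].
- apply/hasPn => ic; rewrite mem_cat => /orP[].
    case/flattenP => s /mapP[i]; rewrite mem_iota => Hi ->; rewrite inE => /predU1P[->|/mapP[m]] /=.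
      by apply/mapP => -[j]; rewrite mem_iota => Hj []; slia.
    by rewrite mem_iota => Hm -> /=; apply/mapP => -[j].
  case/mapP => i; rewrite mem_rev mem_iota => Hi ->.
  by apply/mapP => -[j _ []]; slia.
apply/and3P; split.
- have : uniq (iota 0 k.-1) by apply: iota_uniq.
  have : {subset iota 0 k.-1 <= gtn k.-1} by move=> i; rewrite mem_iota.
  move: {1 2 4}(iota 0 k.-1); elim=> //= i s IH Hs /andP[is_ us].
  rewrite cat_uniq IH ?andbT //; last by move=> j js; apply: Hs; rewrite inE js orbT.
  have ik : i < k.-1 by apply: Hs; rewrite mem_head.
  rewrite map_inj_in_uniq ?iota_uniq ?andbT; last first.
    move=> m m'; rewrite !mem_iota => Hm Hm' [].
    by rewrite /hidx; do 2!case: ifP; slia.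
  pose F i := (L + L + i, 0) :: [seq (hidx i.+1 m, i.+1) | m <- iota 0 k.-1].
  have Hd ic : ic \in flatten [seq F i | i <- s] -> ic \notin F i.
    case/flattenP => s' /mapP[j js ->].
    have jk : j < k.-1 by apply: Hs; rewrite inE js orbT.
    have ij : i != j by apply: contraNneq is_ => ->.
    rewrite inE => /predU1P[->|/mapP[m]].
      rewrite inE negb_or; apply/andP; split; first by rewrite xpair_eqE; slia.
      by apply/mapP => -[m _ []].
    rewrite mem_iota => Hm ->; rewrite inE negb_or; apply/andP; split.
      by rewrite xpair_eqE negb_and orbT.
    by apply/mapP => -[m' _ [_ e]]; move: ij; rewrite e eqxx.
  apply/and3P; split=> //.
    rewrite mem_cat negb_or; apply/andP; split; first by apply/mapP => -[].
    by apply/negP => /Hd; rewrite mem_head.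
  by apply/hasPn => ic /Hd; rewrite inE negb_or => /andP[].
- apply/hasPn => ic /mapP[i]; rewrite mem_rev mem_iota => Hi ->.
  apply/flattenP => -[s /mapP[j]]; rewrite mem_iota => Hj ->; rewrite inE => /predU1P[[]|/mapP[m]].
    by slia.
  by rewrite mem_iota => Hm []; rewrite /hidx; case: ifP; slia.
- by rewrite map_inj_uniq ?rev_uniq ?iota_uniq // => i j [].
Qed.

Lemma connector_path_sub q : size q = r * k -> {subset connector_path q <= q}.
Proof. by move=> sq v /mapP[ic /connector_pos_bound h ->]; apply: mem_nth; rewrite sq. Qed.

Lemma connector_path_uniq q : size q = r * k -> uniq q -> uniq (connector_path q).
Proof.
move=> sq uq; rewrite map_inj_in_uniq ?connector_pos_uniq // => -[i c] [i' c'] h h'.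
have ck ic : ic \in connector_pos -> ic.2 < k.
  rewrite /connector_pos !mem_cat => /or3P[].
  - by case/mapP => ? _ ->.
  - case/flattenP => s /mapP[j]; rewrite mem_iota => Hj ->; rewrite inE => /predU1P[->|/mapP[m _ ->]] //=.
    by slia.
  - by case/mapP => ? _ -> /=; slia.
have b1 := connector_pos_bound h; have b2 := connector_pos_bound h'.
move: (ck _ h) (ck _ h') => /= c1 c2 /(uniqP x0 uq); rewrite !inE sq => /(_ b1 b2) e.
have : i = i'.
  by have := congr1 (divn^~ k) e; rewrite /= !divnMDl // !divn_small // !addn0.
by move=> ii; move: e; rewrite ii => /addnI ->.
Qed.

Lemma mean_connector X Y : size X = k.-1 -> uniq X -> size Y = k.-1 -> uniq Y ->
  ((beta ^+ r) ^+ (k ^ r) <=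
     mean (r * k) (fun q => (tight (X ++ connector_path q ++ Y))%:R))%R.
Proof.
move=> sX uX sY uY; apply: le_trans (lerXn2r _ _ _ (mean_frame sX uX sY uY)) _.
- by rewrite nnegrE exprn_ge0.
- by rewrite nnegrE mean_ge0.
apply: le_trans (mean_blow R n0 _ _ _) _.
by apply: ler_mean => q sq; rewrite ler_nat; apply: leq_bool; apply: connector_tight.
Qed.

End Connector.

End Gadgets.

(** * Swaps and absorbers *)

Section Blocks.
Variables (V : finType) (k : nat) (E : {set {set V}}).
Hypothesis k0 : 0 < k.
Local Notation edge := (edge E).
Local Notation tight := (tight k E).

Lemma mem_mix (T : eqType) K j (f g : nat -> T) : j <= K ->
  drop j (mkseq f K) ++ take j (mkseq g K) =i
  mkseq (fun m => if m < j then g m else f m) K.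
Proof.
move=> jK v; rewrite mem_cat orbC -mem_cat; congr (v \in _).
rewrite /mkseq -map_take -map_drop take_iota drop_iota add0n (minn_idPl jK).
rewrite -{2}(subnKC jK) iotaD map_cat add0n; congr (_ ++ _).
  by apply/eq_in_map => m; rewrite mem_iota => Hm; case: ifP => //; slia.
by apply/eq_in_map => m; rewrite mem_iota => Hm; case: ifP => //; slia.
Qed.

(** Every window contains the middle vertex [v] and, for each position [m], exactly one of [f m] and
    [g m]. *)
Lemma tight_around v (f g : nat -> V) :
  (forall j, edge (v :: mkseq (fun m => if m < j then g m else f m) k.-1)) ->
  tight (mkseq f k.-1 ++ v :: mkseq g k.-1).
Proof.
move=> He; apply: (tight_pair k0); rewrite /= ?size_mkseq; [slia | slia |] => j jk _.
have -> : k - (k.-1 - j) = j.+1 by slia.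
rewrite /= (@eq_edge _ _ _ (v :: mkseq (fun m => if m < j then g m else f m) k.-1)) // => w.
rewrite [RHS]inE -(mem_mix f g jk) !(mem_cat, inE).
by case: (w == v); rewrite ?orbT ?orbF.
Qed.

(** A window across consecutive blocks contains exactly one vertex for each position [m], hence is
    given by some [sig]. *)
Lemma tight_blocks (f : nat -> nat -> V) cs :
  (forall sig : nat -> nat, (forall m, sig m \in cs) -> edge (mkseq (fun m => f (sig m) m) k)) ->
  tight (flatten [seq mkseq (f c) k | c <- cs]).
Proof.
elim: cs => [|c cs IH] He /=; first by apply/tightP => i /= Hi; slia.
have tcs : tight (flatten [seq mkseq (f c) k | c <- cs]).
  by apply: IH => sig Hs; apply: He => m; rewrite inE Hs orbT.
case: cs He tcs {IH} => [|d cs] He tcs /=.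
  rewrite cats0; apply/tightP => i; rewrite size_mkseq => Hi.
  have -> : i = 0 by slia.
  by rewrite drop0 take_oversize ?size_mkseq //; apply: (He (fun=> c)) => m; rewrite mem_head.
apply: (tight_cat k0) => //; first by rewrite size_mkseq; slia.
apply: (tight_pair k0); rewrite ?size_mkseq // => j jk _.
have -> : k - (k - j) = j by slia.
rewrite (eq_edge _ (mem_mix (f c) (f d) jk)).
have := He (fun m => if m < j then d else c).
rewrite (_ : mkseq _ _ = mkseq (fun m => if m < j then f d m else f c m) k).
  by apply => m; case: ifP; rewrite !inE eqxx ?orbT.
by apply: eq_map => m; case: ifP.
Qed.

End Blocks.

Section Absorbers.
Variables (R : realType) (V : finType) (lab : V -> nat) (k b : nat) (E : {set {set V}}).
Hypothesis H : dirac lab k b E.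
Let k2 : 2 < k. Proof. exact: dirac_k H. Qed.
Let kb : k <= b. Proof. exact: dirac_kb H. Qed.
Let n0 : 0 < #|V|. Proof. exact: dirac_card_gt0 H. Qed.
Let k0 : 0 < k. Proof. by move: k2; slia. Qed.
Local Notation n := #|V|.
Local Notation top := (is_top lab k).
Local Notation edge := (edge E).
Local Notation tight := (tight k E).
Variable beta : R.
Hypothesis beta0 : (0 <= beta)%R.
Hypothesis beta_b : (beta * n%:R <= b%:R)%R.
Variable x0 : V.

Definition upward (u w : V) : bool := top w || (lab u + b <= lab w).

Definition swap_frame u (p : seq V) : bool :=
  [&& edge (u :: take k.-1 p), edge (nth x0 p k.-1 :: take k.-1 p) &
      upward u (nth x0 p k.-1)].

(** Choose [k - 2] top vertices, then a neighbour of these and [u] that is upward from [u], and last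
    a neighbour [w] of all [k.-1] of them. Each of the [k.-1] is top or has a label of at least
    [lab u], so the climbing step can make [w] upward as well. *)
Lemma mean_swap_frame u :
  (beta ^+ k <= mean k (fun p => (swap_frame u p)%:R))%R.
Proof.
pose Q (p : seq V) := [&& uniq (u :: take k.-1 p), all (upward u) p,
  (k.-1 <= size p) ==> edge (u :: take k.-1 p) &
  (k == size p) ==> edge (nth x0 p k.-1 :: take k.-1 p)].
apply: (@le_trans _ _ (mean k (fun p => (Q p)%:R)%R)); last first.
  apply: ler_mean => p sp; rewrite ler_nat; apply: leq_bool.
  rewrite /Q /swap_frame sp eqxx leq_pred /= => /and4P[_ /(all_nthP x0) Hu -> ->] /=.
  by apply: Hu; rewrite sp prednK.
apply: mean_tree => //.
  by rewrite /Q /=; apply/andP; split; apply/implyP; slia.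
move=> p sp /and4P[]; case: (ltnP (size p) k.-1) => [spk|]; last first.
  move=> spk; have {}spk : size p = k.-1 by slia.
  rewrite -spk take_size => up Hp ep _.
  have Hs v : v \in p -> top v || (lab u <= lab v).
    by move=> /(allP Hp) /orP[->//|h]; rewrite (leq_trans (leq_addr _ _) h) orbT.
  have up' : uniq p by case/andP: up.
  have bA := many_nbr H (Av := [::]) spk up' (leq0n _) Hs.
  apply: (tree_step beta_b bA) => v; rewrite !inE => /and3P[ev _ Hv].
  have e : take k.-1 (rcons p v) = p by rewrite -cats1 -spk take_size_cat.
  rewrite /Q e up all_rcons Hp /= size_rcons {1}/upward Hv /=.
  move: ep; rewrite /= => ->; rewrite implybT /=; apply/implyP => _.
  by rewrite nth_rcons spk ltnn eqxx.
rewrite take_oversize; last by slia.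
move=> up Hp _ _; have [spk2|spk2] := ltnP (size p) k.-2.
  have bA := @many_top _ _ _ _ _ H (u :: p) ltac:(rewrite /=; slia).
  apply: (tree_step beta_b bA) => v; rewrite !inE => /andP[tv vp].
  rewrite /Q take_oversize ?size_rcons; last by slia.
  rewrite (_ : (k.-1 <= _) = false); last by slia.
  rewrite (_ : (k == _) = false); last by slia.
  rewrite all_rcons Hp /upward tv /= mem_rcons rcons_uniq inE.
  move: up vp; rewrite /= !negb_or eq_sym => /andP[-> ->] /andP[-> ->] //.
have {}spk2 : (size p).+1 = k.-1 by slia.
have Hs v : v \in u :: p -> top v || (lab u <= lab v).
  rewrite inE => /predU1P[->|]; first by rewrite leqnn orbT.
  by move=> /(allP Hp) /orP[->//|h]; rewrite (leq_trans (leq_addr _ _) h) orbT.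
have bA := many_nbr H (s := u :: p) (Av := u :: p) spk2 up ltac:(rewrite /=; slia) Hs.
apply: (tree_step beta_b bA) => v; rewrite !inE => /and3P[ev vp Hv].
rewrite /Q take_oversize ?size_rcons; last by slia.
rewrite (_ : (k == _) = false) ?andbT /=; last by slia.
rewrite all_rcons Hp {1}/upward Hv /= mem_rcons rcons_uniq inE.
move: up vp; rewrite /= !negb_or eq_sym => /andP[-> ->] /andP[-> ->] /=.
apply/implyP => _; rewrite (@eq_edge _ _ _ (v :: u :: p)) // => x.
by rewrite !inE mem_rcons inE orbCA.
Qed.

(** In a 2-fold blow-up, copy 0 of the link precedes the exchanged vertex and copy 1 follows it; the
    exchange partner is the last coordinate, copy 0. *)
Definition swapA (q : seq V) := mkseq (fun m => nth x0 q (m * 2)) k.-1.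
Definition swapB (q : seq V) := mkseq (fun m => nth x0 q (m * 2 + 1)) k.-1.
Definition swapW (q : seq V) := nth x0 q (k.-1 * 2).

Definition swapper u q : bool :=
  [&& tight (swapA q ++ u :: swapB q), tight (swapA q ++ swapW q :: swapB q) &
      upward u (swapW q)].

Lemma blow_swapper u q : size q = k * 2 -> blow 2 k (swap_frame u) q -> swapper u q.
Proof.
move=> sq bq.
have Fr sig : (forall i, i < k -> sig i < 2) ->
    swap_frame u (mkseq (fun i => nth x0 q (i * 2 + sig i)) k) by exact: blowP.
have kE : k = k.-1 + 1 by slia.
have nthW (f : nat -> V) : nth x0 (mkseq f k) k.-1 = f k.-1 by rewrite nth_mkseq //; slia.
have takeS (f : nat -> V) : take k.-1 (mkseq f k) = mkseq f k.-1 by rewrite [in mkseq f k]kE take_mkseq.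
(* The guard [i < k.-1] keeps the last coordinate, the exchange partner, at copy 0 for every [j]. *)
have eqmix j : mkseq (fun m => if m < j then nth x0 q (m * 2 + 1) else nth x0 q (m * 2)) k.-1
   = mkseq (fun i => nth x0 q (i * 2 + (if i < k.-1 then i < j : nat else 0))) k.-1.
  apply/eq_in_map => i; rewrite mem_iota add0n => /= ->.
  by case: ifP => _; rewrite ?addn0.
have sb j i : (if i < k.-1 then i < j : nat else 0) < 2 by case: ifP => // _; case: (i < j).
apply/and3P; split.
- apply: tight_around => // j; rewrite eqmix.
  have /and3P[+ _ _] := Fr (fun i => if i < k.-1 then i < j : nat else 0) (fun i _ => sb j i).
  by rewrite takeS.
- apply: tight_around => // j; rewrite eqmix.
  have /and3P[_ + _] := Fr (fun i => if i < k.-1 then i < j : nat else 0) (fun i _ => sb j i).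
  by rewrite takeS nthW ltnn addn0.
- by have /and3P[_ _] := Fr (fun=> 0) (fun _ _ => isT); rewrite nthW addn0.
Qed.

Lemma mean_swapper u :
  ((beta ^+ k) ^+ (2 ^ k) <= mean (k * 2) (fun q => (swapper u q)%:R))%R.
Proof.
apply: le_trans (lerXn2r _ _ _ (mean_swap_frame u)) _.
- by rewrite nnegrE exprn_ge0.
- by rewrite nnegrE mean_ge0.
apply: le_trans (mean_blow R n0 _ _ _) _.
by apply: ler_mean => q sq; rewrite ler_nat; apply: leq_bool; apply: blow_swapper.
Qed.

Fixpoint swaps (us zs q : seq V) : bool :=
  if us is u :: us' then if zs is z :: zs' then
    [&& edge (u :: take k.-1 q), edge (z :: take k.-1 q) & swaps us' zs' (drop k.-1 q)]
  else true else true.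

Lemma swaps_nth us zs q i : size us = size zs -> i < size us -> swaps us zs q ->
  edge (nth x0 us i :: take k.-1 (drop (i * k.-1) q)) /\
  edge (nth x0 zs i :: take k.-1 (drop (i * k.-1) q)).
Proof.
elim: us zs q i => [|u us IH] [|z zs] q [|i] //=.
  by move=> _ _ /and3P[e1 e2 _]; rewrite drop0.
move=> [ss] Hi /and3P[_ _ /(IH _ _ _ ss Hi)].
by rewrite drop_drop mulSn addnC.
Qed.

(** After [k - 2] top vertices [p], both [u :: p] and [z :: p] consist of [k.-1] top vertices and
    have many common neighbours. The vertex chosen last may fail to be top, hence the guards in
    [Q]. *)
Lemma mean_common_link u z : top u -> top z ->
  (beta ^+ k.-1 <= mean k.-1 (fun p => (edge (u :: p) && edge (z :: p))%:R))%R.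
Proof.
move=> tu tz.
pose Q (p : seq V) := [&& (size p < k.-1) ==> uniq (u :: p),
  (size p < k.-1) ==> uniq (z :: p), (size p < k.-1) ==> all top p &
  (k.-1 == size p) ==> edge (u :: p) && edge (z :: p)].
apply: (@le_trans _ _ (mean k.-1 (fun p => (Q p)%:R)%R)); last first.
  apply: ler_mean => p sp; rewrite ler_nat; apply: leq_bool.
  by rewrite /Q sp eqxx /= => /and4P[].
apply: mean_tree => //.
  by rewrite /Q /= !implybT /=; apply/implyP; slia.
move=> p sp /and4P[]; rewrite sp !implyTb => up zp tp _.
have [spk2|spk2] := ltnP (size p) k.-2.
  have bA := @many_top _ _ _ _ _ H (u :: z :: p) ltac:(rewrite /=; slia).
  apply: (tree_step beta_b bA) => v; rewrite !inE => /andP[tv vp].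
  rewrite /Q size_rcons (_ : (k.-1 == _) = false); last by slia.
  rewrite (_ : (_ < k.-1) = true); last by slia.
  rewrite all_rcons tp tv /= !mem_rcons !rcons_uniq !inE !andbT.
  move: up zp vp; rewrite /= !negb_or !(eq_sym v).
  by move=> /andP[-> ->] /andP[-> _] /and3P[-> -> ->].
have {}spk2 : (size p).+1 = k.-1 by slia.
have bA := @many_common _ _ _ _ _ H (u :: p) (z :: p) [::] spk2 up
  ltac:(by rewrite /= tu) spk2 zp ltac:(by rewrite /= tz) (leq0n _).
apply: (tree_step beta_b bA) => v; rewrite !inE => /and3P[eu ez _].
rewrite /Q size_rcons spk2 ltnn eqxx /=.
rewrite (@eq_edge _ _ (u :: rcons p v) (v :: u :: p)); last first.
  by move=> x; rewrite !inE mem_rcons inE orbCA.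
rewrite (@eq_edge _ _ (z :: rcons p v) (v :: z :: p)); last first.
  by move=> x; rewrite !inE mem_rcons inE orbCA.
by rewrite eu ez.
Qed.

Lemma mean_swaps us zs : size us = size zs -> all top us -> all top zs ->
  (beta ^+ (size us * k.-1) <= mean (size us * k.-1) (fun q => (swaps us zs q)%:R))%R.
Proof.
elim: us zs => [|u us IH] [|z zs] //= [ss] /andP[tu tus] /andP[tz tzs].
rewrite mulSn exprD.
have H1 : (0 <= beta ^+ (size us * k.-1))%R by exact: exprn_ge0.
have H2 p : size p = k.-1 -> edge (u :: p) && edge (z :: p) ->
    (beta ^+ (size us * k.-1) <= mean (size us * k.-1) (fun q => (swaps us zs q)%:R))%R.
  by move=> _ _; apply: IH.
have := mean_stage (A := fun p => edge (u :: p) && edge (z :: p))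
  (B := fun _ => swaps us zs) H1 (mean_common_link tu tz) H2.
move=> /le_trans; apply.
by apply: ler_mean => p _; rewrite -andbA.
Qed.

Lemma mean_top_edge :
  (beta ^+ k <= mean k (fun p => (all top p && edge p)%:R))%R.
Proof.
pose Q (p : seq V) := [&& uniq p, all top p & (k == size p) ==> edge p].
apply: (@le_trans _ _ (mean k (fun p => (Q p)%:R)%R)); last first.
  apply: ler_mean => p sp; rewrite ler_nat; apply: leq_bool.
  by rewrite /Q sp eqxx /= => /and3P[_ -> ->].
apply: mean_tree => //.
  by rewrite /Q /=; apply/implyP; slia.
move=> p sp /and3P[up tp _].
have [spk|spk] := ltnP (size p) k.-1.
  have bA := @many_top _ _ _ _ _ H p ltac:(slia).
  apply: (tree_step beta_b bA) => v; rewrite !inE => /andP[tv vp].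
  rewrite /Q size_rcons (_ : (k == _) = false); last by slia.
  by rewrite all_rcons tp tv rcons_uniq up vp.
have {}spk : size p = k.-1 by slia.
(* With level [n], both alternatives offered by the climbing step amount to being top. *)
have bA := @many_nbr _ _ _ _ _ H p p n spk up ltac:(slia)
  ltac:(by move=> v /(allP tp) ->).
apply: (tree_step beta_b bA) => v; rewrite !inE => /and3P[ev vp Hv].
rewrite /Q rcons_uniq up vp all_rcons tp size_rcons andbT /=.
have -> : top v by case/orP: Hv => //; rewrite /is_top; slia.
apply/implyP => _; rewrite (@eq_edge _ _ _ (v :: p)) // => x.
by rewrite mem_rcons.
Qed.

Definition absorb_frame us (p : seq V) : bool :=
  [&& all top (take k p) && edge (take k p) & swaps us (take k p) (drop k p)].

Lemma mean_absorb_frame us : size us = k -> all top us ->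
  (beta ^+ (k + k * k.-1) <= mean (k + k * k.-1) (fun p => (absorb_frame us p)%:R))%R.
Proof.
move=> su tu; rewrite exprD.
have H1 : (0 <= beta ^+ (k * k.-1))%R by exact: exprn_ge0.
have H2 p : size p = k -> all top p && edge p ->
    (beta ^+ (k * k.-1) <= mean (k * k.-1) (fun q => (swaps us p q)%:R))%R.
  by move=> sp /andP[tp _]; have := @mean_swaps us p; rewrite su sp; apply.
apply: le_trans (mean_stage (A := fun p => all top p && edge p)
  (B := swaps us) H1 mean_top_edge H2) _.
by apply: ler_mean => p _; rewrite lexx.
Qed.

(** In a 3-fold blow-up, copies 0 and 2 of the edge are the outer blocks and copy 1 is the block to
    be inserted between them; the links use copies 0 and 1, as in a swapper. *)
Definition absX (q : seq V) c := mkseq (fun m => nth x0 q (m * 3 + c)) k.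
Definition absA (q : seq V) i := mkseq (fun m => nth x0 q ((k + (i * k.-1 + m)) * 3)) k.-1.
Definition absB (q : seq V) i := mkseq (fun m => nth x0 q ((k + (i * k.-1 + m)) * 3 + 1)) k.-1.

Definition absorber us q : bool :=
  [&& tight (absX q 0 ++ absX q 2), tight (absX q 0 ++ absX q 1 ++ absX q 2) &
      [forall i : 'I_k, tight (absA q i ++ nth x0 us i :: absB q i) &&
                        tight (absA q i ++ nth x0 (absX q 1) i :: absB q i)]].

Lemma blow_absorber us q : size us = k -> size q = (k + k * k.-1) * 3 ->
  blow 3 (k + k * k.-1) (absorb_frame us) q -> absorber us q.
Proof.
move=> su sq bq.
have Fr sig : (forall i, i < k + k * k.-1 -> sig i < 3) ->
  absorb_frame us (mkseq (fun i => nth x0 q (i * 3 + sig i)) (k + k * k.-1)) by exact: blowP.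
apply/and3P; split.
- have := @tight_blocks _ k E k0 (fun c m => nth x0 q (m * 3 + c)) [:: 0; 2].
  rewrite /= cats0; apply => sig Hs.
  have /andP[/andP[_ +] _] := Fr sig ltac:(by move=> i _; move: (Hs i); rewrite !inE; case/orP => /eqP ->).
  by rewrite take_mkseq.
- have := @tight_blocks _ k E k0 (fun c m => nth x0 q (m * 3 + c)) [:: 0; 1; 2].
  rewrite /= cats0; apply => sig Hs.
  have /andP[/andP[_ +] _] := Fr sig ltac:(by move=> i _; move: (Hs i); rewrite !inE; case/or3P => /eqP ->).
  by rewrite take_mkseq.
apply/forallP => i.
(* Edge coordinates are read from copy 1, the block to be exchanged. For a link coordinate, the
   residue modulo [k.-1] is its place within its own link. *)
pose sig j x := if x < k then 1 else (x - k) %% k.-1 < j : nat.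
have Hsig j x : x < k + k * k.-1 -> sig j x < 3.
  by move=> _; rewrite /sig; case: ifP => // _; case: (_ %% _ < j).
have key j : edge (nth x0 us i :: mkseq (fun m => if m < j then nth x0 q ((k + (i * k.-1 + m)) * 3 + 1)
      else nth x0 q ((k + (i * k.-1 + m)) * 3)) k.-1) /\
   edge (nth x0 (absX q 1) i :: mkseq (fun m => if m < j then nth x0 q ((k + (i * k.-1 + m)) * 3 + 1)
      else nth x0 q ((k + (i * k.-1 + m)) * 3)) k.-1).
  have /andP[_] := Fr _ (Hsig j).
  rewrite take_mkseq drop_mkseq => /(swaps_nth (i := i)).
  rewrite su size_mkseq => /(_ erefl (ltn_ord i)).
  have [d Hd] : exists d, k * k.-1 = i * k.-1 + (k.-1 + d).
    by exists ((k - i.+1) * k.-1); have := ltn_ord i; rewrite -mulSn -mulnDl => ?; congr (_ * _); slia.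
  rewrite Hd drop_mkseq take_mkseq nth_mkseq // nth_mkseq // /sig (ltn_ord i) /=.
  rewrite (_ : mkseq _ _ = mkseq (fun m => if m < j then nth x0 q ((k + (i * k.-1 + m)) * 3 + 1)
      else nth x0 q ((k + (i * k.-1 + m)) * 3)) k.-1) //.
  apply/eq_in_map => m; rewrite mem_iota add0n => /= mk.
  rewrite (_ : (k + _ < k) = false) ?addKn ?modnMDl ?modn_small //; last by rewrite ltnNge leq_addr.
  by case: ifP; rewrite ?addn0.
by apply/andP; split; apply: tight_around => // j; have [] := key j.
Qed.

Lemma mean_absorber us : size us = k -> all top us ->
  ((beta ^+ (k + k * k.-1)) ^+ (3 ^ (k + k * k.-1)) <=
     mean ((k + k * k.-1) * 3) (fun q => (absorber us q)%:R))%R.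
Proof.
move=> su tu; apply: le_trans (lerXn2r _ _ _ (mean_absorb_frame su tu)) _.
- by rewrite nnegrE exprn_ge0.
- by rewrite nnegrE mean_ge0.
apply: le_trans (mean_blow R n0 _ _ _) _.
by apply: ler_mean => q sq; rewrite ler_nat; apply: leq_bool; apply: blow_absorber.
Qed.

End Absorbers.

(** * Light edges *)

(** Layer-cake formula for a truncated difference. *)
Lemma sum_steps M y o : \sum_(i < M) (y + i.+1 <= o : nat) = minn M (o - y).
Proof.
elim: M => [|M IH]; first by rewrite big_ord0 min0n.
by rewrite big_ord_recr /= IH; case: leqP; lia.
Qed.

Section MinLab.
Variables (V : finType) (lab : V -> nat).

Definition minlab (s : seq V) : nat :=
  if s is v :: s' then foldr (fun w m => minn (lab w) m) (lab v) s' else 0.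

Lemma minlab_ge (s : seq V) x : s != [::] -> (forall v, v \in s -> x <= lab v) ->
  x <= minlab s.
Proof.
case: s => // v s _ Hx /=; have : x <= lab v by apply: Hx; rewrite mem_head.
have {Hx} : forall w, w \in s -> x <= lab w by move=> w ws; apply: Hx; rewrite inE ws orbT.
elim: s => //= w s IH Hx xv; rewrite leq_min Hx ?mem_head //=.
by apply: IH => // u us; apply: Hx; rewrite inE us orbT.
Qed.

Lemma minlab_le (s : seq V) v : v \in s -> minlab s <= lab v.
Proof.
case: s => // u s; rewrite inE /= => /predU1P[->|].
  by elim: s => //= w s IH; rewrite geq_min IH orbT.
elim: s => //= w s IH; rewrite inE geq_min => /predU1P[->|/IH->]; by rewrite ?leqnn ?orbT.
Qed.

Lemma minlabE (s : seq V) v : v \in s -> (forall w, w \in s -> lab v <= lab w) ->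
  minlab s = lab v.
Proof.
move=> vs Hv; apply/eqP; rewrite eqn_leq minlab_le //=; apply: minlab_ge => //.
by case: (s) vs.
Qed.

End MinLab.

Section Light.
Variables (R : realType) (V : finType) (lab : V -> nat) (k b : nat) (E : {set {set V}}).
Hypothesis H : dirac lab k b E.
Let k2 : 2 < k. Proof. exact: dirac_k H. Qed.
Let n0 : 0 < #|V|. Proof. exact: dirac_card_gt0 H. Qed.
Local Notation n := #|V|.
Local Notation edge := (edge E).
Local Notation minlab := (minlab lab).

Definition toplab m := n + 2 <= 2 * m.+1 + k.

(** A degree condition that can be inherited by subsets: a label is measured by the number of
    vertices of [U] up to it instead of by its value. *)
Definition wide (U : {set V}) e (s : seq V) : bool :=
  if toplab (minlab s) then #|U| + 2 * e <= 2 * #|nbr E s :&: U|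
  else #|[set v in U | lab v <= minlab s]| + 2 * e <= #|nbr E s :&: U|.

Variables (U : {set V}) (Y : V -> nat) (M o e : nat) (theta : R).
Hypothesis oM : o <= M.
Hypothesis e0 : 0 < e.
Hypothesis Htheta :
  (mean k.-1 (fun s => [&& all (mem U) s, uniq s & ~~ wide U e s]%:R) <= theta)%R.

Definition light (p : seq V) : bool :=
  [&& all (mem U) p, edge p & \sum_(v <- p) Y v <= k * o].

(** The levels scale differently because [k.-1] vertices with a deficit of at least [i.+1] each
    allow the last vertex of a light edge an excess of [k.-1 * i.+1]. *)
Let F i := #|[set v in U | Y v + i.+1 <= o]|.
Let Hi i := #|[set v in U | o + k.-1 * i.+1 < Y v]|.

Let c1 : R := ((e%:R / n%:R) ^+ k.-1 - theta - (k.-1 * k.-1)%:R / n%:R)%R.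

(* Let [x] be maximal such that [e] of the vertices counted by [F i] have a label
   of at least [x]. A tuple of such vertices has more neighbours in [U] than there
   are labels in [U] up to its minimum (or than half of [U]), and if light edges
   are rare then almost all of these neighbours are counted by [Hi i]. *)
Lemma low_high i :
  (mean k (fun p => (light p)%:R) < c1 * (e%:R / n%:R))%R -> F i <= Hi i + e.
Proof.
move=> Hmean; have [Fe|eF] := ltnP (F i) e; first by apply: leq_trans (ltnW Fe) (leq_addl _ _).
pose A x := [set v in U | (Y v + i.+1 <= o) && (x <= lab v)].
have exA : exists x, e <= #|A x|.
  exists 0; apply: leq_trans eF _; apply: subset_leq_card; apply/subsetP => v.
  by rewrite !inE => /andP[-> ->].
have ubA x : e <= #|A x| -> x <= \max_v lab v.
  move=> eA; have /card_gt0P[v] : 0 < #|A x| by apply: leq_trans eA.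
  rewrite inE => /and3P[_ _ xv]; apply: leq_trans xv _.
  exact: (leq_bigmax v).
case: (ex_maxnP exA ubA) => x eA maxA.
have Ax1 : #|A x.+1| < e by rewrite ltnNge; apply/negP => /maxA; rewrite ltnn.
pose P s := [&& all (mem (A x)) s, uniq s & wide U e s].
have nR : (0 < n%:R :> R)%R by rewrite ltr0n.
have AU v : v \in A x -> v \in U by rewrite inE => /andP[].
have HP : (c1 <= mean k.-1 (fun s => (P s)%:R))%R.
  have h1 : ((e%:R / n%:R) ^+ k.-1 <= mean k.-1 (fun s => (all (mem (A x)) s)%:R) :> R)%R.
    rewrite mean_all mean1E; apply: lerXn2r.
    - by rewrite nnegrE divr_ge0.
    - by rewrite nnegrE divr_ge0 // sumr_ge0.
    apply: ler_wpM2r; first by rewrite invr_ge0.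
    rewrite (eq_bigr (fun v => (v \in A x)%:R)%R); last by move=> v _; rewrite /= andbT.
    by rewrite sum_indE ler_nat; apply: leq_trans eA _; apply: subset_leq_card; apply/subsetP.
  have h2 := mean_nuniq R n0 k.-1.
  have h3 : (mean k.-1 (fun s => (all (mem (A x)) s)%:R) <=
     mean k.-1 (fun s => (P s)%:R) + (mean k.-1 (fun s : seq V => (~~ uniq s)%:R) +
     mean k.-1 (fun s => [&& all (mem U) s, uniq s & ~~ wide U e s]%:R)) :> R)%R.
    rewrite -!meanD; apply: ler_mean => s _; rewrite -!natrD ler_nat /P.
    have [Hs|//] := boolP (all (mem (A x)) s).
    have -> : all (mem U) s by apply: sub_all Hs => v; apply: AU.
    by case: uniq; case: wide.
  by move: h1 h2 h3 Htheta; rewrite /c1; lra.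
have [s [ss Ps few]] : exists s, [/\ size s = k.-1, P s &
    #|[set v in nbr E s :&: U | Y v <= o + k.-1 * i.+1]| < e].
  (* Each of the [e] small neighbours of a tuple in [T] completes it to a light edge. If [T] had
     density [c1], there would be more light edges than assumed, so [T] does not exhaust [P]. *)
  pose T s := P s && (e <= #|[set v in nbr E s :&: U | Y v <= o + k.-1 * i.+1]|).
  have [s ss] : exists2 s, size s = k.-1 & P s && ~~ T s.
    apply: (@mean_ind_gt0 R V n0 _ (fun s => P s && ~~ T s)).
    have h : (mean k.-1 (fun s => (P s)%:R) <= mean k.-1 (fun s => (P s && ~~ T s)%:R) +
        mean k.-1 (fun s => (T s)%:R) :> R)%R.
      rewrite -meanD; apply: ler_mean => s _; rewrite -natrD ler_nat.
      by case: (P s); case: (T s).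
    suff : (mean k.-1 (fun s => (T s)%:R) < c1 :> R)%R by move: h HP; lra.
    have en : (0 < e%:R / n%:R :> R)%R by rewrite divr_gt0 ?ltr0n.
    rewrite -(ltr_pM2r en); apply: le_lt_trans Hmean.
    pose Fs s := [set v in nbr E s :&: U | Y v <= o + k.-1 * i.+1].
    have h2 s : size s = k.-1 -> T s ->
        (e%:R / n%:R <= mean 1 (fun q => (all (mem (Fs s)) q)%:R) :> R)%R.
      move=> _ /andP[_ Te]; rewrite mean1E; apply: ler_wpM2r; first by rewrite invr_ge0.
      rewrite (eq_bigr (fun v => (v \in Fs s)%:R)%R); last by move=> v _; rewrite /= andbT.
      by rewrite sum_indE ler_nat; apply: leq_trans Te _; apply: subset_leq_card; apply/subsetP.
    have := mean_stage (A := T) (B := fun s q => all (mem (Fs s)) q) (ltW en) (lexx _) h2.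
    move=> /le_trans; apply; rewrite addn1 prednK; last by slia.
    apply: ler_mean => p sp; rewrite ler_nat; apply: leq_bool.
    have std : size (take k.-1 p) = k.-1 by rewrite size_takel //; slia.
    have : size (drop k.-1 p) = 1 by rewrite size_drop; slia.
    rewrite /light -{5 6 7}(cat_take_drop k.-1 p).
    case: (drop k.-1 p) => [//|v [|//]] _; move: (take k.-1 p) std => {p sp} s ss.
    move=> /andP[/andP[/and3P[As _ _] _]]; rewrite /= andbT !inE => /andP[/andP[ev vU] Yv].
    rewrite all_cat /= vU (@eq_edge _ _ _ (v :: s)) ?ev ?andbT; last first.
      by move=> w; rewrite mem_cat !inE orbC.
    rewrite (_ : all _ s) /=; last by apply: sub_all As => w; apply: AU.
    rewrite big_cat big_seq1 /=.
    apply: leq_trans (_ : k.-1 * (o - i.+1) + Y v <= _).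
      rewrite leq_add2r -ss; elim: s As {ss ev} => [|w s IHs] /=; first by rewrite big_nil.
      rewrite big_cons mulSn => /andP[]; rewrite inE => /and3P[_ Yw _] /IHs; slia.
    have io : i.+1 <= o.
      have /card_gt0P[w] : 0 < F i by apply: leq_trans eF.
      by rewrite inE; slia.
    rewrite mulnBr; have : k.-1 * i.+1 <= k.-1 * o by rewrite leq_mul2l io orbT.
    have -> : k * o = o + k.-1 * o by rewrite -mulSn prednK //; slia.
    by move: Yv; slia.
  by rewrite /T; have [Ps|//] := boolP (P s); rewrite /= -ltnNge => HT; exists s.
have /and3P[As us ws] := Ps.
have HN : #|nbr E s :&: U| <= Hi i + e.
  apply: leq_trans (_ : Hi i + #|[set v in nbr E s :&: U | Y v <= o + k.-1 * i.+1]| <= _).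
    apply: leq_trans _ (leq_card_setU _ _); apply: subset_leq_card; apply/subsetP => v.
    rewrite !inE => /andP[-> ->]; by case: leqP; rewrite ?orbT.
  by rewrite leq_add2l ltnW.
have xs : x <= minlab s.
  apply: minlab_ge; first by case: (s) ss => //=; slia.
  by move=> v /(allP As) /=; rewrite /A !inE => /and3P[].
(* At the top level, [Hi i] counts at least half of [U], and the sets counted by [F i] and [Hi i]
   are disjoint. Otherwise all but fewer than [e] of the vertices counted by [F i] have a label of
   at most [x], hence of at most [minlab s]. *)
move: ws; rewrite /wide; case: ifP => _ Hw.
  have : F i + Hi i <= #|U|.
    rewrite -cardsUI (_ : _ :&: _ = set0) ?cards0 ?addn0.
      apply: subset_leq_card; apply/subsetP => v; rewrite !inE.
      by case: (v \in U).
    apply/setP => v; rewrite !inE; apply/negP => /andP[/andP[_ h1] /andP[_ h2]].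
    by have := leq_trans (leq_addr _ _) h1; move: h1 h2; slia.
  by move: Hw HN; slia.
have : F i <= #|[set v in U | lab v <= minlab s]| + #|A x.+1|.
  apply: leq_trans _ (leq_card_setU _ _); apply: subset_leq_card; apply/subsetP => v.
  rewrite /A !inE => /andP[-> ->] /=; case: leqP => //=.
    by move=> h; rewrite (leq_trans h xs).
  by rewrite orbT.
by move: Hw HN Ax1; slia.
Qed.

(* Summing [low_high] over [i] bounds the total deficit below [o] by the total
   excess above [o], against the average of [Y]. *)
Lemma mean_light : \sum_(v in U) Y v + M * e < o * #|U| ->
  (c1 * (e%:R / n%:R) <= mean k (fun p => (light p)%:R))%R.
Proof.
move=> HY; rewrite leNgt; apply/negP => Hmean.
have : \sum_(i < M) F i <= \sum_(i < M) (Hi i + e).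
  by apply: leq_sum => i _; apply: low_high.
rewrite big_split /= sum_nat_const card_ord.
have FE i : F i = \sum_(v in U) (Y v + i.+1 <= o : nat).
  rewrite /F -sum1_card big_mkcond [RHS]big_mkcond /=; apply: eq_bigr => v _.
  by rewrite inE; case: (v \in U) => //=; case: (_ <= _).
have HE i : Hi i = \sum_(v in U) (o + k.-1 * i.+1 < Y v : nat).
  rewrite /Hi -sum1_card big_mkcond [RHS]big_mkcond /=; apply: eq_bigr => v _.
  by rewrite inE; case: (v \in U) => //=; case: (_ < _).
have -> : \sum_(i < M) F i = \sum_(v in U) \sum_(i < M) (Y v + i.+1 <= o : nat).
  by rewrite exchange_big; apply: eq_bigr => i _; exact: FE.
have -> : \sum_(i < M) Hi i = \sum_(v in U) \sum_(i < M) (o + k.-1 * i.+1 < Y v : nat).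
  by rewrite exchange_big; apply: eq_bigr => i _; exact: HE.
have H1 : \sum_(v in U) \sum_(i < M) (Y v + i.+1 <= o : nat) = \sum_(v in U) (o - Y v).
  by apply: eq_bigr => v _; rewrite sum_steps (minn_idPr _) //; lia.
have H2 : \sum_(v in U) \sum_(i < M) (o + k.-1 * i.+1 < Y v : nat) <= \sum_(v in U) (Y v - o).
  apply: leq_sum => v _; apply: leq_trans (geq_minr M _); rewrite -sum_steps.
  apply: leq_sum => i _; apply: leq_bool => h; apply: leq_trans (ltnW h).
  by rewrite leq_add2l leq_pmull //; slia.
have H3 : \sum_(v in U) (o - Y v) + \sum_(v in U) Y v = o * #|U| + \sum_(v in U) (Y v - o).
  rewrite -[o * #|U|]mulnC -sum_nat_const -!big_split /=; apply: eq_bigr => v _; lia.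
by rewrite H1; move: H2 H3 HY; slia.
Qed.

End Light.

(** * Tilings *)

(** Second-order remainder, uniform over the range that contains [total_dev] and its changes. *)
Lemma pow_taylor (R : realType) m : exists2 c : R, (0 <= c)%R & forall x a : R,
  (`|x| <= 2 -> `|a| <= 2 ->
   `|(x - a) ^+ m.+1 - x ^+ m.+1 + m.+1%:R * x ^+ m * a| <= c * a ^+ 2)%R.
Proof.
elim: m => [|m [c c0 IH]].
  exists 0%R => // x a _ _; rewrite !expr1 expr0 mulr1 mul1r mul0r.
  by rewrite (_ : (x - a - x + a = 0)%R) ?normr0 //; ring.
exists (4 * c + m.+1%:R * 2 ^+ m)%R.
  by rewrite addr_ge0 ?mulr_ge0 // exprn_ge0.
move=> x a x2 a2; have {}IH := IH x a x2 a2.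
set r := (_ - _ + _)%R in IH.
have -> : ((x - a) ^+ m.+2 - x ^+ m.+2 + m.+2%:R * x ^+ m.+1 * a =
    (x - a) * r + m.+1%:R * x ^+ m * a ^+ 2)%R.
  by rewrite /r !exprS -(natr1 m.+1); ring.
apply: le_trans (ler_normD _ _) _; rewrite [leRHS]mulrDl; apply: lerD.
  rewrite normrM -mulrA; apply: ler_pM => //.
  by apply: le_trans (ler_normB _ _) _; lra.
rewrite normrM (ger0_norm (sqr_ge0 a)) normrM normr_nat normrX.
apply: ler_wpM2r; first exact: sqr_ge0.
by apply: ler_wpM2l => //; apply: lerXn2r; rewrite ?nnegrE.
Qed.

Section Tile.
Variables (V : finType) (k t : nat) (E : {set {set V}}) (x0 : V).
Hypotheses (k0 : 0 < k) (t0 : 0 < t).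

Definition tile (q : seq V) : seq V :=
  [seq nth x0 q (m * t + c) | c <- iota 0 t, m <- iota 0 k].

Lemma tileE q : tile q = flatten [seq mkseq (fun m => nth x0 q (m * t + c)) k | c <- iota 0 t].
Proof. by []. Qed.

Lemma size_tile (q : seq V) : size (tile q) = k * t.
Proof. by rewrite size_allpairs !size_iota mulnC. Qed.

Lemma tile_uniq (q : seq V) : size q = k * t -> uniq q -> uniq (tile q).
Proof.
move=> sq uq; apply: allpairs_uniq; rewrite ?iota_uniq //.
move=> [c m] [c' m'] /allpairsP[[? ?] /= [h1 h2 [-> ->]]] /allpairsP[[? ?] /= [h3 h4 [-> ->]]].
move: h1 h2 h3 h4; rewrite !mem_iota !add0n => /= h1 h2 h3 h4.
have bd i j : i < t -> j < k -> j * t + i < k * t.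
  by move=> ? ?; apply: leq_trans (_ : j.+1 * t <= _); [rewrite mulSn addnC ltn_add2r|rewrite leq_mul2r; apply/orP; right].
move/(uniqP x0 uq); rewrite !inE sq !bd // => /(_ isT isT) e.
have e2 := congr1 (divn^~ t) e; have e3 := congr1 (modn^~ t) e.
move: e2 e3; rewrite /= !divnMDl // !divn_small // !addn0 !modnMDl !modn_small //.
by move=> -> ->.
Qed.

Lemma tile_blocks (P : pred (seq V)) (q : seq V) : size q = k * t -> blow t k P q ->
  forall sig, (forall m, sig m < t) -> P (mkseq (fun m => nth x0 q (m * t + sig m)) k).
Proof. by move=> sq bq sig Hs; apply: blowP. Qed.

Lemma tile_tight (P : pred (seq V)) (q : seq V) : (forall p, P p -> edge E p) -> size q = k * t ->
  blow t k P q -> tight k E (tile q).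
Proof.
move=> PE sq bq; rewrite tileE.
apply: (tight_blocks k0 (f := fun c m => nth x0 q (m * t + c))) => sig Hs.
by apply: PE; apply: (tile_blocks sq bq) => m; have := Hs m; rewrite mem_iota.
Qed.

Lemma tile_sum (P : pred (seq V)) (q : seq V) (Y : V -> nat) B : (forall p, P p -> \sum_(v <- p) Y v <= B) ->
  size q = k * t -> blow t k P q -> \sum_(v <- tile q) Y v <= t * B.
Proof.
move=> PB sq bq; rewrite tileE big_flatten big_map.
apply: (@leq_trans (\sum_(c <- iota 0 t) B)); last first.
  by rewrite big_const_seq count_predT size_iota iter_addn_0 mulnC.
rewrite big_seq_cond [X in _ <= X]big_seq_cond; apply: leq_sum => c; rewrite andbT mem_iota => ct.
by apply: PB; apply: (tile_blocks sq bq) => m.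
Qed.

Lemma tile_sub (P : pred (seq V)) (q : seq V) (U : {set V}) : (forall p, P p -> all (mem U) p) ->
  size q = k * t -> blow t k P q -> all (mem U) (tile q).
Proof.
move=> PU sq bq; rewrite tileE; apply/allP => v /flattenP[s /mapP[c]].
rewrite mem_iota => ct -> vs; apply: (allP (PU _ _) _ vs); exact: (tile_blocks sq bq).
Qed.

End Tile.

(** * The moment potential and a single tiling step *)

Section Potential.
Variables (R : realType) (V : finType) (lab : V -> nat) (k b : nat) (E : {set {set V}}).
Hypothesis H : dirac lab k b E.
Let k2 : 2 < k. Proof. exact: dirac_k H. Qed.
Let k0 : 0 < k. Proof. by move: k2; lia. Qed.
Let kb : k <= b. Proof. exact: dirac_kb H. Qed.
Let bn : 4 * b <= #|V|. Proof. exact: dirac_bn H. Qed.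
Let n0 : 0 < #|V|. Proof. exact: dirac_card_gt0 H. Qed.
Local Notation n := #|V|.
Local Notation edge := (edge E).
Local Notation minlab := (minlab lab).
Variable W : {set V}.
Hypothesis Wb : #|~: W| <= b.
Let w0 : 0 < #|W|. Proof. by have := cardsC W; slia. Qed.
Let wn : #|W| <= n. Proof. exact: max_card. Qed.
Local Open Scope ring_scope.
Let nR : 0 < n%:R :> R. Proof. by rewrite ltr0n. Qed.
Let wR : 0 < #|W|%:R :> R. Proof. by rewrite ltr0n. Qed.

(* Excess of the indicator of the neighbourhood of [s] over the indicator of the
   labels up to [min s] (half of everything, when [min s] is large); the degree
   condition says that its average over [W] is bounded away from 0. *)
Definition excess (s : seq V) (v : V) : R :=
  (edge (v :: s))%:R -
  (if toplab V k (minlab s) then 2^-1 else (lab v <= minlab s)%N%:R).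

Definition avg_excess s : R := (\sum_(v in W) excess s v) / #|W|%:R.
(** Centring makes the deviations cancel over [W], so the potential is 0 before the first tile. *)
Definition dev s v : R := excess s v - avg_excess s.
Definition total_dev (U : {set V}) s : R := (\sum_(v in U) dev s v) / n%:R.
Definition potential (U : {set V}) : R :=
  mean k.-1 (fun s => total_dev U s ^+ k.*2).

Lemma excess_norm s v : `|excess s v| <= 1.
Proof.
rewrite /excess; case: edge; case: toplab; rewrite ?(ler_norml, ltr_norml) /=; try lra;
  case: (_ <= _)%N => /=; lra.
Qed.

Lemma avg_norm s : `|avg_excess s| <= 1.
Proof.
rewrite normrM normfV normr_nat ler_pdivrMr // mul1r.
apply: le_trans (ler_norm_sum _ _ _) _.
apply: le_trans (_ : \sum_(v in W) 1 <= _); last by rewrite sumr_const.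
by apply: ler_sum => v _; apply: excess_norm.
Qed.

Lemma dev_norm s v : `|dev s v| <= 2.
Proof.
apply: le_trans (ler_normB _ _) _.
by have := excess_norm s v; have := avg_norm s; lra.
Qed.

Lemma sum_dev_norm (U : {set V}) s : `|\sum_(v in U) dev s v| <= 2 * #|U|%:R.
Proof.
apply: le_trans (ler_norm_sum _ _ _) _.
apply: le_trans (_ : \sum_(v in U) 2 <= _); last by rewrite sumr_const mulr_natr.
by apply: ler_sum => v _; apply: dev_norm.
Qed.

Lemma total_dev_norm (U : {set V}) s : `|total_dev U s| <= 2.
Proof.
rewrite normrM normfV normr_nat ler_pdivrMr //; apply: le_trans (sum_dev_norm _ _) _.
by apply: ler_wpM2l => //; rewrite ler_nat max_card.
Qed.

Lemma potential_W : potential W = 0.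
Proof.
rewrite /potential (@eq_mean _ _ _ _ (fun=> 0)) ?mean0 // => s _.
rewrite /total_dev (_ : \sum_(v in W) dev s v = 0) ?mul0r ?expr0n ?double_eq0; first by case: (k) k0.
rewrite /dev big_split /= sumrN sumr_const -[avg_excess s *+ _]mulr_natr /avg_excess.
by rewrite divfK ?subrr // gt_eqF.
Qed.

Lemma potential_ge0 U : 0 <= potential U.
Proof. by apply: mean_ge0 => s _; rewrite -mul2n exprM exprn_ge0 // sqr_ge0. Qed.

(** Over [W] the excess sums to at least [6 * b], so a proportional share for [U] is at least
    [6 * eps * b]. A tuple that is not wide only reaches [2 * e], which is at most [2 * eps * b]. *)
Lemma not_wide_dev (U : {set V}) e (s : seq V) (eps : R) : size s = k.-1 -> uniq s -> U \subset W ->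
  0 <= eps -> eps * n%:R <= #|U|%:R -> e%:R <= eps * b%:R ->
  ~~ wide lab k E U e s -> total_dev U s <= - (4 * eps * b%:R / n%:R).
Proof.
move=> ss us UW eps0 HU He Hw.
have [v0 [v0s v0min Hd]] := dirac_deg H ss us.
have mE := minlabE v0s v0min.
have topE : toplab V k (minlab s) = is_top lab k v0 by rewrite /toplab mE.
have sumE (X : {set V}) : \sum_(v in X) excess s v = #|nbr E s :&: X|%:R -
    (if is_top lab k v0 then #|X|%:R / 2 else #|[set v in X | (lab v <= minlab s)%N]|%:R).
  rewrite big_split /= sumrN topE; congr (_ - _).
    rewrite -sum1_card natr_sum big_mkcond [RHS]big_mkcond /=; apply: eq_bigr => v _.
    by rewrite !inE; case: (v \in X); rewrite ?andbT ?andbF //; case: edge.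
  case: is_top; first by rewrite sumr_const mulrC mulr_natr.
  rewrite -sum1_card natr_sum big_mkcond [RHS]big_mkcond /=; apply: eq_bigr => v _.
  by rewrite !inE; case: (v \in X) => //=; case: (_ <= _)%N.
have cW := cardsC W.
have HW : 6 * b%:R <= \sum_(v in W) excess s v.
  have NW : (#|nbr E s| <= #|nbr E s :&: W| + b)%N.
    apply: leq_trans (_ : #|nbr E s :&: W| + #|~: W| <= _)%N; last by rewrite leq_add2l.
    apply: leq_trans _ (leq_card_setU _ _); apply: subset_leq_card; apply/subsetP => v.
    by rewrite !inE => ->; case: (v \in W).
  rewrite sumE; case: ifP Hd => _ Hd.
    have : (12 * b + #|W| <= 2 * #|nbr E s :&: W|)%N.
      by move: Hd NW kb cW; clear; lia.
    by rewrite -(ler_nat R) natrD !natrM; lra.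
  have : (6 * b + #|[set v in W | (lab v <= minlab s)%N]| <= #|nbr E s :&: W|)%N.
    have : (#|[set v in W | (lab v <= minlab s)%N]| <= (lab v0).+1)%N.
      rewrite mE; apply: leq_trans (dirac_lab H _); apply: subset_leq_card.
      by apply/subsetP => v; rewrite !inE => /andP[_]; rewrite ltnS.
    by move: Hd NW kb; clear; lia.
  by rewrite -(ler_nat R) natrD natrM; lra.
have eb : 0 <= eps * b%:R by rewrite mulr_ge0.
have HU2 : \sum_(v in U) excess s v <= 2 * eps * b%:R.
  rewrite sumE; move: Hw; rewrite /wide topE; case: ifP => _; rewrite -ltnNge -(ltr_nat R) natrD !natrM; lra.
have Hav : 6 * b%:R / n%:R <= avg_excess s.
  rewrite ler_pdivlMr // mulrAC ler_pdivrMr //.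
  apply: le_trans (_ : 6 * b%:R * n%:R <= _).
    by apply: ler_wpM2l; [rewrite mulr_ge0|rewrite ler_nat].
  by apply: ler_wpM2r HW; exact: ltW.
rewrite /total_dev /dev big_split /= sumrN sumr_const -[avg_excess s *+ _]mulr_natr.
rewrite -[leRHS]mulNr; apply: ler_wpM2r; first by rewrite invr_ge0 ltW.
have : 6 * b%:R / n%:R * (eps * n%:R) <= avg_excess s * #|U|%:R.
  by apply: ler_pM => //; rewrite ?mulr_ge0 ?invr_ge0 //; apply: ltW.
have -> : 6 * b%:R / n%:R * (eps * n%:R) = 6 * eps * b%:R by field; rewrite gt_eqF.
by move: HU2; lra.
Qed.

(** Taylor expansion: the linear term gives each vertex its weight, and the quadratic error is
    [O(1 / n ^ 2)] for tiles of fixed size. *)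
Lemma potential_setD (U : {set V}) (q : seq V) (c : R) :
  (forall x a : R, `|x| <= 2 -> `|a| <= 2 ->
     `|(x - a) ^+ k.*2 - x ^+ k.*2 + k.*2%:R * x ^+ k.*2.-1 * a| <= c * a ^+ 2) ->
  0 <= c -> uniq q -> all (mem U) q ->
  potential (U :\: [set v in q]) <= potential U -
    k.*2%:R / n%:R * (\sum_(v <- q) mean k.-1 (fun s => total_dev U s ^+ k.*2.-1 * dev s v)) +
    c * (2 * (size q)%:R / n%:R) ^+ 2.
Proof.
move=> Hc c0 uq qU; pose a s := (\sum_(v <- q) dev s v) / n%:R.
have sq : (size q)%:R <= n%:R :> R.
  by rewrite ler_nat -(card_uniqP uq) max_card.
have a_norm s : `|a s| <= 2 * (size q)%:R / n%:R.
  rewrite normrM normfV normr_nat; apply: ler_wpM2r; first by rewrite invr_ge0 ltW.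
  apply: le_trans (ler_norm_sum _ _ _) _.
  apply: le_trans (_ : \sum_(v <- q) 2 <= _); first by apply: ler_sum => v _; apply: dev_norm.
  by rewrite big_const_seq count_predT iter_addr_0 mulr_natr.
have a2 s : `|a s| <= 2.
  apply: le_trans (a_norm s) _; rewrite ler_pdivrMr //; exact: ler_wpM2l.
have devD s : total_dev (U :\: [set v in q]) s = total_dev U s - a s.
  rewrite /total_dev /a (big_setID [set v in q] (A := U)) /=.
  rewrite (_ : \sum_(v in U :&: _) _ = \sum_(v <- q) dev s v); first by field; rewrite gt_eqF.
  rewrite [RHS]big_uniq //; apply: eq_bigl => v; rewrite !inE andb_idl //.
  by move=> vq; apply: (allP qU).
rewrite /potential.
have -> : k.*2%:R / n%:R * (\sum_(v <- q) mean k.-1 (fun s => total_dev U s ^+ k.*2.-1 * dev s v))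
   = mean k.-1 (fun s => k.*2%:R * total_dev U s ^+ k.*2.-1 * a s).
  rewrite -mean_sum -meanZ; apply: eq_mean => s _.
  by rewrite -mulr_sumr /a; field; rewrite gt_eqF.
rewrite -meanB -[X in _ <= _ + X](mean_const n0 k.-1) -meanD.
apply: ler_mean => s _; rewrite devD.
have := Hc _ _ (total_dev_norm U s) (a2 s); rewrite ler_norml => /andP[_].
suff : c * a s ^+ 2 <= c * (2 * (size q)%:R / n%:R) ^+ 2 by lra.
apply: ler_wpM2l => //; rewrite -real_normK ?num_real //; apply: lerXn2r => //.
  by rewrite nnegrE.
by rewrite nnegrE; apply: le_trans (a_norm s).
Qed.

(** In place of Hoelder's inequality, comparing [|x|] with [rho] gives [|x| ^ (2k - 1) <= rho ^ (2k
    - 1) + x ^ 2k / rho]. *)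
Lemma weight_norm (U : {set V}) (rho : R) v : 0 < rho -> potential U <= rho ^+ k.*2 ->
  `|mean k.-1 (fun s => total_dev U s ^+ k.*2.-1 * dev s v)| <= 4 * rho ^+ k.*2.-1.
Proof.
move=> rho0 HU; have dk : k.*2 = k.*2.-1.+1 by slia.
have B (s : seq V) : `|total_dev U s ^+ k.*2.-1 * dev s v| <=
    2 * (rho ^+ k.*2.-1 + total_dev U s ^+ k.*2 / rho).
  rewrite normrM mulrC; apply: ler_pM => //; first exact: dev_norm.
  rewrite normrX; set x := total_dev U s.
  have -> : x ^+ k.*2 = `|x| ^+ k.*2 by rewrite -mul2n !exprM real_normK ?num_real.
  have [xr|rx] := lerP `|x| rho.
    apply: le_trans (_ : rho ^+ k.*2.-1 <= _).
      by apply: lerXn2r; rewrite ?nnegrE // ltW.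
    by rewrite lerDl divr_ge0 ?exprn_ge0 // ltW.
  rewrite dk exprS; set y := `|x| ^+ k.*2.-1.
  have y0 : 0 <= y by rewrite exprn_ge0.
  have r0 : 0 <= rho ^+ k.*2.-1 by rewrite exprn_ge0 // ltW.
  apply: le_trans (_ : `|x| * y / rho <= _); last by rewrite lerDr.
  by rewrite ler_pdivlMr // mulrC; apply: ler_wpM2r => //; apply: ltW.
have D : mean k.-1 (fun s => 2 * (rho ^+ k.*2.-1 + total_dev U s ^+ k.*2 / rho))
    <= 4 * rho ^+ k.*2.-1.
  rewrite meanZ meanD mean_const //.
  rewrite (@eq_mean _ _ _ (fun s => total_dev U s ^+ k.*2 / rho)
     (fun s => rho^-1 * total_dev U s ^+ k.*2)); last by move=> s _; rewrite mulrC.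
  rewrite meanZ -/(potential U).
  have : rho^-1 * potential U <= rho ^+ k.*2.-1.
    by rewrite mulrC ler_pdivrMr // -exprSr -dk.
  by lra.
rewrite ler_norml; apply/andP; split; last first.
  apply: le_trans _ D; apply: ler_mean => s _; apply: le_trans (ler_norm _) (B s).
rewrite -lerN2 opprK -meanN; apply: le_trans _ D; apply: ler_mean => s _.
by apply: le_trans (B s); rewrite -normrN ler_norm.
Qed.

(** Markov's inequality for the moment of order [2k]: such tuples have [total_dev] at most [- z]. *)
Lemma mean_bad (U : {set V}) e (rho eps : R) : 0 < rho -> 0 < eps ->
  potential U <= rho ^+ k.*2 -> U \subset W -> eps * n%:R <= #|U|%:R ->
  e%:R <= eps * b%:R ->
  mean k.-1 (fun s => [&& all (mem U) s, uniq s & ~~ wide lab k E U e s]%:R) <=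
  (rho / (4 * eps * b%:R / n%:R)) ^+ k.*2.
Proof.
move=> rho0 eps0 HU UW epsU eb; set z := _ / n%:R.
have b0 : 0 < b%:R :> R by rewrite ltr0n; slia.
have z0 : 0 < z by rewrite divr_gt0 // !mulr_gt0.
have z2 : 0 < z ^+ k.*2 by rewrite exprn_gt0.
apply: le_trans (_ : (z ^+ k.*2)^-1 * potential U <= _); last first.
  have -> : (rho / z) ^+ k.*2 = rho ^+ k.*2 / z ^+ k.*2 by exact: expr_div_n.
  by rewrite [leLHS]mulrC; apply: ler_wpM2r => //; rewrite invr_ge0 ltW.
rewrite -meanZ; apply: ler_mean => s ss.
have p0 (x : R) : 0 <= x ^+ k.*2 by rewrite -mul2n exprM exprn_ge0 // sqr_ge0.
have [/and3P[_ us ws]|_] := boolP [&& _, _ & _]; last first.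
  by rewrite mulr_ge0 // invr_ge0 ltW.
have := not_wide_dev ss us UW (ltW eps0) epsU eb ws; rewrite -/z => h.
rewrite mulrC ler_pdivlMr // mul1r.
have -> : total_dev U s ^+ k.*2 = (- total_dev U s) ^+ k.*2 by rewrite -mul2n !exprM sqrrN.
by apply: lerXn2r; rewrite ?nnegrE; lra.
Qed.

(** Over [U], the weights [y] sum to [n] times the potential, hence to at least 0. The integers [Y],
    which decrease in [y], therefore average at most [Q], and light edges for them are frequent. On
    a tile built from light edges, [y] averages at least [- 2 * B / Q], which bounds the increase of
    the potential. *)
Lemma tile_step (x0 : V) t (U : {set V}) (rho eps c : R) Q e :
  (forall x a : R, `|x| <= 2 -> `|a| <= 2 ->
     `|(x - a) ^+ k.*2 - x ^+ k.*2 + k.*2%:R * x ^+ k.*2.-1 * a| <= c * a ^+ 2) ->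
  0 <= c -> (0 < t)%N -> 0 < rho -> 0 < eps -> (0 < e)%N -> (0 < Q)%N ->
  potential U <= rho ^+ k.*2 -> U \subset W -> eps * n%:R <= #|U|%:R ->
  e%:R <= eps * b%:R -> (2 * Q * e < #|U|)%N ->
  let c1 : R := (e%:R / n%:R) ^+ k.-1 - (rho / (4 * eps * b%:R / n%:R)) ^+ k.*2
     - (k.-1 * k.-1)%:R / n%:R in
  0 <= c1 -> (k * t * (k * t))%:R / n%:R < (c1 * (e%:R / n%:R)) ^+ (t ^ k) ->
  exists q : seq V, [/\ size q = (k * t)%N, uniq q, all (mem U) q, tight k E q &
    potential (U :\: [set v in q]) <= potential U +
      k.*2%:R / n%:R * (8 * (k * t)%:R * rho ^+ k.*2.-1 / Q%:R) +
      c * (2 * (k * t)%:R / n%:R) ^+ 2].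
Proof.
move=> Hc c0 t0 rho0 eps0 e0 Q0 HU UW epsU eb QeU c1 c10 Hkt.
have Hbad := mean_bad rho0 eps0 HU UW epsU eb.
pose B : R := 4 * rho ^+ k.*2.-1.
have B0 : 0 < B by rewrite mulr_gt0 // exprn_gt0.
have QR : 0 < Q%:R :> R by rewrite ltr0n.
pose y v := mean k.-1 (fun s => total_dev U s ^+ k.*2.-1 * dev s v).
have yB v : `|y v| <= B by exact: weight_norm.
have wv v : -1 <= y v / B <= 1.
  by rewrite -ler_norml normrM normfV (gtr0_norm B0) ler_pdivrMr // mul1r.
pose Y v := Num.truncn (Q%:R * (1 - y v / B)).
have Y0 v : 0 <= Q%:R * (1 - y v / B).
  by have /andP[] := wv v; move=> *; apply: mulr_ge0; [exact: ltW|lra].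
have sumy : 0 <= \sum_(v in U) y v.
  rewrite -mean_sum.
  rewrite (@eq_mean _ _ _ _ (fun s => n%:R * total_dev U s ^+ k.*2)).
    by rewrite meanZ mulr_ge0 //; apply: potential_ge0.
  move=> s _; rewrite -mulr_sumr.
  have -> : \sum_(v in U) dev s v = n%:R * total_dev U s.
    by rewrite /total_dev mulrC divfK // gt_eqF.
  by rewrite mulrCA -exprSr prednK //; slia.
have sumY : (\sum_(v in U) Y v <= Q * #|U|)%N.
  rewrite -(ler_nat R) natr_sum natrM.
  apply: le_trans (_ : \sum_(v in U) Q%:R * (1 - y v / B) <= _).
    by apply: ler_sum => v _; have /andP[] := truncn_itv (Y0 v).
  rewrite -mulr_sumr; apply: ler_wpM2l; first exact: ltW.
  rewrite big_split /= sumr_const sumrN -mulr_suml gerDl oppr_le0.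
  by apply: divr_ge0 => //; exact: ltW.
(* The threshold [Q.+1] exceeds the average by 1; summed over [U] this slack pays for
   [2 * Q * e]. *)
have HL : (c1 * (e%:R / n%:R) <= mean k (fun p => (light k E U Y Q.+1 p)%:R)).
  apply: (@mean_light R V lab k b E H U Y (2 * Q) Q.+1 e) => //; first by slia.
  by move: sumY QeU; clear; nia.
have HLb : (c1 * (e%:R / n%:R)) ^+ (t ^ k) <=
    mean (k * t) (fun q => (blow t k (light k E U Y Q.+1) q)%:R).
  apply: le_trans (mean_blow R n0 _ _ _).
  have e_n : 0 <= e%:R / n%:R :> R by rewrite divr_ge0.
  have h1 : 0 <= c1 * (e%:R / n%:R) by exact: mulr_ge0.
  by apply: lerXn2r => //; rewrite nnegrE //; apply: le_trans HL.
have := mean_good n0 (pred0 : {pred V}) HLb; rewrite card0 mulr0 mul0r subr0 => Hg.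
have [q sq] : exists2 q, size q = (k * t)%N &
    [&& blow t k (light k E U Y Q.+1) q, uniq q & ~~ has (mem (pred0 : {pred V})) q].
  by apply: (@mean_ind_gt0 R V n0); move: Hg Hkt; lra.
case/and3P => bq uq _.
have sT : size (tile k t x0 q) = (k * t)%N by rewrite size_tile.
have uT : uniq (tile k t x0 q) by apply: tile_uniq.
have aT : all (mem U) (tile k t x0 q).
  by apply: (tile_sub x0 (P := light k E U Y Q.+1) _ sq bq) => p /and3P[].
have tT : tight k E (tile k t x0 q).
  by apply: (tile_tight x0 k0 (P := light k E U Y Q.+1) _ sq bq) => p /and3P[].
have YT : (\sum_(v <- tile k t x0 q) Y v <= t * (k * Q.+1))%N.
  by apply: (tile_sum x0 (P := light k E U Y Q.+1) _ sq bq) => p /and3P[].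
exists (tile k t x0 q); split=> //.
apply: le_trans (potential_setD Hc c0 uT aT) _; rewrite sT.
rewrite lerD2r lerD2l -mulrN; apply: ler_wpM2l; first by rewrite divr_ge0.
(* The [2] collects the [1] in the threshold [Q.+1] and a rounding loss of at most 1 per vertex. *)
have H1 : \sum_(v <- tile k t x0 q) Q%:R * (1 - y v / B) <= (k * t)%:R * (Q%:R + 2).
  apply: le_trans (_ : \sum_(v <- tile k t x0 q) ((Y v)%:R + 1) <= _).
    by apply: ler_sum => v _; have /andP[_ /ltW] := truncn_itv (Y0 v); rewrite -natr1.
  rewrite big_split /= big_const_seq count_predT iter_addr_0 sT -natr_sum.
  by move: YT; rewrite -(ler_nat R) !natrM -natr1; lra.
rewrite -mulr_sumr big_split /= big_const_seq count_predT iter_addr_0 sT in H1.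
rewrite sumrN -mulr_suml -/y in H1.
set S := \sum_(v <- _) y v in H1 *.
have : - S / B <= 2 * (k * t)%:R / Q%:R.
  by rewrite ler_pdivlMr //; move: H1; lra.
rewrite ler_pdivrMr // => /le_trans; apply.
by rewrite /B le_eqVlt; apply/orP; left; apply/eqP; field; rewrite gt_eqF.
Qed.

End Potential.

Local Open Scope ring_scope.

Lemma eventually_div (R : realType) (a eps : R) : 0 < eps ->
  exists n0 : nat, forall n : nat, (n0 <= n)%N -> a / n%:R < eps.
Proof.
move=> eps0; exists (Num.truncn (`|a| / eps)).+1 => n Hn.
have h := truncnS_gt (`|a| / eps).
have nn : `|a| / eps < n%:R by apply: lt_le_trans h _; rewrite ler_nat.
have n0 : 0 < n%:R :> R.
  by apply: le_lt_trans nn; rewrite divr_ge0 // ltW.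
rewrite ltr_pdivrMr // mulrC -ltr_pdivrMr //; apply: le_lt_trans nn.
by apply: ler_wpM2r; rewrite ?ler_norm // invr_ge0 ltW.
Qed.

(** There is room for at most [n / (k * t)] tiles, and [rho] is chosen so that this many steps lift
    the potential from 0 to at most [rho ^ 2k]. Hence each step can be carried out until the
    uncovered set is small. *)
Lemma tiling (R : realType) (k t : nat) (beta eps : R) :
  (2 < k)%N -> (0 < t)%N -> 0 < beta -> 0 < eps ->
  exists n0 : nat, forall (V : finType) (lab : V -> nat) (b : nat) (E : {set {set V}}),
    dirac lab k b E -> beta * #|V|%:R <= b%:R -> (n0 <= #|V|)%N ->
  forall W : {set V}, (#|~: W| <= b)%N ->
  exists ts : seq (seq V), [/\ all (fun q => (size q == k * t)%N && tight k E q) ts,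
    uniq (flatten ts), all (mem W) (flatten ts) &
    #|W|%:R - (k * t * size ts)%:R <= eps * #|V|%:R].
Proof.
move=> k2 t0 beta0 eps0; have k0 : (0 < k)%N by slia.
pose K := (k * t)%N; pose D := k.*2; have K0 : (0 < K)%N by rewrite muln_gt0 k0.
have dk : D.-1.+1 = D by rewrite /D; slia.
have [c c0] := pow_taylor R D.-1; rewrite dk => Hc.
pose X : R := (4 * D%:R / (eps * beta)) ^+ D.
pose Z : R := (8 / eps) ^+ k.-1.
have X0 : 0 <= X by rewrite exprn_ge0 // divr_ge0 ?mulr_ge0 // ltW.
have Z0 : 0 < Z by rewrite exprn_gt0 // divr_gt0.
pose A : R := 4 * X * Z.
have A0 : 0 <= A by rewrite !mulr_ge0 // ltW.
(* [A] makes the density of tuples that are not wide at most [eta ^ k.-1 / 4]; [beta^-1] is there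
   for [e <= eps * b]. *)
pose Q := (Num.truncn (A + beta^-1)).+1.
have QA : A + beta^-1 < Q%:R by exact: truncnS_gt.
have ib : 0 < beta^-1 by rewrite invr_gt0.
have QR : 0 < Q%:R :> R by rewrite ltr0n.
(* With this value the linear terms of [n / K] steps add up to exactly [rho ^ D / 2]; the other half
   is left for the quadratic errors. *)
pose rho : R := 16 * D%:R / Q%:R.
have D0 : 0 < D%:R :> R by rewrite ltr0n; rewrite /D; slia.
have rho0 : 0 < rho by rewrite divr_gt0 // mulr_gt0.
pose eta : R := eps / (8 * Q%:R).
have eta0 : 0 < eta by rewrite divr_gt0 // mulr_gt0.
have Htheta : (rho / (4 * eps * beta)) ^+ D <= eta ^+ k.-1 / 4.
  have -> : rho / (4 * eps * beta) = (4 * D%:R / (eps * beta)) / Q%:R.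
    by rewrite /rho; field; rewrite !gt_eqF.
  have -> : eta = (8 / eps)^-1 / Q%:R by rewrite /eta; field; rewrite !gt_eqF.
  have -> : (4 * D%:R / (eps * beta) / Q%:R) ^+ D = X / Q%:R ^+ D by exact: expr_div_n.
  have -> : ((8 / eps)^-1 / Q%:R) ^+ k.-1 = Z^-1 / Q%:R ^+ k.-1.
    by rewrite /Z -exprVn expr_div_n.
  rewrite ler_pdivrMr ?exprn_gt0 // -(subnK (_ : k.-1 <= D)%N); last by rewrite /D; slia.
  rewrite exprD mulrA.
  have q1 : 0 < Q%:R ^+ k.-1 :> R by rewrite exprn_gt0.
  have -> : Z^-1 / Q%:R ^+ k.-1 / 4 * Q%:R ^+ (D - k.-1) * Q%:R ^+ k.-1 =
      Q%:R ^+ (D - k.-1) / (4 * Z).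
    by move: q1; move: (_ ^+ k.-1) (_ ^+ (D - k.-1)) => u w u0; field; rewrite !gt_eqF.
  rewrite ler_pdivlMr ?mulr_gt0 //.
  apply: le_trans (_ : Q%:R <= _); first by move: QA ib; rewrite /A; lra.
  by rewrite -[leLHS]expr1; apply: ler_weXn2l; rewrite ?ler1n // /D; slia.
have d1 : 0 < rho ^+ D / 2 by rewrite divr_gt0 // exprn_gt0.
have d2 : 0 < eta ^+ k.-1 / 4 by rewrite divr_gt0 // exprn_gt0.
have d3 : 0 < (eta ^+ k / 2) ^+ (t ^ k) by rewrite exprn_gt0 // divr_gt0 // exprn_gt0.
have [n1 H1] := eventually_div (4 * c * K%:R) d1.
have [n2 H2] := eventually_div (k.-1 * k.-1)%:R d2.
have [n3 H3] := eventually_div (K * K)%:R d3.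
have [n4 H4] := eventually_div 1 eta0.
exists (n1 + n2 + n3 + n4)%N => V lab b E HD bb nn W Wb.
set n := #|V| in bb nn *.
have {}H1 : 4 * c * K%:R / n%:R < rho ^+ D / 2 by apply: H1; slia.
have {}H2 : (k.-1 * k.-1)%:R / n%:R < eta ^+ k.-1 / 4 by apply: H2; slia.
have {}H3 : (K * K)%:R / n%:R < (eta ^+ k / 2) ^+ (t ^ k) by apply: H3; slia.
have {}H4 : 1 / n%:R < eta by apply: H4; slia.
have nV0 : (0 < n)%N := dirac_card_gt0 HD.
have nR : 0 < n%:R :> R by rewrite ltr0n.
have [x0 _] : exists x0, x0 \in V by apply/card_gt0P.
pose e := Num.truncn (n%:R * (eps / (4 * Q%:R))).
have /andP[e1 e2] : e%:R <= n%:R * (eps / (4 * Q%:R)) < e.+1%:R.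
  by apply: truncn_itv; rewrite mulr_ge0 // ltW // divr_gt0 // mulr_gt0.
have etaE : eps / (4 * Q%:R) = 2 * eta by rewrite /eta; field; rewrite gt_eqF.
have e_n : eta <= e%:R / n%:R.
  rewrite ler_pdivlMr //; move: e2 H4; rewrite etaE -natr1 ltr_pdivrMr //.
  by lra.
have e0 : (0 < e)%N.
  by rewrite -(ltr_nat R) -(ltr_pM2r (_ : 0 < n%:R^-1)) ?invr_gt0 // mul0r; apply: lt_le_trans e_n.
have eb : e%:R <= eps * b%:R.
  apply: le_trans e1 _; rewrite mulrC -mulrA; apply: ler_wpM2l; first exact: ltW.
  apply: le_trans bb; apply: ler_wpM2r; first exact: ltW.
  rewrite invf_ple ?posrE ?mulr_gt0 //; first by move: QA A0 ib; lra.
pose step : R := D%:R / n%:R * (8 * K%:R * rho ^+ D.-1 / Q%:R) + c * (2 * K%:R / n%:R) ^+ 2.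
have step_sum j : (K * j <= n)%N -> j%:R * step <= rho ^+ D.
  move=> Kj; have Kj' : j%:R * K%:R / n%:R <= 1 :> R.
    by rewrite ler_pdivrMr // mul1r -natrM ler_nat mulnC.
  have -> : j%:R * step = (j%:R * K%:R / n%:R) * (rho ^+ D / 2 + 4 * c * K%:R / n%:R).
    have -> : rho ^+ D = rho ^+ D.-1 * (16 * D%:R / Q%:R) by rewrite -{1}dk exprSr.
    by rewrite /step; move: (rho ^+ D.-1) => u; field; rewrite !gt_eqF.
  apply: le_trans (_ : 1 * (rho ^+ D / 2 + 4 * c * K%:R / n%:R) <= _); last by lra.
  apply: ler_wpM2r => //; apply: addr_ge0; first exact: ltW.
  by apply: divr_ge0 => //; rewrite !mulr_ge0.
pose ok (ts : seq (seq V)) := [/\ all (fun q => (size q == k * t)%N && tight k E q) ts,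
    uniq (flatten ts) & all (mem W) (flatten ts)].
have size_ok ts : ok ts -> (size (flatten ts) = K * size ts)%N.
  by move=> [h _ _]; apply: size_flatten_const; apply: sub_all h => q /andP[].
have card_ok ts : ok ts -> (#|W :\: [set v in flatten ts]| + K * size ts = #|W|)%N.
  move=> ok_ts; have [_ uf /allP sW] := ok_ts.
  rewrite -[RHS](cardsID [set v in flatten ts] W) addnC (setIidPr _).
    rewrite -(size_ok _ ok_ts); congr (_ + _)%N; rewrite cardsE.
    by apply/esym/card_uniqP.
  by apply/subsetP => v; rewrite inE => /sW.
suff loop j : (exists2 ts, ok ts & #|W|%:R - (K * size ts)%:R <= eps * n%:R) \/
    (exists2 ts, ok ts /\ size ts = j &
       potential R lab k E W (W :\: [set v in flatten ts]) <= j%:R * step).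
  have [[ts [? ? ?] ?]|[ts [ok_ts st] _]] := loop n.+1; first by exists ts.
  exfalso; have := card_ok _ ok_ts; rewrite st.
  have h : (#|W| <= n)%N by exact: max_card.
  by move: h K0; clear; nia.
elim: j => [|j [IH|[ts [ok_ts st] Hp]]]; [right|by left|].
  exists [::] => //; rewrite mul0r (_ : _ :\: _ = W) ?(potential_W R HD Wb) //.
  by apply/setP => v; rewrite !inE.
set U := W :\: _ in Hp; have cU := card_ok _ ok_ts; rewrite -/U st in cU.
have [small|big] := lerP (#|U|%:R) (eps * n%:R).
  by left; exists ts => //; rewrite st -cU natrD addrK.
right.
have Kj : (K * j <= n)%N by apply: leq_trans (max_card (mem W)); rewrite -cU leq_addl.
have QeU : (2 * Q * e < #|U|)%N.
  rewrite -(ltr_nat R); apply: le_lt_trans big; rewrite !natrM.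
  apply: le_trans (_ : 2 * Q%:R * (n%:R * (eps / (4 * Q%:R))) <= _).
    by apply: ler_wpM2l; rewrite ?mulr_ge0.
  have -> : 2 * Q%:R * (n%:R * (eps / (4 * Q%:R))) = eps * n%:R / 2 by field; rewrite gt_eqF.
  have en : 0 < eps * n%:R by rewrite mulr_gt0.
  by move: en; lra.
have c1_ge : eta ^+ k.-1 / 2 <= (e%:R / n%:R) ^+ k.-1 -
    (rho / (4 * eps * b%:R / n%:R)) ^+ D - (k.-1 * k.-1)%:R / n%:R.
  have h1 : eta ^+ k.-1 <= (e%:R / n%:R) ^+ k.-1.
    by apply: lerXn2r => //; rewrite nnegrE; [exact: ltW|exact: divr_ge0].
  have b0 : 0 < b%:R :> R by apply: lt_le_trans bb; rewrite mulr_gt0.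
  have h2 : (rho / (4 * eps * b%:R / n%:R)) ^+ D <= (rho / (4 * eps * beta)) ^+ D.
    have z1 : 0 < 4 * eps * beta by rewrite !mulr_gt0.
    have z12 : 4 * eps * beta <= 4 * eps * b%:R / n%:R.
      by rewrite ler_pdivlMr // -(mulrA (4 * eps)); apply: ler_wpM2l bb; rewrite mulr_ge0 // ltW.
    have z2 := lt_le_trans z1 z12.
    apply: lerXn2r; first by rewrite nnegrE; apply/ltW/divr_gt0.
      by rewrite nnegrE; apply/ltW/divr_gt0.
    by rewrite ler_pM2l // lef_pV2 ?posrE.
  by move: h1 h2 Htheta H2; lra.
have [|//|q [sq uq qU tq Hq]] := tile_step HD Wb x0 Hc c0 t0 rho0 eps0 e0 (ltn0Sn _ : 0 < Q)%N
    (le_trans Hp (step_sum _ Kj)) (subsetDl _ _) (ltW big) eb QeU (le_trans _ c1_ge).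
- by rewrite divr_ge0 // exprn_ge0 // ltW.
- apply: lt_le_trans H3 _; apply: lerXn2r.
  + by rewrite nnegrE divr_ge0 // exprn_ge0 // ltW.
  + rewrite nnegrE mulr_ge0 ?divr_ge0 //; apply: le_trans c1_ge.
    by rewrite divr_ge0 // exprn_ge0 // ltW.
  rewrite -{1}(prednK k0) exprSr mulrAC; apply: ler_pM => //; last exact: ltW.
  by rewrite divr_ge0 // exprn_ge0 // ltW.
have [a1 a2 a3] := ok_ts.
exists (q :: ts).
  split; last by rewrite /= st.
  split=> /=; first by rewrite sq eqxx tq.
  - rewrite cat_uniq uq a2 andbT /=; apply/hasPn => v vts; apply/negP => /= vq.
    by have := allP qU v vq; rewrite /= !inE vts.
  - by rewrite all_cat a3 andbT; apply: sub_all qU => v /=; rewrite inE => /andP[].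
rewrite (_ : W :\: _ = U :\: [set v in q]); last first.
  by apply/setP => v; rewrite !inE mem_cat negb_or andbA.
apply: le_trans Hq _.
have -> : j.+1%:R * step = j%:R * step + step by rewrite -natr1 mulrDl mul1r.
by rewrite -addrA; apply: lerD Hp _; exact: lexx.
Qed.

Local Close Scope ring_scope.

(** * Assembling paths *)

Section Flatten.
Variables (T : eqType).
Implicit Types (fam qs : seq (seq T)).

Lemma mem_flatten fam (q : seq T) v : q \in fam -> v \in q -> v \in flatten fam.
Proof. by move=> qf vq; apply/flattenP; exists q. Qed.

Lemma flatten_disjoint fam q q' v : uniq (flatten fam) -> q \in fam -> q' \in fam ->
  v \in q -> v \in q' -> q = q'.
Proof.
elim: fam => //= s fam IH; rewrite cat_uniq => /and3P[_ d u].
rewrite !inE => /predU1P[->|qf] /predU1P[->|qf'] vq vq' //.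
- by case/hasP: d; exists v => //; apply: mem_flatten vq'.
- by case/hasP: d; exists v => //; apply: mem_flatten vq.
- exact: IH.
Qed.

Lemma flatten_uniq_mem fam q : uniq (flatten fam) -> q \in fam -> uniq q.
Proof.
elim: fam => //= s fam IH; rewrite cat_uniq inE => /and3P[us _ u] /predU1P[->//|].
exact: IH.
Qed.

Lemma uniq_of_flatten fam : uniq (flatten fam) -> [::] \notin fam -> uniq fam.
Proof.
elim: fam => //= s fam IH; rewrite cat_uniq inE negb_or => /and3P[_ d u] /andP[s0 nf].
rewrite IH // andbT; apply/negP => sf.
case: s s0 d sf => // v s _ /hasPn d sf.
by have := d v (mem_flatten sf (mem_head _ _)); rewrite /= mem_head.
Qed.

Lemma uniq_flatten_map (f : seq T -> seq T) fam qs :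
  uniq (flatten fam) -> uniq qs -> {subset qs <= fam} ->
  (forall q, q \in fam -> uniq (f q) /\ {subset f q <= q}) ->
  uniq (flatten (map f qs)).
Proof.
move=> uf uqs sub Hf; elim: qs uqs sub => //= q qs IH /andP[qqs uqs] sub.
have qf : q \in fam by apply: sub; rewrite mem_head.
have sub' : {subset qs <= fam} by move=> x xq; apply: sub; rewrite inE xq orbT.
have [ufq sfq] := Hf q qf.
rewrite cat_uniq ufq IH // andbT /=; apply/hasPn => v /flattenP[s /mapP[q' q'q ->]] vq'.
apply/negP => /= vq; move: qqs; have [_ sfq'] := Hf q' (sub' _ q'q).
by rewrite (flatten_disjoint uf qf (sub' _ q'q) (sfq _ vq) (sfq' _ vq')) q'q.
Qed.

Lemma sub_flatten_map (f : seq T -> seq T) fam qs :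
  {subset qs <= fam} -> (forall q, q \in fam -> {subset f q <= q}) ->
  {subset flatten (map f qs) <= flatten fam}.
Proof.
move=> sub Hf v /flattenP[s /mapP[q qq ->]] vq.
by apply: mem_flatten (sub _ qq) _; apply: Hf => //; apply: sub.
Qed.

Lemma fresh_hit fam qs (P : pred (seq T)) : uniq fam -> size qs < count P fam ->
  exists2 q, q \in fam & P q && (q \notin qs).
Proof.
move=> uf lt; have : has (fun q => P q && (q \notin qs)) fam.
  rewrite has_count; have le : count (mem qs) fam <= size qs.
    rewrite -size_filter; apply: uniq_leq_size; first exact: filter_uniq.
    by move=> q; rewrite mem_filter => /andP[].
  have : count P fam <= count (fun q => P q && (q \notin qs)) fam + count (mem qs) fam.
    elim: (fam) => //= q s; case: (P q); case: (q \in qs) => /=; clear; lia.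
  by move: lt le; clear; lia.
by case/hasP => q qf Pq; exists q.
Qed.

Lemma uniq_map_nth (x0 : T) q pos : uniq q -> uniq pos -> all (gtn (size q)) pos ->
  uniq (map (nth x0 q) pos) /\ {subset map (nth x0 q) pos <= q}.
Proof.
move=> uq up /allP bp; split; last first.
  by move=> v /mapP[i ip ->]; apply: mem_nth; apply: bp.
rewrite map_inj_in_uniq // => i j ip jp; apply: (uniqP x0 uq); rewrite inE; exact: bp.
Qed.

End Flatten.

Section Weave.
Variables (V : finType) (cp : seq V -> seq V).

Fixpoint weave (qs ps : seq (seq V)) : seq (seq V) :=
  if qs is q :: qs' then if ps is p :: ps' then cp q :: p :: weave qs' ps' else [::]
  else [::].

Lemma weave_rcons (qs ps : seq (seq V)) (q p : seq V) : size qs = size ps ->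
  weave (rcons qs q) (rcons ps p) = weave qs ps ++ [:: cp q; p].
Proof. by elim: qs ps => [|q' qs IH] [|p' ps] //= [/IH ->]. Qed.

Lemma perm_weave (qs ps : seq (seq V)) : size qs = size ps ->
  perm_eq (flatten (weave qs ps)) (flatten ps ++ flatten (map cp qs)).
Proof.
elim: qs ps => [|q qs IH] [|p ps] //= [/IH /permP e]; apply/permP => a.
by have := e a; rewrite !count_cat; lia.
Qed.

Lemma mem_weave (qs ps : seq (seq V)) (p : seq V) : size qs = size ps -> p \in ps -> p \in weave qs ps.
Proof.
elim: qs ps => [|q qs IH] [|p' ps] //= [/IH e]; rewrite !inE.
by case/predU1P => [->|/e->]; rewrite ?eqxx ?orbT.
Qed.

Variables (k : nat) (E : {set {set V}}).
Hypothesis k2 : 2 < k.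
Let k0 : 0 < k. Proof. by move: k2; lia. Qed.
Local Notation tight := (tight k E).
Variables (fam : seq (seq V)) (h : nat).
Hypothesis ufam : uniq fam.
Hypothesis Hfam : forall X Y : seq V, size X = k.-1 -> uniq X -> size Y = k.-1 -> uniq Y ->
  h <= count (fun q => tight (X ++ cp q ++ Y)) fam.

Definition linkable (p : seq V) := [&& tight p, uniq p & k.-1 <= size p].

(** Each join can be made by at least [h] tuples of the bank. Fewer than [h] are in use when it is
    made, so a greedy choice never gets stuck. *)
Lemma connect_pieces (ps : seq (seq V)) (p0 : seq V) (us : seq (seq V)) : linkable p0 -> all linkable ps ->
  uniq us -> size us + size ps <= h -> exists qs, [/\ size qs = size ps, uniq (us ++ qs),
    {subset qs <= fam} & tight (flatten (p0 :: weave qs ps))].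
Proof.
elim: ps p0 us => [|p ps IH] p0 us lp0 /= => [_ uus _|/andP[lp lps] uus sz].
  by exists [::]; split=> //=; rewrite ?cats0 //; case/and3P: lp0.
have [/and3P[t0 u0 s0] /and3P[t1 u1 s1]] := (lp0, lp).
pose X := drop (size p0 - k.-1) p0; pose Y := take k.-1 p.
have sX : size X = k.-1 by rewrite size_drop; move: s0; clear; lia.
have sY : size Y = k.-1 by rewrite size_takel.
have uX : uniq X by apply: drop_uniq.
have uY : uniq Y by apply: take_uniq.
have [|q qf /andP[tq qus]] := @fresh_hit _ fam us (fun q => tight (X ++ cp q ++ Y)) ufam.
  by apply: leq_trans (Hfam sX uX sY uY); apply: leq_trans sz; rewrite addnS ltnS leq_addr.
have [||qs [sqs uqs sub tqs]] := IH p (rcons us q) lp lps.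
- by rewrite rcons_uniq qus.
- by rewrite size_rcons; move: sz; clear; lia.
exists (q :: qs); split => /=.
- by rewrite sqs.
- by move: uqs; rewrite cat_rcons.
- by move=> x; rewrite inE => /predU1P[->|/sub].
have tXY : tight (p0 ++ cp q ++ p).
  have e0 : p0 = take (size p0 - k.-1) p0 ++ X by rewrite cat_take_drop.
  have e1 : p = Y ++ drop k.-1 p by rewrite cat_take_drop.
  have h1 : tight (X ++ cp q ++ p).
    rewrite {1}e1 catA; rewrite catA in tq.
    have := @tight_cat _ k E k0 (X ++ cp q) Y (drop k.-1 p).
    by rewrite -!catA; apply; rewrite ?sY //; [rewrite catA | rewrite cat_take_drop].
  rewrite {1}e0 -catA; apply: (tight_cat k0); rewrite ?sX //.
  by rewrite cat_take_drop.
have := @tight_cat _ k E k0 (p0 ++ cp q) p (flatten (weave qs ps)) s1.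
by rewrite -!catA; apply.
Qed.

End Weave.

Section Replace.
Variables (V : finType) (k : nat) (E : {set {set V}}).
Hypothesis k0 : 0 < k.
Local Notation tight := (tight k E).
Local Notation cyc_tight := (cyc_tight k E).

Definition replaceable (p p' : seq V) : Prop :=
  exists a m m' b, [/\ p = a ++ m ++ b, p' = a ++ m' ++ b, k.-1 <= size a, k.-1 <= size b & tight p'].

(** Old pieces are added on one side and new ones on the other, so vertices are balanced without
    subtracting multisets. Blocks that are not replaced remain available for later exchanges. *)
Lemma replace_blocks (prs : seq (seq V * seq V)) (bl : seq (seq V)) :
  uniq (map fst prs) -> {subset map fst prs <= bl} ->
  (forall pr, pr \in prs -> replaceable pr.1 pr.2) -> cyc_tight (flatten bl) ->
  exists bl', [/\ cyc_tight (flatten bl'),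
    perm_eq (flatten bl' ++ flatten (map fst prs)) (flatten bl ++ flatten (map snd prs)) &
    forall p, p \in bl -> p \notin map fst prs -> p \in bl'].
Proof.
elim: prs bl => [|[p p'] prs IH] bl /=.
  by move=> _ _ _ tb; exists bl; split.
move=> /andP[pn up] sub Hr tb.
have [a [m [m' [b [/= e1 e2 sa sb tp']]]]] := Hr (p, p') (mem_head _ _).
have pbl : p \in bl by apply: sub; rewrite mem_head.
have [bl1 [bl2 ebl]] : exists bl1 bl2, bl = bl1 ++ p :: bl2.
  by case/splitPr: pbl => bl1 bl2; exists bl1, bl2.
have keep x : x \in bl -> x != p -> x \in bl1 ++ p' :: bl2.
  by rewrite ebl !mem_cat !inE => /or3P[->//|->//|->]; rewrite ?orbT.
have [| | |bl' [t' pm kp]] := IH (bl1 ++ p' :: bl2) up.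
- move=> x xp; apply: keep; first by apply: sub; rewrite inE xp orbT.
  by apply: contraNneq pn => <-.
- by move=> pr prp; apply: Hr; rewrite inE prp orbT.
- move: tb; rewrite ebl !flatten_cat /= e1 e2.
  by apply: cyc_tight_replace => //; rewrite -e2.
exists bl'; split=> //.
  apply/permP => c; move/permP/(_ c): pm.
  by rewrite ebl !flatten_cat /= !count_cat; clear; lia.
move=> x xb; rewrite inE negb_or => /andP[xp xn]; apply: kp => //; exact: keep.
Qed.

End Replace.

Lemma uniq_flatten_fam (I T : eqType) (F : I -> seq T) (s : seq I) : uniq s ->
  (forall i, i \in s -> uniq (F i)) ->
  (forall i j v, i \in s -> j \in s -> v \in F i -> v \in F j -> i = j) ->
  uniq (flatten (map F s)).
Proof.
elim: s => //= i s IH /andP[is_ us] H1 H2; rewrite cat_uniq H1 ?mem_head //=.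
rewrite IH // ?andbT; first last.
- by move=> a b v sa sb; apply: H2; rewrite inE ?sa ?sb orbT.
- by move=> a sa; apply: H1; rewrite inE sa orbT.
apply/hasPn => v /flattenP[t /mapP[j js ->]] vj; apply/negP => /= vi.
by move: is_; rewrite (H2 i j v) ?mem_head ?inE ?js ?orbT.
Qed.

Lemma mixed_radix_inj K i j m m' : m < K -> m' < K -> i * K + m = j * K + m' -> i = j /\ m = m'.
Proof.
move=> mK mK' e; have K0 : 0 < K by apply: leq_ltn_trans mK.
have := congr1 (divn^~ K) e; rewrite /= !divnMDl // !divn_small // !addn0 => ij.
by split=> //; move: e; rewrite ij => /addnI.
Qed.

Section Pieces.
Variables (V : finType) (k : nat) (x0 : V).
Hypothesis k2 : 2 < k.

(** Initial layout, holding the exchange partner; a swap puts a leftover vertex in its place and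
    releases it. *)
Definition swap_piece (q : seq V) := swapA k x0 q ++ swapW k x0 q :: swapB k x0 q.

Lemma swap_piece_ok (q : seq V) : size q = k * 2 -> uniq q ->
  uniq (swap_piece q) /\ {subset swap_piece q <= q}.
Proof.
move=> sq uq; rewrite (_ : swap_piece q = map (nth x0 q)
   ([seq m * 2 | m <- iota 0 k.-1] ++ k.-1 * 2 :: [seq m * 2 + 1 | m <- iota 0 k.-1])).
  apply: uniq_map_nth => //.
    rewrite cat_uniq /= map_inj_uniq ?iota_uniq; last by move=> i j; lia.
    rewrite map_inj_uniq ?iota_uniq; last by move=> i j; lia.
    rewrite andbT negb_or -andbA /=; apply/and3P; split.
    - by apply/mapP => -[i]; rewrite mem_iota; lia.
    - by apply/hasPn => v /mapP[i _ ->]; apply/mapP => -[j _]; lia.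
    - by apply/mapP => -[i _]; lia.
  apply/allP => v; rewrite mem_cat inE /= sq => /or3P[/mapP[i]|/eqP->|/mapP[i]]; rewrite ?mem_iota; lia.
by rewrite map_cat /= -!map_comp.
Qed.

(** Initial layout: the outer blocks are adjacent, and the vertices of the middle block sit inside
    the links. Absorbing fills the links with new vertices and moves the middle block between the
    outer ones. *)
Definition abs_pieces (q : seq V) : seq (seq V) :=
  (absX k x0 q 0 ++ absX k x0 q 2) ::
  [seq absA k x0 q i ++ nth x0 (absX k x0 q 1) i :: absB k x0 q i | i <- iota 0 k].

Lemma abs_pieces_ok (q : seq V) : size q = (k + k * k.-1) * 3 -> uniq q ->
  uniq (flatten (abs_pieces q)) /\ {subset flatten (abs_pieces q) <= q}.
Proof.
move=> sq uq.
pose F i := [seq (k + (i * k.-1 + m)) * 3 | m <- iota 0 k.-1] ++ (i * 3 + 1) ::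
  [seq (k + (i * k.-1 + m)) * 3 + 1 | m <- iota 0 k.-1].
rewrite (_ : flatten (abs_pieces q) = map (nth x0 q)
   (([seq m * 3 + 0 | m <- iota 0 k] ++ [seq m * 3 + 2 | m <- iota 0 k]) ++
     flatten [seq F i | i <- iota 0 k])).
  have inF i v : v \in F i -> i < k ->
     [\/ exists2 m, m < k.-1 & v = (k + (i * k.-1 + m)) * 3, v = i * 3 + 1 |
         exists2 m, m < k.-1 & v = (k + (i * k.-1 + m)) * 3 + 1].
    rewrite mem_cat inE => /or3P[/mapP[m p ->]|/eqP->|/mapP[m p ->]] ik.
    - by constructor 1; exists m => //; move: p; rewrite mem_iota.
    - by constructor 2.
    - by constructor 3; exists m => //; move: p; rewrite mem_iota.
  apply: uniq_map_nth => //.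
    rewrite cat_uniq; apply/and3P; split.
    - rewrite cat_uniq !map_inj_uniq ?iota_uniq; try by move=> i j; lia.
      by rewrite andbT; apply/hasPn => v /mapP[i _ ->]; apply/mapP => -[j _]; lia.
    - apply/hasPn => v /flattenP[s /mapP[i]]; rewrite mem_iota => /= ik -> vF.
      rewrite mem_cat negb_or; case: (inF _ _ vF ik) => [[m mk ->]|->|[m mk ->]]; apply/andP; split;
        apply/mapP => -[j]; rewrite mem_iota; lia.
    apply: uniq_flatten_fam; first exact: iota_uniq.
      move=> i _; rewrite cat_uniq /= !map_inj_uniq ?iota_uniq; try by move=> ? ?; lia.
      rewrite andbT negb_or -andbA /=; apply/and3P; split.
      - by apply/mapP => -[m _]; lia.
      - by apply/hasPn => v /mapP[m _ ->]; apply/mapP => -[j _]; lia.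
      - have h : i <= i * k.-1 by rewrite leq_pmulr //; lia.
        by apply/mapP => -[m _]; lia.
    move=> i j v; rewrite !mem_iota /= => ik jk vi vj.
    case: (inF _ _ vi ik) => [[m mk e]|e|[m mk e]]; case: (inF _ _ vj jk) => [[m' mk' e']|e'|[m' mk' e']]; try lia.
      by have [] := @mixed_radix_inj k.-1 i j m m' mk mk' ltac:(lia).
    by have [] := @mixed_radix_inj k.-1 i j m m' mk mk' ltac:(lia).
  apply/allP => v /=; rewrite !mem_cat sq => /orP[/orP[]/mapP[m]|].
  - by rewrite mem_iota => mk ->; nia.
  - by rewrite mem_iota => mk ->; nia.
  case/flattenP => s /mapP[i]; rewrite mem_iota => ik -> vF.
  have b m : m < k.-1 -> k + (i * k.-1 + m) < k + k * k.-1.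
    move=> mk; rewrite ltn_add2l; apply: leq_trans (_ : i.+1 * k.-1 <= _).
      by rewrite mulSn addnC ltn_add2r.
    by rewrite leq_mul2r; apply/orP; right; move: ik; lia.
  by case: (inF _ _ vF ik) => [[m /b mk ->]|->|[m /b mk ->]]; nia.
rewrite !map_cat -!map_comp /abs_pieces /=; congr (_ ++ _).
rewrite map_flatten -map_comp; congr flatten; apply/eq_in_map => i; rewrite mem_iota => /= ik.
by rewrite map_cat /= -!map_comp nth_mkseq.
Qed.

End Pieces.

Lemma perm_flatten_insert (I T : eqType) (A B : I -> seq T) (f : I -> T) (s : seq I) :
  perm_eq (flatten [seq A i ++ f i :: B i | i <- s])
          (flatten [seq A i ++ B i | i <- s] ++ map f s).
Proof.
elim: s => //= i s /permP IH; apply/permP => a; have := IH a.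
by rewrite /= !count_cat /= ?count_cat /=; lia.
Qed.

(** * Swapping and absorbing the leftover vertices *)

Section Phases.
Variables (V : finType) (lab : V -> nat) (k b : nat) (E : {set {set V}}).
Hypothesis H : dirac lab k b E.
Let k2 : 2 < k. Proof. exact: dirac_k H. Qed.
Let k0 : 0 < k. Proof. by move: k2; lia. Qed.
Let b0 : 0 < b. Proof. by have := dirac_kb H; move: k2; lia. Qed.
Local Notation n := #|V|.
Local Notation top := (is_top lab k).
Local Notation tight := (tight k E).
Local Notation cyc_tight := (cyc_tight k E).
Variables (x0 : V) (ell : nat).
Hypothesis nell : n <= ell * b.
Local Notation sp := (swap_piece k x0).
Local Notation aps := (abs_pieces k x0).

(* Number of upward swaps that certainly turn a leftover vertex into a top one. *)
Definition cost (u : V) : nat := if top u then 0 else ell - lab u %/ b.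

Lemma cost_le u : cost u <= ell.
Proof. by rewrite /cost; case: ifP => // _; apply: leq_subr. Qed.

Lemma cost_upward u w : ~~ top u -> upward lab k b u w -> cost w < cost u.
Proof.
move=> tu; rewrite /cost (negPf tu) /upward.
have lu : lab u %/ b < ell.
  rewrite ltn_divLR //; apply: leq_trans nell.
  by move: tu k2; rewrite /is_top; clear; lia.
case: (top w) => /= [_|uw]; first by rewrite subn_gt0.
have : lab u %/ b + 1 <= lab w %/ b.
  by apply: leq_trans (leq_div2r _ uw); rewrite divnDr // divnn b0.
by move: lu; clear; lia.
Qed.

Lemma size_swapA q : size (swapA k x0 q) = k.-1. Proof. by rewrite size_mkseq. Qed.
Lemma size_swapB q : size (swapB k x0 q) = k.-1. Proof. by rewrite size_mkseq. Qed.

(** Induction on the total cost: a swap consumes one swapper and lowers the total cost by at least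
    1, so every vertex still has as many swappers as the remaining cost. The list [keep] protects
    the absorbers. *)
Lemma swap_phase N (fam keep bl : seq (seq V)) (U : seq V) :
  \sum_(v <- U) cost v <= N ->
  uniq fam -> {in fam &, injective sp} -> (forall q, q \in fam -> sp q \in bl) ->
  (forall q, q \in fam -> sp q \notin keep) -> {subset keep <= bl} ->
  cyc_tight (flatten bl) ->
  (forall u, \sum_(v <- U) cost v <= count (swapper lab k b E x0 u) fam) ->
  exists bl' U', [/\ cyc_tight (flatten bl'),
    perm_eq (flatten bl' ++ U') (flatten bl ++ U), {subset keep <= bl'},
    all top U' & size U' = size U].
Proof.
elim: N fam bl U => [|N IH] fam bl U HN uf inj spbl spk kbl tbl Hc.
  exists bl, U; split=> //; apply/allP => u uU; apply: contraT => tu.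
  have := HN; rewrite (big_rem u) //= leqn0 addn_eq0 => /andP[/eqP c0 _].
  have lu : lab u %/ b < ell.
    rewrite ltn_divLR //; apply: leq_trans nell.
    by move: tu k2; rewrite /is_top; clear; lia.
  by move: c0; rewrite /cost (negPf tu); move: lu; clear; lia.
have [tU|] := boolP (all top U); first by exists bl, U.
case/allPn => u uU tu.
have cu : 0 < cost u.
  have lu : lab u %/ b < ell.
    rewrite ltn_divLR //; apply: leq_trans nell.
    by move: tu k2; rewrite /is_top; clear; lia.
  by rewrite /cost (negPf tu) subn_gt0.
have sumU : \sum_(v <- U) cost v = cost u + \sum_(v <- rem u U) cost v by rewrite (big_rem u).
have : has (swapper lab k b E x0 u) fam.
  by rewrite has_count; apply: leq_trans (Hc u); rewrite sumU; move: cu; clear; lia.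
case/hasP => q qf /and3P[t1 t2 up].
pose w := swapW k x0 q.
have cw : cost w < cost u by apply: cost_upward.
pose p' := swapA k x0 q ++ u :: swapB k x0 q.
have [| | |bl1 [tbl1 pm kp]] := @replace_blocks _ k E k0 [:: (sp q, p')] bl _ _ _ tbl => //.
- by move=> x; rewrite inE => /eqP->; apply: spbl.
- move=> pr; rewrite inE => /eqP-> /=.
  exists (swapA k x0 q), [:: w], [:: u], (swapB k x0 q); split=> //.
  + by rewrite size_swapA.
  + by rewrite size_swapB.
have sumU1 : \sum_(v <- w :: rem u U) cost v < \sum_(v <- U) cost v.
  by rewrite big_cons sumU ltn_add2r.
have urem : uniq (rem q fam) by apply: rem_uniq.
have memrem x : x \in rem q fam -> x \in fam /\ x != q.
  by rewrite mem_rem_uniq // inE => /andP[].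
have [| | | | | | | |bl2 [U2 [h1 h2 h3 h4 h5]]] := IH (rem q fam) bl1 (w :: rem u U).
- by move: HN sumU1; clear; lia.
- exact: urem.
- by move=> x y /memrem[xf _] /memrem[yf _]; apply: inj.
- move=> x /memrem[xf xq]; apply: kp; first exact: spbl.
  by rewrite /= inE; apply: contraNneq xq => /inj->.
- by move=> x /memrem[xf _]; apply: spk.
- move=> p pk; apply: kp; first exact: kbl.
  by rewrite /= inE; apply: contraTneq pk => ->; apply: spk.
- exact: tbl1.
- move=> v; have := Hc v; have /permP/(_ (swapper lab k b E x0 v)) := perm_to_rem qf.
  move=> /= ->; move: sumU1; case: (swapper _ _ _ _ _ v q) => /=; clear; lia.
exists bl2, U2; split=> //; last by rewrite h5 /= size_rem // prednK //; case: (U) uU.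
apply: (perm_trans h2); apply/permP => a; move/permP/(_ a): pm.
have /permP/(_ a) /= e := perm_to_rem uU.
rewrite /= !cats0 !count_cat /= ?count_cat /= e -/w; clear; lia.
Qed.

(** Each round absorbs [k] vertices and consumes one absorber, so every tuple loses at most one of
    the [j] absorbers that it needs. *)
Lemma absorb_phase j (fam bl : seq (seq V)) (U : seq V) :
  size U = k * j -> all top U -> uniq fam ->
  (forall q, q \in fam -> uniq (aps q)) ->
  (forall q q' p, q \in fam -> q' \in fam -> p \in aps q -> p \in aps q' -> q = q') ->
  (forall q, q \in fam -> {subset aps q <= bl}) -> cyc_tight (flatten bl) ->
  (forall us : seq V, size us = k -> all top us -> j <= count (absorber k E x0 us) fam) ->
  exists2 bl', cyc_tight (flatten bl') & perm_eq (flatten bl') (flatten bl ++ U).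
Proof.
elim: j fam bl U => [|j IH] fam bl U sU tU uf ua inj sub tbl Hc.
  by exists bl => //; rewrite muln0 in sU; rewrite (size0nil sU) cats0.
pose us := take k U; pose U1 := drop k U.
have sus : size us = k by rewrite size_takel // sU mulnS leq_addr.
have [tus tU1] : all top us /\ all top U1.
  by move: tU; rewrite -{1}(cat_take_drop k U) all_cat => /andP[].
have : has (absorber k E x0 us) fam by rewrite has_count; apply: leq_trans (Hc _ sus tus).
case/hasP => q qf /and3P[t1 t2 /forallP t3].
pose X := absX k x0 q 0; pose Z := absX k x0 q 1; pose Y := absX k x0 q 2.
pose Aq := absA k x0 q; pose Bq := absB k x0 q.
pose prs := (X ++ Y, X ++ Z ++ Y) ::
  [seq (Aq i ++ nth x0 Z i :: Bq i, Aq i ++ nth x0 us i :: Bq i) | i <- iota 0 k].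
have fst_prs : map fst prs = aps q by rewrite /prs /abs_pieces /= -map_comp.
have snd_prs : map snd prs = (X ++ Z ++ Y) :: [seq Aq i ++ nth x0 us i :: Bq i | i <- iota 0 k].
  by rewrite /prs /= -map_comp.
have [| | |bl1 [tbl1 pm kp]] := @replace_blocks _ k E k0 prs bl _ _ _ tbl.
- by rewrite fst_prs; apply: ua.
- by rewrite fst_prs; apply: sub.
- move=> pr; rewrite inE => /predU1P[->|/mapP[i]].
    by exists X, [::], Z, Y; split=> //; rewrite size_mkseq leq_pred.
  rewrite mem_iota => /= ik ->; have /andP[ti _] := t3 (Ordinal ik).
  exists (Aq i), [:: nth x0 Z i], [:: nth x0 us i], (Bq i).
  by split=> //; rewrite size_mkseq.
rewrite fst_prs snd_prs in pm kp.
have memrem x : x \in rem q fam -> x \in fam /\ x != q.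
  by rewrite mem_rem_uniq // inE => /andP[].
have [| | | | | | | |bl2 tbl2 pm2] := IH (rem q fam) bl1 U1.
- by rewrite size_drop sU mulnS addKn.
- exact: tU1.
- exact: rem_uniq.
- by move=> x /memrem[xf _]; apply: ua.
- by move=> x y p /memrem[xf _] /memrem[yf _]; apply: inj.
- move=> x /memrem[xf xq] p px; apply: kp; first exact: (sub x).
  by apply: contra xq => pq; apply/eqP; apply: inj px pq.
- exact: tbl1.
- move=> vs svs tvs; have := Hc vs svs tvs.
  have /permP/(_ (absorber k E x0 vs)) := perm_to_rem qf.
  by move=> /= ->; case: (absorber _ _ _ vs q) => /=; clear; lia.
exists bl2 => //; apply: (perm_trans pm2).
(* [Z] leaves the links and reappears between [X] and [Y], so the net change is the insertion of
   [us]. *)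
apply/permP => a; move/permP/(_ a): pm.
have /permP/(_ a) := perm_flatten_insert Aq Bq (nth x0 Z) (iota 0 k).
have /permP/(_ a) := perm_flatten_insert Aq Bq (nth x0 us) (iota 0 k).
have -> : map (nth x0 us) (iota 0 k) = us by have := mkseq_nth x0 us; rewrite sus.
have -> : map (nth x0 Z) (iota 0 k) = Z.
  by have := mkseq_nth x0 Z; rewrite size_mkseq.
have -> : U = us ++ U1 by rewrite cat_take_drop.
rewrite /abs_pieces -/X -/Z -/Y -/Aq -/Bq /=.
rewrite !count_cat /= ?count_cat; clear; lia.
Qed.

End Phases.

(** As [M >= 4 / c], the two integer bounds make each error term of the greedy selection at most
    [c / 4]. *)
Lemma greedy_nat (R : realType) (V D : finType) (hit : D -> pred (seq V)) C (c : R)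
    (F : seq V) kap h M :
  0 < #|V| -> 0 < #|D| -> (0 < c)%R ->
  (forall d, (c <= mean C (fun q => (hit d q)%:R))%R) ->
  ((1 - c / 4) ^+ kap <= 4^-1)%R -> #|D| < 2 ^ h -> (4 / c <= M%:R)%R ->
  M * (C * (size F + C * (kap * h))) <= #|V| -> M * (C * C) <= #|V| ->
  exists fam : seq (seq V), [/\ size fam = kap * h, all (fun q => size q == C) fam,
    uniq (flatten fam), ~~ has (mem F) (flatten fam) &
    forall d, h <= count (hit d) fam].
Proof.
move=> V0 D0 c0 Hh Hk HD HM H1 H2.
have nR : (0 < #|V|%:R :> R)%R by rewrite ltr0n.
have M0 : (0 < M%:R :> R)%R by apply: lt_le_trans HM; rewrite divr_gt0.
have scale (x : nat) : M * x <= #|V| -> (x%:R / #|V|%:R <= c / 4)%R.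
  move=> Hx; rewrite ler_pdivrMr //.
  apply: le_trans (_ : c / 4 * (M%:R * x%:R) <= _)%R; last first.
    by apply: ler_wpM2l; [rewrite divr_ge0 // ltW|rewrite -natrM ler_nat].
  rewrite mulrA -[leLHS]mul1r; apply: ler_wpM2r => //.
  by move: HM; rewrite ler_pdivrMr //; lra.
apply: (greedy_family (F := mem F) V0 D0 c0 Hh Hk HD).
have h1 := scale _ H1; rewrite natrM in h1.
apply: le_trans (_ : c / 4 + c / 4 <= _)%R; last by lra.
apply: lerD; last exact: scale.
apply: le_trans h1; apply: ler_wpM2r; first by rewrite invr_ge0 ltW.
by apply: ler_wpM2l => //; rewrite ler_nat leq_add2r; exact: card_size.
Qed.

(** * Families of swappers, absorbers and connectors *)

Section Families.
Variables (R : realType) (V : finType) (lab : V -> nat) (k b : nat) (E : {set {set V}}).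
Hypothesis H : dirac lab k b E.
Let k2 : 2 < k. Proof. exact: dirac_k H. Qed.
Let k0 : 0 < k. Proof. by move: k2; lia. Qed.
Let n0 : 0 < #|V|. Proof. exact: dirac_card_gt0 H. Qed.
Local Notation n := #|V|.
Local Notation top := (is_top lab k).
Local Notation tight := (tight k E).
Variables (beta : R).
Hypotheses (beta0 : (0 < beta)%R) (beta1 : (beta <= 1)%R) (beta_b : (beta * n%:R <= b%:R)%R).
Variable x0 : V.
Local Notation sp := (swap_piece k x0).
Local Notation aps := (abs_pieces k x0).

Definition swap_density : R := ((beta ^+ k) ^+ (2 ^ k))%R.
Definition abs_size : nat := k + k * k.-1.
Definition abs_density : R := ((beta ^+ abs_size) ^+ (3 ^ abs_size))%R.

Lemma beta_pow_pos a c : (0 < (beta ^+ a) ^+ c)%R.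
Proof. by rewrite !exprn_gt0. Qed.

Lemma beta_pow_le1 a c : ((beta ^+ a) ^+ c <= 1)%R.
Proof. by rewrite -exprM exprn_ile1 // ltW. Qed.

Lemma swap_family M kap h (F : seq V) :
  (4 / swap_density <= M%:R)%R -> ((1 - swap_density / 4) ^+ kap <= 4^-1)%R -> n < 2 ^ h ->
  M * (k * 2 * (size F + k * 2 * (kap * h))) <= n -> M * (k * 2 * (k * 2)) <= n ->
  exists fam : seq (seq V), [/\ size (flatten fam) <= k * 2 * (kap * h) /\ size fam <= kap * h,
    uniq (flatten fam), ~~ has (mem F) (flatten fam),
    forall u, h <= count (swapper lab k b E x0 u) fam &
    forall q, q \in fam -> size q = k * 2 /\ tight (sp q)].
Proof.
move=> HM Hk HD H1 H2.
have [fam [sf sC uf dF Hd]] := greedy_nat (D := V) n0 n0 (beta_pow_pos _ _)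
  (fun u => mean_swapper H (ltW beta0) beta_b x0 u) Hk HD HM H1 H2.
(* Discarding tuples whose piece is not tight loses no hit, as [swapper] includes this tightness. *)
exists [seq q <- fam | tight (sp q)].
have sub : {subset [seq q <- fam | tight (sp q)] <= fam}.
  by move=> q; rewrite mem_filter => /andP[].
have [fam0|fn0] := eqVneq fam [::].
  rewrite fam0 /= in Hd *; split=> // u; exact: Hd.
have C0 : [::] \notin fam.
  by apply/negP => /(allP sC) /=; rewrite eq_sym; slia.
have uff := uniq_of_flatten uf C0.
split.
- split; last by rewrite size_filter -sf count_size.
  rewrite (@size_flatten_const _ _ (k * 2)).
    by rewrite leq_mul2l size_filter -sf count_size orbT.
  by apply/allP => q /sub /(allP sC).
- rewrite -(map_id [seq q <- fam | _]); apply: (uniq_flatten_map uf) => //.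
    exact: filter_uniq.
  by move=> q qf; split=> //; apply: flatten_uniq_mem qf.
- apply/hasPn => v /flattenP[q /sub qf vq]; move/hasPn: dF; apply.
  exact: mem_flatten vq.
- move=> u; apply: leq_trans (Hd u) _; rewrite count_filter.
  apply: sub_count => q /= /[dup] /and3P[_ t _] ->; exact: t.
- by move=> q; rewrite mem_filter => /andP[tq /(allP sC)/eqP].
Qed.

Lemma abs_family M kap h (F : seq V) :
  (4 / abs_density <= M%:R)%R -> ((1 - abs_density / 4) ^+ kap <= 4^-1)%R -> n ^ k < 2 ^ h ->
  M * (abs_size * 3 * (size F + abs_size * 3 * (kap * h))) <= n ->
  M * (abs_size * 3 * (abs_size * 3)) <= n ->
  exists fam : seq (seq V), [/\ size (flatten fam) <= abs_size * 3 * (kap * h) /\ size fam <= kap * h,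
    uniq (flatten fam), ~~ has (mem F) (flatten fam),
    forall us : seq V, size us = k -> all top us -> h <= count (absorber k E x0 us) fam &
    forall q, q \in fam -> size q = abs_size * 3 /\ all tight (aps q)].
Proof.
move=> HM Hk HD H1 H2.
(* Tuples with a vertex that is not top count as met by everything, so the density bound holds for
   all requests. *)
pose hit (us : k.-tuple V) q := all top us ==> absorber k E x0 us q.
have Hhit us : (abs_density <= mean (abs_size * 3) (fun q => (hit us q)%:R))%R.
  rewrite /hit; have [tus|_] := boolP (all top us).
    by apply: (mean_absorber H (ltW beta0) beta_b x0) => //; apply: size_tuple.
  by rewrite mean_const //; apply: beta_pow_le1.
have [||fam [sf sC uf dF Hd]] := greedy_nat (D := k.-tuple V) (hit := hit) n0 _ (beta_pow_pos _ _)
  Hhit Hk _ HM H1 H2.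
- by rewrite card_tuple expn_gt0 n0.
- by rewrite card_tuple.
exists [seq q <- fam | all tight (aps q)].
have sub : {subset [seq q <- fam | all tight (aps q)] <= fam}.
  by move=> q; rewrite mem_filter => /andP[].
have C0 : [::] \notin fam.
  by apply/negP => /(allP sC) /=; rewrite eq_sym /abs_size; slia.
have uff := uniq_of_flatten uf C0.
split.
- split; last by rewrite size_filter -sf count_size.
  rewrite (@size_flatten_const _ _ (abs_size * 3)).
    by rewrite leq_mul2l size_filter -sf count_size orbT.
  by apply/allP => q /sub /(allP sC).
- rewrite -(map_id [seq q <- fam | _]); apply: (uniq_flatten_map uf) => //.
    exact: filter_uniq.
  by move=> q qf; split=> //; apply: flatten_uniq_mem qf.
- apply/hasPn => v /flattenP[q /sub qf vq]; move/hasPn: dF; apply.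
  exact: mem_flatten vq.
- move=> us sus tus; have sus' : size us == k by rewrite sus.
  apply: leq_trans (Hd (Tuple sus')) _; rewrite count_filter.
  apply: sub_count => q; rewrite /hit /= tus /= => /[dup] /and3P[t1 _ /forallP t3] ->.
  rewrite /= /abs_pieces /= t1 /=; apply/allP => p /mapP[i]; rewrite mem_iota => /= ik ->.
  by have /andP[] := t3 (Ordinal ik).
- by move=> q; rewrite mem_filter => /andP[tq /(allP sC)/eqP].
Qed.

Variable ell : nat.
Hypotheses (ell0 : 0 < ell) (nell : n <= ell * b).
Local Notation L := (k.-1 * ell).
Hypothesis Lb : L <= b.
Local Notation cp := (connector_path k x0 ell).

Definition conn_size : nat := L + (L + k.-1).
Definition conn_density : R := ((beta ^+ conn_size) ^+ (k ^ conn_size))%R.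

Lemma bank_family M kap h (F : seq V) :
  (4 / conn_density <= M%:R)%R -> ((1 - conn_density / 4) ^+ kap <= 4^-1)%R ->
  n ^ k.-1 * n ^ k.-1 < 2 ^ h ->
  M * (conn_size * k * (size F + conn_size * k * (kap * h))) <= n ->
  M * (conn_size * k * (conn_size * k)) <= n ->
  exists fam : seq (seq V), [/\ size (flatten fam) = conn_size * k * (kap * h),
    uniq (flatten fam), ~~ has (mem F) (flatten fam), uniq fam /\
    (forall X Y : seq V, size X = k.-1 -> uniq X -> size Y = k.-1 -> uniq Y ->
       h <= count (fun q => tight (X ++ cp q ++ Y)) fam) &
    forall q, q \in fam -> uniq (cp q) /\ {subset cp q <= q}].
Proof.
move=> HM Hk HD H1 H2.
pose hit (XY : k.-1.-tuple V * k.-1.-tuple V) q :=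
  uniq XY.1 && uniq XY.2 ==> tight (XY.1 ++ cp q ++ XY.2).
have Hhit XY : (conn_density <= mean (conn_size * k) (fun q => (hit XY q)%:R))%R.
  rewrite /hit; have [/andP[u1 u2]|_] := boolP (_ && _).
    by apply: (mean_connector H (ltW beta0) beta_b x0 ell0 nell Lb) => //; apply: size_tuple.
  by rewrite mean_const //; apply: beta_pow_le1.
have [||fam [sf sC uf dF Hd]] := greedy_nat (hit := hit) n0 _ (beta_pow_pos _ _)
  Hhit Hk _ HM H1 H2.
- by rewrite card_prod !card_tuple muln_gt0 expn_gt0 n0.
- by rewrite card_prod !card_tuple.
have C0 : [::] \notin fam.
  have k1 : 0 < k.-1 by slia.
  have C1 : 0 < conn_size * k by rewrite muln_gt0 k0 /conn_size !addn_gt0 k1 !orbT.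
  by apply/negP => /(allP sC) /=; rewrite eq_sym (gtn_eqF C1).
exists fam; split=> //.
- by rewrite (size_flatten_const sC) sf.
- split; first exact: uniq_of_flatten.
  move=> X Y sX uX sY uY.
  have [sX' sY'] : size X == k.-1 /\ size Y == k.-1 by rewrite sX sY.
  by have := Hd (Tuple sX', Tuple sY'); rewrite /hit /= uX uY.
- move=> q qf; have sq : size q = conn_size * k by apply/eqP/(allP sC).
  split; first by apply: (connector_path_uniq H) => //; apply: flatten_uniq_mem qf.
  exact: (connector_path_sub H).
Qed.

End Families.

Lemma flatten_flatten (T : Type) (s : seq (seq (seq T))) :
  flatten (flatten s) = flatten (map flatten s).
Proof. by elim: s => //= x s IH; rewrite flatten_cat IH. Qed.

Section Assembly.
Variables (R : realType) (V : finType) (lab : V -> nat) (k b : nat) (E : {set {set V}}).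
Hypothesis H : dirac lab k b E.
Let k2 : 2 < k. Proof. exact: dirac_k H. Qed.
Let k0 : 0 < k. Proof. by move: k2; lia. Qed.
Let n0 : 0 < #|V|. Proof. exact: dirac_card_gt0 H. Qed.
Local Notation n := #|V|.
Local Notation top := (is_top lab k).
Local Notation tight := (tight k E).
Variables (beta : R).
Hypotheses (beta0 : (0 < beta)%R) (beta1 : (beta <= 1)%R) (beta_b : (beta * n%:R <= b%:R)%R).
Variables (x0 : V) (ell : nat).
Hypotheses (ell0 : 0 < ell) (nell : n <= ell * b).
Hypothesis Lb : k.-1 * ell <= b.
Local Notation sp := (swap_piece k x0).
Local Notation aps := (abs_pieces k x0).
Local Notation cp := (connector_path k x0 ell).
Local Notation dS := (swap_density k beta).
Local Notation dA := (abs_density k beta).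
Local Notation dC := (conn_density k beta ell).
Local Notation aS := (k * 2).
Local Notation aA := (abs_size k * 3).
Local Notation aC := (conn_size k ell * k).
Variables (MS kS MA kA MC kC g : nat).
Hypotheses (HMS : (4 / dS <= MS%:R)%R) (HMA : (4 / dA <= MA%:R)%R) (HMC : (4 / dC <= MC%:R)%R).
Hypotheses (HkS : ((1 - dS / 4) ^+ kS <= 4^-1)%R) (HkA : ((1 - dA / 4) ^+ kA <= 4^-1)%R)
  (HkC : ((1 - dC / 4) ^+ kC <= 4^-1)%R).

Definition absorbing (famS famA bl : seq (seq V)) : Prop :=
  [/\ [/\ uniq famS, {in famS &, injective sp}, forall q, q \in famS -> sp q \in bl,
          forall q, q \in famS -> sp q \notin flatten (map aps famA) &
          forall u, g <= count (swapper lab k b E x0 u) famS],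
      [/\ uniq famA, forall q, q \in famA -> uniq (aps q),
          forall q q' p, q \in famA -> q' \in famA -> p \in aps q -> p \in aps q' -> q = q',
          forall q, q \in famA -> {subset aps q <= bl} &
          forall us : seq V, size us = k -> all top us -> g <= count (absorber k E x0 us) famA] &
      linkable k E (flatten bl)].

(** [h] bounds the number of pieces, one per swapper and [k.+1] per absorber, and thus the joins;
    [total] bounds the vertices of the three families, each selected to avoid the earlier ones. *)
Lemma absorbing_path : 0 < g -> n ^ k < 2 ^ g ->
  let h := kS * g + k.+1 * (kA * g) in
  let total := aS * (kS * g) + aA * (kA * g) + aC * (kC * h) in
  n ^ k.-1 * n ^ k.-1 < 2 ^ h ->
  MS * (aS * total) <= n -> MA * (aA * total) <= n -> MC * (aC * total) <= n ->
  MS * (aS * aS) <= n -> MA * (aA * aA) <= n -> MC * (aC * aC) <= n ->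
  exists famS famA bl, absorbing famS famA bl /\ size (flatten bl) <= total.
Proof.
move=> g0 Hg h total Hh H1 H2 H3 H4 H5 H6.
have mono M a x y : x <= y -> M * (a * y) <= n -> M * (a * x) <= n.
  by move=> xy; apply: leq_trans; rewrite !leq_mul2l xy !orbT.
have Hg1 : n < 2 ^ g.
  by apply: leq_ltn_trans Hg; rewrite -{1}(expn1 n) leq_pexp2l.
have [famS [[sS cS] uS _ hS tS]] := swap_family H beta0 beta_b x0 (F := [::]) HMS HkS Hg1
  ltac:(apply: mono H1; rewrite /total /=; slia) H4.
have [famA [[sA cA] uA dA hA tA]] := abs_family H beta0 beta1 beta_b x0 (F := flatten famS) HMA HkA Hg
  ltac:(apply: mono H2; move: sS; rewrite /total /=; clear; lia) H5.
pose F := flatten famS ++ flatten famA.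
have [bank [sB uB dB [ub hB] cB]] := bank_family H beta0 beta1 beta_b x0 ell0 nell Lb (F := F) HMC HkC Hh
  ltac:(apply: mono H3; move: sS sA; rewrite /F size_cat /total -/h /=; clear; lia) H6.
have spok q : q \in famS -> uniq (sp q) /\ {subset sp q <= q}.
  by move=> qf; have [sq _] := tS q qf; apply: swap_piece_ok => //; apply: flatten_uniq_mem qf.
have apok q : q \in famA -> uniq (flatten (aps q)) /\ {subset flatten (aps q) <= q}.
  by move=> qf; have [sq _] := tA q qf; apply: abs_pieces_ok => //; apply: flatten_uniq_mem qf.
have spw q : swapW k x0 q \in sp q by rewrite mem_cat mem_head orbT.
have size_sp q : k.-1 <= size (sp q) by rewrite size_cat size_mkseq leq_addr.
have size_ap q p : p \in aps q -> k.-1 <= size p.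
  rewrite inE => /predU1P[->|/mapP[i _ ->]]; rewrite size_cat size_mkseq.
    by apply: leq_trans (leq_pred k) (leq_addr _ _).
  exact: leq_addr.
have ne (p : seq V) : k.-1 <= size p -> exists v, v \in p.
  by case: p => [|v p _]; [move=> /=; slia | exists v; rewrite mem_head].
have uniqS : uniq famS.
  apply: uniq_of_flatten => //; apply/negP => /tS[/= e _].
  by move: e k0; clear; lia.
have uniqA : uniq famA.
  apply: uniq_of_flatten => //; apply/negP => /tA[/= e _].
  by move: e k0; rewrite /abs_size; clear; lia.
have injS : {in famS &, injective sp}.
  move=> q q' qf qf' e; have [_ s1] := spok q qf; have [_ s2] := spok q' qf'.
  by apply: (flatten_disjoint uS qf qf' (s1 _ (spw q))); apply: s2; rewrite -e.
have SA q q' v : q \in famS -> q' \in famA -> v \in q -> v \in q' -> False.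
  move=> qf qf' vq vq'; move/hasPn: dA => /(_ v (mem_flatten qf' vq')) /=.
  by rewrite (mem_flatten qf vq).
have notA q : q \in famS -> sp q \notin flatten (map aps famA).
  move=> qf; apply/negP => /flattenP[s /mapP[q' qf' ->]] spq.
  apply: (SA q q' (swapW k x0 q)) => //; first by have [_] := spok q qf; apply.
  by have [_] := apok q' qf'; apply; apply: mem_flatten spq _.
have injA q q' p : q \in famA -> q' \in famA -> p \in aps q -> p \in aps q' -> q = q'.
  move=> qf qf' pq pq'; have [v vp] := ne p (size_ap _ _ pq).
  apply: (flatten_disjoint uA qf qf' (v := v)).
    by have [_] := apok q qf; apply; apply: mem_flatten pq vp.
  by have [_] := apok q' qf'; apply; apply: mem_flatten pq' vp.
have uaps q : q \in famA -> uniq (aps q).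
  move=> qf; have [u _] := apok q qf; apply: uniq_of_flatten => //.
  by apply/negP => /size_ap /ne[v].
pose pcs := map sp famS ++ flatten (map aps famA).
have fpcs : flatten pcs = flatten (map sp famS) ++ flatten (map (fun q => flatten (aps q)) famA).
  by rewrite flatten_cat flatten_flatten -map_comp.
have subF : {subset flatten pcs <= F}.
  move=> v; rewrite fpcs !mem_cat => /orP[] hv; apply/orP; [left|right].
    by apply: sub_flatten_map hv => // q /spok[].
  by apply: (sub_flatten_map (fam := famA)) hv => // q /apok[].
have upcs : uniq (flatten pcs).
  rewrite fpcs cat_uniq (uniq_flatten_map uS) //=.
  rewrite (uniq_flatten_map uA) // andbT; apply/hasPn => v hv; apply/negP => /= hv'.
  have /flattenP[q' qf' vq'] := sub_flatten_map (fam := famA) (qs := famA) (fun _ h => h)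
    (fun q qf => (apok q qf).2) hv.
  have /flattenP[q qf vq] := sub_flatten_map (fam := famS) (qs := famS) (fun _ h => h)
    (fun q qf => (spok q qf).2) hv'.
  exact: SA vq vq'.
have lpcs : all (linkable k E) pcs.
  apply/allP => p pp; rewrite /linkable (flatten_uniq_mem upcs pp) /=.
  move: pp; rewrite mem_cat => /orP[/mapP[q qf ->]|/flattenP[s /mapP[q qf ->] pq]].
    by have [_ ->] := tS q qf; rewrite size_sp.
  by have [_ /allP/(_ p pq)->] := tA q qf; rewrite (size_ap _ _ pq).
have szpcs : size pcs <= h.
  rewrite size_cat size_map /h; apply: leq_add => //.
  rewrite (@size_flatten_const _ _ k.+1) ?size_map ?leq_mul2l ?cA ?orbT //.
  by apply/allP => s /mapP[q _ ->]; rewrite /= size_map size_iota.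
have pcs0 : pcs != [::].
  have : 0 < size famS by apply: leq_trans (count_size _ _); apply: leq_trans (hS x0).
  by rewrite /pcs; case: (famS).
case epcs : pcs pcs0 => [//|p1 rest] _.
move: lpcs szpcs; rewrite epcs /= => /andP[lp1 lrest] szr.
have [|qs [sqs uqs subq tq]] := connect_pieces k2 ub hB lp1 lrest (us := [::]) isT.
  by rewrite add0n ltnW.
pose bl := p1 :: weave cp qs rest.
have permbl : perm_eq (flatten bl) (flatten pcs ++ flatten (map cp qs)).
  by rewrite epcs /bl /= -catA perm_cat2l; exact: perm_weave.
have inbl p : p \in pcs -> p \in bl.
  rewrite epcs inE /bl => /predU1P[->|pr]; first by rewrite mem_head.
  by rewrite inE mem_weave ?orbT.
have ucp : uniq (flatten (map cp qs)) by apply: (uniq_flatten_map uB) => //.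
have subcp : {subset flatten (map cp qs) <= flatten bank}.
  by apply: sub_flatten_map => // q /cB[].
exists famS, famA, bl; split.
  split.
  - by split=> // q qf; apply: inbl; rewrite mem_cat map_f.
  - split=> // q qf p pq; apply: inbl; rewrite mem_cat; apply/orP; right.
    by apply/flattenP; exists (aps q) => //; apply: map_f.
  rewrite /linkable tq (perm_uniq permbl) cat_uniq upcs ucp andbT /=.
  apply/andP; split; last first.
    by rewrite size_cat; apply: leq_trans (leq_addr _ _); case/and3P: lp1.
  apply/hasPn => v /subcp vb; apply/negP => /= /subF vF.
  by move/hasPn: dB => /(_ v vb) /=; rewrite vF.
rewrite (perm_size permbl) size_cat /total; apply: leq_add.
  apply: leq_trans (uniq_leq_size upcs subF) _; rewrite size_cat; exact: leq_add.
by rewrite -sB; apply: uniq_leq_size.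
Qed.

End Assembly.

(** * The cycle *)

Section Closing.
Variables (R : realType) (V : finType) (lab : V -> nat) (k b : nat) (E : {set {set V}}).
Hypothesis H : dirac lab k b E.
Let k2 : 2 < k. Proof. exact: dirac_k H. Qed.
Let k0 : 0 < k. Proof. by move: k2; lia. Qed.
Let bn : 4 * b <= #|V|. Proof. exact: dirac_bn H. Qed.
Let n0 : 0 < #|V|. Proof. exact: dirac_card_gt0 H. Qed.
Local Notation n := #|V|.
Local Notation tight := (tight k E).
Variables (beta : R).
Hypotheses (beta0 : (0 < beta)%R) (beta1 : (beta <= 1)%R) (beta_b : (beta * n%:R <= b%:R)%R).
Variables (x0 : V) (ell : nat).
Hypotheses (ell0 : 0 < ell) (nell : n <= ell * b).
Hypothesis Lb : k.-1 * ell <= b.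
Local Notation cp := (connector_path k x0 ell).
Local Notation dC := (conn_density k beta ell).
Local Notation aC := (conn_size k ell * k).
Variables (MC kC : nat).
Hypotheses (HMC : (4 / dC <= MC%:R)%R).
Hypotheses (HkC : ((1 - dC / 4) ^+ kC <= 4^-1)%R).

Lemma closing_cycle h t Ne TP (bl : seq (seq V)) :
  linkable k E (flatten bl) -> size (flatten bl) <= TP ->
  n ^ k.-1 * n ^ k.-1 < 2 ^ h ->
  let B2 := aC * (kC * h) in
  MC * (aC * (TP + B2)) <= n -> MC * (aC * aC) <= n -> TP + B2 <= b -> 1 < t -> 1 < Ne ->
  (forall j, k * t * j <= n -> j.+1 <= h) ->
  (forall W : {set V}, #|~: W| <= b -> exists ts : seq (seq V),
     [/\ all (fun q => (size q == k * t) && tight q) ts, uniq (flatten ts),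
         all (mem W) (flatten ts) & Ne * #|W| <= n + Ne * (k * t * size ts)]) ->
  exists (bl' : seq (seq V)) (U : seq V), [/\ {subset bl <= bl'}, cyc_tight k E (flatten bl') /\ k <= size (flatten bl'),
    perm_eq (flatten bl' ++ U) (enum V), k %| size U &
    Ne * size U <= n + Ne * (B2 + k)].
Proof.
move=> lPA sPA Hh B2 H1 H2 Hb t1 Ne1 Hj Htile.
set PA := flatten bl in lPA sPA *.
have [bank [sB uB dB [ub hB] cB]] := bank_family H beta0 beta1 beta_b x0 ell0 nell Lb (F := PA) HMC HkC Hh
  ltac:(apply: leq_trans H1; rewrite !leq_mul2l leq_add2r sPA !orbT; exact: isT) H2.
pose W := ~: [set v in PA ++ flatten bank].
have /and3P[tPA uPA szPA] := lPA.
have uPB : uniq (PA ++ flatten bank) by rewrite cat_uniq uPA uB dB.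
have cW : #|W| + (size PA + size (flatten bank)) = n.
  rewrite addnC -size_cat -(cardsC [set v in PA ++ flatten bank]); congr (_ + _).
  by rewrite cardsE; apply/esym/card_uniqP.
have [|ts [/allP hts uts /allP tsW szW]] := Htile W.
  by rewrite setCK cardsE; apply: leq_trans (card_size _) _; rewrite size_cat sB; apply: leq_trans Hb; rewrite leq_add2r.
(* The trimming needs a tile. Without tiles [#|W|] would be at most [n / 2], but it is at least
   [n - b], where [4 * b <= n]. *)
have ts0 : ts != [::].
  apply/eqP => e; move: szW; rewrite e muln0 muln0 addn0.
  have : n <= #|W| + b by rewrite -cW leq_add2l; apply: leq_trans Hb; rewrite sB leq_add2r.
  by move: bn Ne1 n0; clear; nia.
case ets : ts ts0 => [//|t1' ts'] _.
pose K := k * t; pose Cc := size (connector_pos k ell).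
pose j := size ts.
have szcp q : size (cp q) = Cc by rewrite size_map.
have szts : size (flatten ts) = K * j.
  by apply: size_flatten_const; apply/allP => q /hts /andP[].
have Kj : K * j <= n.
  rewrite -szts -(card_uniqP uts); exact: max_card.
pose N0 := size PA + K * j + Cc * j.+1.
(* [N0] is the length of the cycle without trimming. Since [n * k.-1] is [- n] modulo [k], removing
   [r] vertices makes the number of uncovered vertices, [n - N0 + r], divisible by [k]. *)
pose r := (N0 + n * k.-1) %% k.
have rk : r < k by rewrite ltn_mod.
have [t1h u1] : t1' \in ts /\ uniq t1'.
  by rewrite ets mem_head; split=> //; apply: flatten_uniq_mem uts _; rewrite ets mem_head.
have /andP[/eqP s1 tt1] := hts _ t1h.
have Kk : k + k <= K by rewrite /K addnn -muln2 leq_mul2l t1 orbT.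
pose ps := drop r t1' :: ts'.
(* Appended as a last piece, the start of the absorbing path makes the final connector close the
   cycle. It is left out of [bl'], because the cyclic reading repeats it. *)
pose X := take k.-1 PA.
have sX : size X = k.-1 by rewrite size_takel.
have fps : flatten ts = take r t1' ++ flatten ps by rewrite ets /= catA cat_take_drop.
have ups : uniq (flatten ps) by move: uts; rewrite fps cat_uniq => /and3P[].
have psW v : v \in flatten ps -> v \in W.
  by move=> vp; apply: tsW; rewrite fps mem_cat vp orbT.
have szps : size (flatten ps) + r = K * j.
  by rewrite -szts fps size_cat size_takel ?s1 -/K; [rewrite addnC|move: rk Kk; clear; lia].
have lps : all (linkable k E) (rcons ps X).
  rewrite all_rcons; apply/andP; split.
    rewrite /linkable sX leqnn take_uniq // andbT.
    have tX : tight (X ++ drop k.-1 PA) by rewrite cat_take_drop.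
    by rewrite (tight_prefix k0 tX).
  apply/allP => p pp; rewrite /linkable (flatten_uniq_mem ups pp) /=.
  move: pp; rewrite inE => /predU1P[->|pts].
    rewrite size_drop s1 -/K; rewrite (_ : k.-1 <= _); last by move: rk Kk; clear; lia.
    have tD : tight (take r t1' ++ drop r t1') by rewrite cat_take_drop.
    by rewrite (tight_suffix tD).
  have /andP[/eqP-> ->] : (size p == K) && tight p by apply: hts; rewrite ets inE pts orbT.
  by move: Kk k0; clear; lia.
have szps2 : size ps = j by rewrite /j ets.
have [|qs0 [sqs0 uqs0 subq0 tq0]] := connect_pieces k2 ub hB lPA lps (us := [::]) isT.
  by rewrite add0n size_rcons szps2; apply: Hj.
case: (lastP qs0) sqs0 uqs0 subq0 tq0 => [|qs q]; first by rewrite size_rcons.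
rewrite !size_rcons => -[sqs] uqs0 subq0; rewrite weave_rcons // => tq0.
pose bl' := bl ++ weave cp qs ps ++ [:: cp q].
pose c := flatten bl'.
have cE : c = PA ++ flatten (weave cp qs ps) ++ cp q by rewrite /c /bl' !flatten_cat /= cats0.
have pc : perm_eq c (PA ++ flatten ps ++ flatten (map cp (rcons qs q))).
  rewrite cE perm_cat2l map_rcons -cats1 flatten_cat /= cats0 catA perm_cat2r.
  exact: perm_weave.
have subcp : {subset flatten (map cp (rcons qs q)) <= flatten bank}.
  by apply: sub_flatten_map => // x /cB[].
have ucp : uniq (flatten (map cp (rcons qs q))) by apply: (uniq_flatten_map uB).
have inW v : v \in W -> (v \in PA = false) /\ (v \in flatten bank = false).
  by rewrite !inE mem_cat negb_or => /andP[/negPf-> /negPf->].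
have uc : uniq c.
  rewrite (perm_uniq pc) cat_uniq uPA (cat_uniq (flatten ps)) ups ucp /= andbT; apply/andP; split.
    apply/hasPn => v; rewrite mem_cat => /orP[/psW/inW[-> //]|/subcp vb].
    by move/hasPn: dB => /(_ v vb).
  by apply/hasPn => v /subcp vb; apply/negP => /= /psW/inW[_]; rewrite vb.
have szc : size c + r = N0.
  rewrite (perm_size pc) size_cat (size_cat (flatten ps)) (@size_flatten_const _ (map cp (rcons qs q)) Cc); last first.
    by apply/allP => x /mapP[y _ ->]; rewrite szcp.
  by rewrite size_map size_rcons (etrans sqs szps2) /N0; rewrite -szps -!addnA; congr (_ + (_ + _)); rewrite addnC.
have XE : take k.-1 c = X by rewrite cE takel_cat.
pose U := [seq v <- enum V | v \notin c].
have pU : perm_eq (c ++ U) (enum V).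
  apply: uniq_perm; rewrite ?enum_uniq //.
    rewrite cat_uniq uc filter_uniq ?enum_uniq ?andbT //=.
    by apply/hasPn => v; rewrite mem_filter => /andP[].
  by move=> v; rewrite mem_cat mem_filter mem_enum andbT orbN.
have szU : size c + size U = n by rewrite -size_cat (perm_size pU) -cardE.
exists bl', U; split=> //.
- by move=> p pb; rewrite mem_cat pb.
- split.
    rewrite /cyc_tight -/c XE cE -!catA; move: tq0.
    by rewrite /= flatten_cat /= cats0.
  rewrite -/c (perm_size pc) size_cat (size_cat (flatten ps)); apply: leq_trans (_ : size PA + size (flatten ps) <= _); last by rewrite leq_add2l leq_addr.
  have : K <= K * j by rewrite /j ets /= leq_pmulr.
  by move: szps rk Kk; clear; lia.
- have e : size U + (N0 + n * k.-1) %/ k * k = n * k.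
    have := divn_eq (N0 + n * k.-1) k; rewrite -/r.
    have -> : n * k = n + n * k.-1 by rewrite -mulnS prednK.
    by move: szU szc; clear; lia.
  by rewrite -(@dvdn_addl ((N0 + n * k.-1) %/ k * k)) ?dvdn_mull // e dvdn_mull.
- have e : size U + K * j <= #|W| + (B2 + k).
    by move: szU szc cW rk; rewrite sB -/B2 /N0; clear; lia.
  have := leq_mul (leqnn Ne) e; rewrite !mulnDr => e2.
  rewrite -(leq_add2r (Ne * (K * j))); apply: leq_trans e2 _.
  by rewrite addnAC leq_add2r.
Qed.

End Closing.

(** * Choice of the constants *)

Lemma exists_decay (R : realType) (c : R) : (0 < c)%R -> (c <= 1)%R ->
  exists2 kap, 0 < kap & ((1 - c / 4) ^+ kap <= 4^-1)%R.
Proof.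
move=> c0 c1; set x := (c / 4)%R; have x0 : (0 < x)%R by rewrite divr_gt0.
have x1 : (x <= 1)%R by rewrite /x; lra.
exists (Num.truncn (3 / x)%R).+1 => //; set m := Num.truncn _.
have hm : (3 <= m.+1%:R * x)%R.
  by rewrite -ler_pdivrMr //; apply: ltW; exact: truncnS_gt.
(* Bernoulli's inequality gives [(1 + x) ^ m.+1 >= 4], and [(1 - x) * (1 + x) <= 1]. *)
have := @tangent R m (1 + x) 1; rewrite !expr1n mulr1 => /(_ ltac:(lra) ltac:(lra)) h.
have h4 : (4 <= (1 + x) ^+ m.+1)%R by apply: le_trans h; move: hm; lra.
rewrite -[leRHS]mul1r ler_pdivlMr //.
apply: le_trans (_ : (1 - x) ^+ m.+1 * (1 + x) ^+ m.+1 <= _)%R.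
  by apply: ler_wpM2l => //; apply: exprn_ge0; lra.
rewrite -exprMn; apply: exprn_ile1; first by apply: mulr_ge0; lra.
by have := sqr_ge0 x; rewrite expr2; lra.
Qed.

Lemma poly_lt_exp a N : 0 < N -> exists n0, forall n, n0 <= n -> n ^ a < 2 ^ (n %/ N).
Proof.
move=> N0; pose M := N * (2 * a.+1).
have M0 : 0 < M by rewrite /M !muln_gt0 N0.
exists (M * M).+1 => n Hn; pose m := n %/ M.
have n0 : 0 < n by apply: leq_trans Hn.
have mM : M <= m by rewrite leq_divRL // ltnW.
have nM : n < M * m.+1 by rewrite mulnC; exact: ltn_ceil.
apply: (@leq_ltn_trans (n ^ a.+1)); first by rewrite leq_pexp2l.
apply: (@leq_trans ((M * m.+1) ^ a.+1)); first by rewrite ltn_exp2r.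
apply: (@leq_trans ((2 ^ m * 2 ^ m) ^ a.+1)).
  rewrite leq_exp2r //; apply: leq_mul; last exact: ltn_expl.
  by apply: leq_trans mM _; apply: ltnW; exact: ltn_expl.
rewrite -expnD -expnM leq_pexp2l // leq_divRL // addnn -mul2n.
apply: leq_trans (leq_trunc_div n M); rewrite -/m /M.
by rewrite -!mulnA !(mulnC m) !mulnA leq_eqVlt; apply/orP; left; apply/eqP; lia.
Qed.

Lemma dirac_hamiltonian (R : realType) k q0 : 2 < k -> 4 <= q0 ->
  exists N0, forall (V : finType) (lab : V -> nat) (E : {set {set V}}),
    N0 <= #|V| -> dirac lab k (#|V| %/ q0) E ->
  exists c : seq V, [/\ uniq c, forall v, v \in c, k <= size c & cyc_tight k E c].
Proof.
move=> k2 q04; have k0 : 0 < k by lia.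
have q0R : (0 < q0%:R :> R)%R by rewrite ltr0n; lia.
pose beta : R := ((2 * q0%:R)^-1)%R.
have beta0 : (0 < beta)%R by rewrite invr_gt0 mulr_gt0.
have beta1 : (beta <= 1)%R.
  rewrite invf_le1 ?mulr_gt0 //; apply: le_trans (_ : 2 * 1 <= _)%R; first by lra.
  by apply: ler_wpM2l => //; rewrite ler1n; lia.
pose ell := 2 * q0; have ell0 : 0 < ell by rewrite /ell; lia.
pose dS := swap_density k beta; pose dA := abs_density k beta.
pose dC := conn_density k beta ell.
have [kS kS0 HkS] := @exists_decay R dS (beta_pow_pos beta0 _ _) (beta_pow_le1 beta0 beta1 _ _).
have [kA kA0 HkA] := @exists_decay R dA (beta_pow_pos beta0 _ _) (beta_pow_le1 beta0 beta1 _ _).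
have [kC kC0 HkC] := @exists_decay R dC (beta_pow_pos beta0 _ _) (beta_pow_le1 beta0 beta1 _ _).
pose MS := (Num.truncn (4 / dS)%R).+1; have HMS : (4 / dS <= MS%:R)%R by apply: ltW; exact: truncnS_gt.
pose MA := (Num.truncn (4 / dA)%R).+1; have HMA : (4 / dA <= MA%:R)%R by apply: ltW; exact: truncnS_gt.
pose MC := (Num.truncn (4 / dC)%R).+1; have HMC : (4 / dC <= MC%:R)%R by apply: ltW; exact: truncnS_gt.
clearbody MS MA MC.
pose aS := k * 2; pose aA := abs_size k * 3; pose aC := conn_size k ell * k.
have aC0 : 0 < aC by rewrite muln_gt0 k0 andbT /conn_size !addn_gt0; move: k2; clear; lia.
pose T := aS * kS + aA * kA + aC * (kC * (kS + k.+1 * kA)).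
pose N := (MS * aS + MA * aA + MC * aC + q0) * T.+1.
have N0 : 0 < N by rewrite muln_gt0 addn_gt0 (_ : 0 < q0) ?orbT //; move: q04; clear; lia.
pose Ne := 8 * N * ell; pose N2 := Ne * (aC * kC); pose t := 4 * N2.
have Ne0 : 0 < Ne by rewrite /Ne muln_gt0 ell0 andbT muln_gt0 N0.
have N20 : 0 < N2 by rewrite /N2 muln_gt0 Ne0 muln_gt0 aC0 kC0.
have t0 : 0 < t by rewrite muln_gt0 N20.
have NeR : (0 < Ne%:R :> R)%R by rewrite ltr0n.
have [nT HT] := @tiling R k t beta (Ne%:R^-1)%R k2 t0 beta0 ltac:(by rewrite invr_gt0).
have [nP HP] := @poly_lt_exp (k.-1 + k.-1) N2 N20.
pose X1 := k.-1 * ell * q0; pose X2 := Ne * k.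
pose X3 := MS * (aS * aS); pose X4 := MA * (aA * aA); pose X5 := MC * (aC * aC).
exists (nT + nP + (X1 + q0 + N2 + N + X2) + (X3 + X4 + X5)) => V lab E.
set n := #|V|; set b := n %/ q0 => Hn HD.
have hT : nT <= n by apply: leq_trans Hn; clearbody X1 X2 X3 X4 X5 N2 N; clear; lia.
have hP : nP <= n by apply: leq_trans Hn; clearbody X1 X2 X3 X4 X5 N2 N; clear; lia.
have hL : X1 <= n by apply: leq_trans Hn; clearbody X1 X2 X3 X4 X5 N2 N; clear; lia.
have hq : q0 <= n by apply: leq_trans Hn; clearbody X1 X2 X3 X4 X5 N2 N; clear; lia.
have hN2 : N2 <= n by apply: leq_trans Hn; clearbody X1 X2 X3 X4 X5 N2 N; clear; lia.
have hN : N <= n by apply: leq_trans Hn; clearbody X1 X2 X3 X4 X5 N2 N; clear; lia.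
have hNe : X2 <= n by apply: leq_trans Hn; clearbody X1 X2 X3 X4 X5 N2 N; clear; lia.
have hS : X3 <= n by apply: leq_trans Hn; clearbody X1 X2 X3 X4 X5 N2 N; clear; lia.
have hA : X4 <= n by apply: leq_trans Hn; clearbody X1 X2 X3 X4 X5 N2 N; clear; lia.
have hC : X5 <= n by apply: leq_trans Hn; clearbody X1 X2 X3 X4 X5 N2 N; clear; lia.
have q0p : 0 < q0 by move: q04; clear; lia.
have n0 : 0 < n by exact: dirac_card_gt0 HD.
have b0 : 0 < b by rewrite divn_gt0.
have nell : n <= ell * b.
  apply: leq_trans (ltnW (ltn_ceil n q0p)) _; rewrite -/b /ell mulnC -mulnA mulnCA leq_mul2l.
  by apply/orP; right; move: b0; clear; lia.
have Lb : k.-1 * ell <= b by rewrite leq_divRL.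
have beta_b : (beta * n%:R <= b%:R)%R.
  by rewrite mulrC ler_pdivrMr ?mulr_gt0 // -!natrM ler_nat; move: nell; rewrite /ell mulnC.
have [x0 _] : exists x0, x0 \in V by apply/card_gt0P.
pose g := n %/ N; pose h2 := n %/ N2.
have g0 : 0 < g by rewrite divn_gt0.
have gN : N * g <= n by rewrite mulnC leq_trunc_div.
have h2N : N2 * h2 <= n by rewrite mulnC leq_trunc_div.
pose B2 := aC * (kC * h2).
have B2N : Ne * B2 <= n by rewrite /B2 mulnA mulnA -/aC -(mulnA Ne) -/N2.
have NNe : N <= Ne by rewrite /Ne -mulnA mulnCA leq_pmulr // muln_gt0.
have B2g : B2 <= g by rewrite leq_divRL // mulnC; apply: leq_trans B2N; rewrite leq_mul2r NNe orbT.
have h2g : h2 <= g.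
  by apply: leq_div2l => //; apply: leq_trans NNe _; rewrite leq_pmulr // muln_gt0 aC0.
have sub M a x : M * a * T.+1 <= N -> x <= T.+1 * g -> M * (a * x) <= n.
  move=> h1 h2'; apply: leq_trans gN; rewrite mulnA; apply: leq_trans (leq_mul (leqnn (M * a)) h2') _.
  by rewrite mulnA leq_mul2r h1 orbT.
have sS : MS * aS * T.+1 <= N by rewrite leq_mul2r; apply/orP; right; clear; lia.
have sA : MA * aA * T.+1 <= N by rewrite leq_mul2r; apply/orP; right; clear; lia.
have sC : MC * aC * T.+1 <= N by rewrite leq_mul2r; apply/orP; right; clear; lia.
have Hpoly2 : n ^ k.-1 * n ^ k.-1 < 2 ^ h2 by rewrite -expnD; apply: HP.
have Hpoly x : h2 <= x -> n ^ k.-1 * n ^ k.-1 < 2 ^ x.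
  by move=> hx; apply: leq_trans Hpoly2 _; rewrite leq_pexp2l.
have Hk : n ^ k < 2 ^ g.
  apply: leq_ltn_trans (Hpoly g h2g); rewrite -expnD leq_pexp2l //.
  by move: k2; clear; lia.
pose h := kS * g + k.+1 * (kA * g).
have gh : g <= h by rewrite /h; apply: leq_trans (leq_addr _ _); rewrite leq_pmull.
pose total := aS * (kS * g) + aA * (kA * g) + aC * (kC * h).
have totE : total = T * g by rewrite /total /T /h; clear; nia.
have totT : total <= T.+1 * g by rewrite totE leq_mul2r leqnSn orbT.
have [famS [famA [bl [Habs Hbl]]]] := absorbing_path HD beta0 beta1 beta_b x0 ell0 nell Lb
  HMS HMA HMC HkS HkA HkC g0 Hk (Hpoly h (leq_trans h2g gh))
  (sub _ _ _ sS totT) (sub _ _ _ sA totT) (sub _ _ _ sC totT) hS hA hC.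
have [[uS injS inS notA cS] [uA uaA injA inA cA] lbl] := Habs.
have totB : total + B2 <= T.+1 * g by rewrite totE mulSn addnC leq_add2r.
have tB : total + B2 <= b.
  rewrite leq_divRL //; apply: leq_trans gN; apply: leq_trans (leq_mul totB (leqnn q0)) _.
  rewrite mulnC mulnA leq_mul2r; apply/orP; right.
  by rewrite leq_mul2r; apply/orP; right; clear; lia.
have [||||bl1 [U [sub1 [tc1 sz1] pm1 dv1 szU]]] := closing_cycle (h := h2) (t := t) (Ne := Ne) HD beta0 beta1 beta_b x0 ell0
  nell Lb HMC HkC lbl Hbl Hpoly2 (sub _ _ _ sC totB) hC tB.
- by rewrite /t; move: N20; clear; lia.
- have p : 0 < N * ell by rewrite muln_gt0 N0.
  by rewrite /Ne -mulnA; move: (N * ell) p => x; clear; lia.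
- move=> j Hj; rewrite leq_divRL //.
  case: j Hj => [|j] Hj; first by rewrite mul1n.
  apply: leq_trans Hj; rewrite /t; move: k2; clear; nia.
- move=> W HW; have [ts [h1 hu h3 h4]] := HT V lab b E HD beta_b hT W HW.
  exists ts; split=> //.
  rewrite -(ler_nat R) natrD !natrM -/n.
  have : (Ne%:R * (#|W|%:R - (k * t * size ts)%:R) <= n%:R :> R)%R.
    apply: le_trans (ler_wpM2l (ltW NeR) h4) _.
    by rewrite mulrA divff ?mul1r // gt_eqF.
  by rewrite !natrM; lra.
have sUg : ell * size U <= g.
  rewrite leq_divRL //.
  have e : Ne * size U = 8 * (ell * size U * N).
    have aux x y z : 8 * x * y * z = 8 * (y * z * x).
      by rewrite -!mulnA; congr (8 * _); rewrite mulnC -mulnA.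
    exact: aux.
  move: szU B2N hNe; rewrite mulnDr e /X2; move: (_ * _ * N) (Ne * _) (Ne * _) => x y z.
  by clear; lia.
have HcS u : \sum_(v <- U) cost lab k (n %/ q0) ell v <= count (swapper lab k b E x0 u) famS.
  apply: leq_trans (cS u); apply: leq_trans sUg.
  elim: (U) => [|v s IH]; first by rewrite big_nil.
  by rewrite big_cons /= mulnS; apply: leq_add IH; apply: cost_le.
have [||bl2 [U2 [tc2 pm2 keep2 tU2 sz2]]] := swap_phase HD nell (leqnn _) uS injS
   (keep := flatten (map (abs_pieces k x0) famA)) (bl := bl1) _ notA _ tc1 HcS.
- by move=> q qf; apply: sub1; apply: inS.
- by move=> p /flattenP[s /mapP[q qf ->]] pq; apply: sub1; apply: inA pq.
have [j sj] : exists j, size U2 = k * j by exists (size U2 %/ k); rewrite mulnC divnK // sz2.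
have jg : j <= g.
  apply: leq_trans sUg; rewrite -sz2 sj; by rewrite mulnA leq_pmull // muln_gt0 ell0 k0.
have [||bl3 tc3 pm3] := absorb_phase HD sj tU2 uA uaA injA (bl := bl2) _ tc2.
- move=> q qf p pq; apply: keep2; apply/flattenP; exists (abs_pieces k x0 q) => //.
  exact: map_f.
- by move=> us sus tus; apply: leq_trans jg _; apply: cA.
have pm : perm_eq (flatten bl3) (enum V).
  by apply: perm_trans pm3 _; apply: perm_trans pm2 _.
exists (flatten bl3); split=> //.
- by rewrite (perm_uniq pm) enum_uniq.
- by move=> v; rewrite (perm_mem pm) mem_enum.
- rewrite (perm_size pm) -cardE; apply: leq_trans (dirac_kb HD) _; exact: leq_div.
Qed.

Local Open Scope ring_scope.

Lemma degree_le_nbr k n (G : kgraph k 'I_n) (s : seq 'I_n) :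
  (0 < k)%N -> size s = k.-1 -> uniq s ->
  (degree G [set v in s] <= #|nbr (edges G) s|)%N.
Proof.
move=> k0 ss us; rewrite /degree.
apply: leq_trans (leq_imset_card (fun v => v |: [set v in s]) (mem (nbr (edges G) s))).
apply: subset_leq_card; apply/subsetP => e; rewrite inE => /andP[eG se].
have ce := edges_uniform eG.
have cs : #|[set v in s]| = k.-1 by rewrite cardsE (card_uniqP us).
have : (0 < #|e :\: [set v in s]|)%N.
  by rewrite cardsD (setIidPr se) ce cs; case: (k) k0 => //= k' _; rewrite subSn ?subnn.
case/card_gt0P => v; rewrite inE => /andP[vs ve].
have eE : e = v |: [set v in s].
  apply/esym/eqP; rewrite eqEcard subUset sub1set ve se /= cardsU1 vs ce cs.
  by case: (k) k0.
apply/imsetP; exists v => //; rewrite inE /edge.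
suff -> : [set x in v :: s] = e by [].
by rewrite eE; apply/setP => x; rewrite !inE.
Qed.

Lemma min_degree_dirac (R : realType) k n (G : kgraph k 'I_n) (alpha : R) q0 :
  (2 < k)%N -> (4 <= q0)%N -> 8 <= alpha * q0%:R -> (k * q0 <= n)%N ->
  (forall S : {set 'I_n}, #|S| = (k - 1)%N ->
     Num.min (min_label S)%:R ((n%:R - k%:R + 2) / 2) + alpha * n%:R
       <= (degree G S)%:R) ->
  dirac (@nat_of_ord n) k (#|'I_n| %/ q0) (edges G).
Proof.
move=> k2 q04 aq kn HG; rewrite card_ord.
have q0p : (0 < q0)%N by lia.
have a0 : 0 <= alpha.
  have : 0 < alpha * q0%:R by lra.
  by rewrite pmulr_lgt0 ?ltr0n // => /ltW.
have bn : 8 * (n %/ q0)%:R <= alpha * n%:R.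
  apply: le_trans (_ : alpha * q0%:R * (n %/ q0)%:R <= _); first by apply: ler_wpM2r.
  by rewrite -mulrA; apply: ler_wpM2l => //; rewrite -natrM ler_nat mulnC leq_trunc_div.
split=> //.
- exact: edges_uniform.
- exact: card_ord_lt.
- move=> s ss us.
  have cs : #|[set v in s]| = (k - 1)%N by rewrite cardsE (card_uniqP us) ss subn1.
  have /card_gt0P[u uS] : (0 < #|[set v in s]|)%N by rewrite cs; lia.
  have [v0 v0S mE] := min_labelP uS.
  exists v0; split; first by move: v0S; rewrite inE.
    by move=> v vs; rewrite -ltnS -mE; apply: min_label_le; rewrite inE.
  have := HG _ cs; rewrite mE.
  have /(_ ltac:(lia)) := degree_le_nbr G _ ss us; rewrite -(ler_nat R).
  set d := #|nbr _ _|; rewrite /is_top card_ord => h1 h2.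
  move: (v0.+1) (n %/ q0)%N bn h1 h2 => m b bn h1 h2; clearbody d.
  have toR (x y z t c : nat) : (x + 2 + c * y <= 2 * z + t)%N =
      (x%:R + 2 + c%:R * y%:R <= 2 * z%:R + t%:R :> R).
    by rewrite -!natrM -!natrD ler_nat.
  case: ifP => [ht|/negbT]; last rewrite -ltnNge => /ltnW ht.
    have := toR n 0%N m k 0%N; rewrite mul0n addn0 mul0r addr0 ht toR.
    move: h2; rewrite minElt; case: ifP => Hm /[swap] /esym; move: Hm; lra.
  rewrite -(ler_nat R) natrD natrM.
  have : (2 * m%:R + k%:R <= n%:R + 2 :> R) by rewrite -natrM -!natrD ler_nat.
  move: h2; rewrite minElt; case: ifP => Hm; move: Hm; lra.
- by rewrite leq_divRL.
- rewrite card_ord; apply: leq_trans (leq_trunc_div n q0).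
  by rewrite mulnC leq_mul2l q04 orbT.
Qed.

Theorem corollary1p3 (R : realType) (k : nat) (alpha : R) :
  (3 <= k)%N -> 0 < alpha -> alpha < 1 / 4 ->
  exists n0 : nat, forall n : nat, (n0 <= n)%N ->
  forall G : kgraph k 'I_n,
    (forall S : {set 'I_n}, #|S| = (k - 1)%N ->
       Num.min (min_label S)%:R ((n%:R - k%:R + 2) / 2) + alpha * n%:R
         <= (degree G S)%:R) ->
    exists c : seq 'I_n, tight_hamiltonian_cycle G c.
Proof.
move=> k2 a0 a4; pose q0 := (Num.truncn (8 / alpha)).+1.
have aq : 8 <= alpha * q0%:R.
  by rewrite mulrC -ler_pdivrMr //; apply: ltW; exact: truncnS_gt.
have q04 : (4 <= q0)%N.
  rewrite -(ler_nat R) leNgt; apply/negP => q4.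
  have : alpha * q0%:R <= 1 / 4 * 4 by apply: ler_pM => //; exact: ltW.
  by move: aq; lra.
have [N0 HN] := @dirac_hamiltonian R k q0 k2 q04.
exists (N0 + k * q0)%N => n Hn G HG.
have [||c [uc ac kc tc]] := HN 'I_n (@nat_of_ord n) (edges G).
- by rewrite card_ord; apply: leq_trans Hn; apply: leq_addr.
- apply: (min_degree_dirac k2 q04 aq) HG; apply: leq_trans Hn; exact: leq_addl.
exists c; apply: cyc_tight_hamiltonian => //; exact: ltnW (ltnW k2).
Qed.
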